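(* Let $a\in\mathcal{EAF}^*$ and $b_0\in\mathcal{EAT}^*$. Then $$S_{S_f(b_0)}(a)=S_f(b_c\star a),\qquad\text{with } b_c\star a=(b_c\otimes a)\circ\Delta_{CEM},$$ where $b_c$ is the character of $\mathcal{CEF}^1$ that extends $b_0$ and $\Delta_{CEM}:\mathcal{EAF}\to\mathcal{CEF}^1\otimes\mathcal{EAF}$ is the CEM coaction over exotic aromatic forests.
   Context: **Aromatic forests.** Consider graphs $\pi=(V,E,S)$: $V$ is a finite set of vertices, $E\subset V\times V$ a set of directed edges (loops allowed; an edge $(v,w)$ goes from $v$ to $w$, $v$ is a predecessor of $w$ and $w$ the successor of $v$), each vertex having at most one successor, and $S$ is a set of unordered pairs of vertices called stolons; stolons link vertices without successor and each vertex is in at most one stolon. Vertices without successor that are not in a stolon are roots; vertices not in stolons and without predecessors are leaves. A connected component is a tree (it has exactly one root) or an aroma (no root; it contains a stolon or a directed cycle). Aromatic forests are isomorphism classes of such graphs, including the empty graph $\mathbf 1$. **Exotic aromatic forests.** An exotic aromatic forest is an aromatic forest whose vertices are decorated by $\{\bullet\}\cup\{1,2,3,\dots\}$ such that all vertices that are not leaves are black ($\bullet$), and every natural number decorates either zero or exactly two vertices (which are leaves). Forests differing only by a permutation of the natural numbers are identified. A pair of leaves with the same number is called a liana; $L$ is the set of lianas and $V_\bullet$ the set of black vertices. $EAF$ is the set of exotic aromatic forests and $EAT$ the subset of those with exactly one root (exotic aromatic trees); $\mathcal{EAF},\mathcal{EAT}$ are the real vector spaces they span. $\sigma(\pi)$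 is the number of automorphisms of $\pi$. **S-series.** For a smooth vector field $f$ on $\mathbb R^d$ and a smooth test function $\phi$, lower indices denoting partial derivatives, $$F_{\mathcal E}(\pi)[\phi]=\sum_{i_v=1,\dots,d;\ v\in V}\delta_{I_{S\cup L}}\Big(\prod_{v\in V_\bullet} f^{i_v}_{I_{\Pi(v)}}\Big)\phi_{I_R},$$ where $R$ is the set of roots, $\Pi(v)$ the set of predecessors of $v$, $I_X=(i_x)_{x\in X}$, and $\delta_{I_{S\cup L}}$ forces $i_x=i_y$ for each stolon or liana $\{x,y\}$. For $a\in\mathcal{EAF}^*$ the exotic aromatic S-series is the formal series $S_f(a)=\sum_{\pi\in EAF}\frac{a(\pi)}{\sigma(\pi)}F_{\mathcal E}(\pi)$. For $b_0\in\mathcal{EAT}^*$ (extended by $0$ to $\mathcal{EAF}$), $S_f(b_0)$ is a formal sum of first order differential operators and is identified with a formal vector field; $S_{S_f(b_0)}(a)$ is the S-series in which $f$ is replaced by this formal vector field, expanded formally. **Clumped forests.** $\mathcal{CEF}^1:=S(\mathcal{EAT})$ is the symmetric algebra over $\mathbb R$ of $\mathcal{EAT}$, i.e. its basis consists of commutative monomials $\tau_1\cdots\tau_n$ of exotic aromatic trees, each aroma being attached to a specific tree. The character $b_c$ is defined by $b_c(\mathbf 1)=1$, $b_c(\tau_1\cdots\tau_n)=b_0(\tau_1)\cdots b_0(\tau_n)$. **CEM coaction.** $\Delta_{CEM}(\pi)=\sum_{p\subset\pi}p\otimes\pi/_p$, where the sum is over all clumped exotic subforests $p\in\mathcal{CEF}^1$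 of $\pi$ covering all black vertices. Explicitly, $p$ is obtained by choosing a subset of the vertices containing $V_\bullet$, a subset of the edges and stolons between chosen vertices, and an assignment of each resulting rootless component (aroma) to one of the resulting rooted components, such that each resulting aromatic tree is an exotic aromatic tree (in particular the two vertices of a liana lie in the same aromatic tree of $p$ or are both outside $p$). $\pi/_p$ is obtained by contracting each aromatic tree of $p$ to a single black vertex: edges and stolons not in $p$ are kept, so the contracted vertex inherits the outgoing edge, stolon, or root status of the root of the contracted tree in $\pi$, and all non-contracted incoming edges; $\pi/_p$ must be an exotic aromatic forest. If $\pi$ has no valid subforest (no black vertices), $\Delta_{CEM}(\pi)=\mathbf 1\otimes\pi$.
   Formalization: Adds the hypothesis that a vanishes on all forests with stolons or b_0 vanishes on all trees with a numbered root; otherwise the identity fails, e.g. a the indicator of two black vertices joined by a stolon, b_0 = 1 on the black vertex and on the tree of grad div f, 0 elsewhere. *)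

(* Defs.v *)
From HB Require Import structures.
From mathcomp Require Import all_boot all_order all_algebra all_fingroup.
From mathcomp Require Import generic_quotient finmap.
From mathcomp Require Import monalg.
From mathcomp Require Import reals topology normedtype derive.

Set Implicit Arguments.
Unset Strict Implicit.
Unset Printing Implicit Defensive.

Import Order.TTheory GRing.Theory Num.Theory numFieldNormedType.Exports.
Local Open Scope quotient_scope.
Local Open Scope ring_scope.

(* Decorations by natural numbers are only relevant up to a permutation of the
   numbers, so they are encoded by the set of lianas, i.e. of pairs of vertices
   carrying the same number; the other vertices are black. *)
Record graph (V : finType) := Graph {
  edges : {set V * V};
  stolons : {set {set V}};
  lianas : {set {set V}} }.

Section GraphFinType.
Variable V : finType.

Definition graph_to (G : graph V) := (edges G, stolons G, lianas G).
Definition graph_of (x : {set V * V} * {set {set V}} * {set {set V}}) :=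
  Graph x.1.1 x.1.2 x.2.
Lemma graph_toK : cancel graph_to graph_of. Proof. by case. Qed.

HB.instance Definition _ := Finite.copy (graph V) (can_type graph_toK).
End GraphFinType.

Section Graphs.
Variables (V : finType) (G : graph V).

Definition preds (v : V) := [set u | (u, v) \in edges G].
Definition has_succ (v : V) := [exists w, (v, w) \in edges G].
Definition in_stolon (v : V) := v \in cover (stolons G).
Definition is_root (v : V) := ~~ has_succ v && ~~ in_stolon v.
Definition leaf (v : V) := (preds v == set0) && ~~ in_stolon v.
Definition black (v : V) := v \notin cover (lianas G).
Definition roots := [set v | is_root v].

(* Disjoint unordered pairs of distinct vertices. *)
Definition pairing (P : {set {set V}}) :=
  trivIset P && [forall s in P, #|s| == 2%N].

Definition is_aromatic :=
  [&& [forall v, forall w, forall w',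
         ((v, w) \in edges G) && ((v, w') \in edges G) ==> (w == w')],
      pairing (stolons G) & [forall v, in_stolon v ==> ~~ has_succ v]].

Definition is_eaf :=
  [&& is_aromatic, pairing (lianas G) & [forall v, ~~ black v ==> leaf v]].

Definition is_eat := is_eaf && (#|roots| == 1%N).
End Graphs.

(* For f injective this is the graph induced by G on the image of f, with its
   vertices renamed along f. *)
Definition pull (U V : finType) (f : U -> V) (G : graph V) : graph U :=
  Graph [set e | (f e.1, f e.2) \in edges G]
        [set s : {set U} | f @: s \in stolons G]
        [set s : {set U} | f @: s \in lianas G].

Definition induced (V : finType) (G : graph V) (A : {set V}) : graph 'I_#|A| :=
  pull (@enum_val V (mem A)) G.

Section Isomorphism.
Variable n : nat.

Definition eaf_graph := {G : graph 'I_n | is_eaf G}.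

Definition iso (G H : eaf_graph) :=
  [exists s : {perm 'I_n}, pull s (val G) == val H].

Lemma pull_id (G : graph 'I_n) : pull id G = G.
Proof.
case: G => E S L; rewrite /pull /=; congr Graph; apply/setP => x;
  rewrite inE ?imset_id //.
by case: x.
Qed.

Lemma pull_comp (f g : 'I_n -> 'I_n) (G : graph 'I_n) :
  pull f (pull g G) = pull (g \o f) G.
Proof.
by rewrite /pull /=; congr Graph; apply/setP => x;
  rewrite !inE //= -imset_comp.
Qed.

Lemma eq_pull (f g : 'I_n -> 'I_n) (G : graph 'I_n) :
  f =1 g -> pull f G = pull g G.
Proof.
move=> fg; rewrite /pull; congr Graph; apply/setP => x;
  by rewrite !inE ?fg // (eq_imset _ fg).
Qed.

Lemma iso_refl : reflexive iso.
Proof.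
move=> G; apply/existsP; exists 1%g.
by rewrite (eq_pull (g := id)) ?pull_id // => i; rewrite perm1.
Qed.

Lemma iso_sym : symmetric iso.
Proof.
suff h G H : iso G H -> iso H G by move=> G H; apply/idP/idP; exact: h.
case/existsP => s /eqP sE; apply/existsP; exists (s^-1)%g.
by rewrite -sE pull_comp (eq_pull (g := id)) ?pull_id // => i /=; rewrite permKV.
Qed.

Lemma iso_trans : transitive iso.
Proof.
move=> H G K /existsP[s /eqP sE] /existsP[t /eqP tE]; apply/existsP.
exists (t * s)%g; rewrite -tE -sE pull_comp; apply/eqP/eq_pull => i /=.
by rewrite permM.
Qed.

Canonical iso_equiv := EquivRel iso iso_refl iso_sym iso_trans.

Definition EAF_ := {eq_quot iso_equiv}.
End Isomorphism.

HB.instance Definition _ n := EqQuotient.on (EAF_ n).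
HB.instance Definition _ n := Choice.on (EAF_ n).

Lemma EAF_reprK n :
  pcancel (fun t : EAF_ n => repr t) (fun G => Some (\pi_(EAF_ n) G)).
Proof. by move=> t; rewrite reprK. Qed.

HB.instance Definition _ n :=
  Choice_isCountable.Build (EAF_ n) (pcan_pickleK (@EAF_reprK n)).
HB.instance Definition _ n :=
  isFinite.Build (EAF_ n) (pcan_enumP (@EAF_reprK n)).

Definition rep n (t : EAF_ n) : graph 'I_n := val (repr t).

Definition EAF := {n : nat & EAF_ n}.
HB.instance Definition _ := Choice.on EAF.

Definition EAT := {t : EAF | is_eat (rep (tagged t))}.
HB.instance Definition _ := Choice.on EAT.

Definition eaf_class n (G : graph 'I_n) (hG : is_eaf G) : EAF :=
  Tagged EAF_ (\pi_(EAF_ n) (exist _ G hG)).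

Lemma roots_pull n (s : {perm 'I_n}) (G : graph 'I_n) :
  roots (pull s G) = s @^-1: roots G.
Proof.
apply/setP => v; rewrite !inE /is_root /has_succ /in_stolon; congr (~~ _ && ~~ _).
  apply/existsP/existsP => -[w]; first by rewrite inE /= => ?; exists (s w).
  by move=> h; exists (s^-1 w)%g; rewrite inE /= permKV.
apply/bigcupP/bigcupP => -[A].
  by rewrite inE => ? vA; exists (s @: A) => //; rewrite imset_f.
move=> AS vA; exists (s @^-1: A); rewrite inE //=.
suff -> : s @: (s @^-1: A) = A by [].
apply/setP => x; apply/imsetP/idP => [[y]|xA]; first by rewrite inE => ? ->.
by exists (s^-1 x)%g; rewrite ?inE permKV.
Qed.

Lemma is_eat_eaf n (G : graph 'I_n) : is_eat G -> is_eaf G.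
Proof. by case/andP. Qed.

Lemma is_eat_class n (G : graph 'I_n) (hG : is_eaf G) :
  is_eat (rep (tagged (eaf_class hG))) = is_eat G.
Proof.
rewrite /is_eat hG /rep (valP (repr _)) /=.
have /eqquotP/existsP[s /eqP /= sE] := reprK (\pi_(EAF_ n) (exist _ G hG)).
by rewrite -[in RHS]sE roots_pull card_preimset //; exact: perm_inj.
Qed.

Definition eat_class n (G : graph 'I_n) (hG : is_eat G) : EAT :=
  exist _ (eaf_class (is_eat_eaf hG)) (etrans (is_eat_class _) hG).

Definition sigma n (G : graph 'I_n) := #|[set s : {perm 'I_n} | pull s G == G]|.

(* A clumped subforest is given by the vertex sets of its aromatic trees and by
   its edges and stolons.  Grouping the connected components into sets with
   exactly one root is the same as assigning every aroma to a rooted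
   component. *)
Record presubforest (V : finType) := PreSubforest {
  clumps : {set {set V}};
  sub_edges : {set V * V};
  sub_stolons : {set {set V}} }.

Section PreSubforestFinType.
Variable V : finType.

Definition presubforest_to (p : presubforest V) :=
  (clumps p, sub_edges p, sub_stolons p).
Definition presubforest_of (x : {set {set V}} * {set V * V} * {set {set V}}) :=
  PreSubforest x.1.1 x.1.2 x.2.
Lemma presubforest_toK : cancel presubforest_to presubforest_of.
Proof. by case. Qed.

HB.instance Definition _ :=
  Finite.copy (presubforest V) (can_type presubforest_toK).
End PreSubforestFinType.

Section Subforests.
Variables (V : finType) (G : graph V).

Section Contraction.
Variable p : presubforest V.

Definition covered := cover (clumps p).

Definition clump_graph (B : {set V}) : graph 'I_#|B| :=
  induced (Graph (sub_edges p) (sub_stolons p) (lianas G)) B.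

(* The vertices of the contraction, as a partition of V: the clumps, and the
   singletons of the vertices outside the subforest. *)
Definition blocks : {set {set V}} :=
  clumps p :|: [set [set v] | v in ~: covered].
Definition block (v : V) : {set V} := pblock blocks v.

(* Clumps become black because the lianas they contain are discarded. *)
Definition contraction : graph 'I_#|blocks| :=
  induced
    (Graph [set (block e.1, block e.2) | e in edges G :\: sub_edges p]
           [set block @: s | s : {set V} in stolons G :\: sub_stolons p]
           [set block @: l | l : {set V} in lianas G & [disjoint l & covered]])
    blocks.

Definition is_subforest :=
  [&& trivIset (clumps p),
      [forall v, black G v ==> (v \in covered)],
      sub_edges p \subset edges G,
      [forall e in sub_edges p,
         exists B in clumps p, (e.1 \in B) && (e.2 \in B)],
      sub_stolons p \subset stolons G,
      [forall s in sub_stolons p, exists B in clumps p, s \subset B],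
      [forall l in lianas G,
         [disjoint l & covered] || [exists B in clumps p, l \subset B]],
      [forall B in clumps p, is_eat (clump_graph B)] &
      is_eaf contraction].
End Contraction.

Definition subforest := {p : presubforest V | is_subforest p}.

Lemma subforest_clump (p : subforest) (B : {set V}) :
  B \in clumps (val p) -> is_eat (clump_graph (val p) B).
Proof. by case: p => p /= /and5P[_ _ _ _ /and5P[_ _ _ /forall_inP + _]]; apply. Qed.

Lemma subforest_contraction (p : subforest) : is_eaf (contraction (val p)).
Proof. by case: p => p /= /and5P[_ _ _ _ /and5P[]]. Qed.

Definition clump_tree (p : subforest) (B : {B | B \in clumps (val p)}) : EAT :=
  eat_class (subforest_clump (valP B)).

Definition clump_monomial (p : subforest) : {cmonom EAT} :=
  \big[mmul/mone]_(B : {B | B \in clumps (val p)}) ucm (clump_tree B).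

Definition contracted (p : subforest) : EAF :=
  eaf_class (subforest_contraction p).
End Subforests.

Section Coaction.
Variable R : realType.

(* CEF^1 = S(EAT) is {malg R[{cmonom EAT}]}; its tensor product with the span
   of EAF has the pairs (monomial, forest) as a basis. *)
Definition CEM (t : EAF) : {malg R[({cmonom EAT} * EAF)%type]} :=
  \sum_(p : subforest (rep (tagged t))) << (clump_monomial p, contracted p) >>.

(* Linear functionals are given by their values on the basis. *)
Definition character (b0 : EAT -> R) (m : {cmonom EAT}) : R :=
  \prod_(t <- finsupp m) b0 t ^+ m t.

Definition tensor (K1 K2 : choiceType) (u : K1 -> R) (v : K2 -> R)
  (k : K1 * K2) : R := u k.1 * v k.2.

Definition star (b0 : EAT -> R) (a : EAF -> R) (t : EAF) : R :=
  mmap idfun (tensor (character b0) a) (CEM t).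

Definition extend0 (b0 : EAT -> R) (t : EAF) : R := oapp b0 0 (insub t).
End Coaction.

Section Calculus.
Variables (R : realType) (d : nat).
Implicit Types (g : 'rV[R]_d -> R) (x : 'rV[R]_d).

(* Iterated partial derivative with respect to the coordinates listed in s. *)
Definition partial (s : seq 'I_d) (g : 'rV[R]_d -> R) : 'rV[R]_d -> R :=
  foldr (fun i k x => derive k x (delta_mx 0 i)) g s.

Definition smooth (g : 'rV[R]_d -> R) :=
  forall s, continuous (partial s g) /\
            forall i x, derivable (partial s g) x (delta_mx 0 i).

Definition smooth_field (f : 'rV[R]_d -> 'rV[R]_d) :=
  forall i, smooth (fun x => f x 0 i).

(* F_E with a separate vector field at every black vertex; F_E itself is the
   case of a constant family. *)
Definition elem_diff n (G : graph 'I_n) (f : 'I_n -> 'rV[R]_d -> 'rV[R]_d)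
    (phi : 'rV[R]_d -> R) (x : 'rV[R]_d) : R :=
  \sum_(i : {ffun 'I_n -> 'I_d})
    [forall s in stolons G :|: lianas G,
       forall u in s, forall v in s, i u == i v]%:R *
    (\prod_(v | black G v)
       partial [seq i u | u <- enum (preds G v)] (fun y => f v y 0 (i v)) x) *
    partial [seq i r | r <- enum (roots G)] phi x.

(* Formal series are graded by the number of vertices: there are infinitely
   many forests with a given number of black vertices, but finitely many with a
   given number of vertices.  The n-th term of a series of differential
   operators (of vector fields) is its homogeneous component of degree n. *)
Definition operator_series := nat -> ('rV[R]_d -> R) -> 'rV[R]_d -> R.
Definition field_series := nat -> 'rV[R]_d -> 'rV[R]_d.

Definition S_series (f : 'rV[R]_d -> 'rV[R]_d) (a : EAF -> R) :
    operator_series := fun n phi x =>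
  \sum_(t : EAF_ n)
    a (Tagged EAF_ t) / (sigma (rep t))%:R *
    elem_diff (rep t) (fun=> f) phi x.

(* A first order operator sum_i g^i d_i is identified with the vector field g,
   whose components are its values on the coordinate functions. *)
Definition field_of (D : operator_series) : field_series := fun n x =>
  \row_i D n (fun y => y 0 i) x.

(* S-series along a formal vector field g = sum_(m > 0) g_m, expanded by
   multilinearity of F_E in the vector fields: m v is the degree of the term of
   g chosen at the black vertex v, and a numbered vertex has degree 1.  As all
   degrees are positive, forests with more than n vertices do not contribute to
   degree n. *)
Definition S_series_formal (g : field_series) (a : EAF -> R) :
    operator_series := fun n phi x =>
  \sum_(k < n.+1) \sum_(t : EAF_ k)
    a (Tagged EAF_ t) / (sigma (rep t))%:R *
    \sum_(m : {ffun 'I_k -> 'I_n.+1} |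
             [&& [forall v, (0 < m v)%N],
                 [forall v, ~~ black (rep t) v ==> (m v == 1%N :> nat)] &
                 (\sum_v m v == n)%N])
      elem_diff (rep t) (fun v => g (m v)) phi x.
End Calculus.

(* Substituting a tree with a numbered root at an end of a stolon puts a
   numbered vertex into a stolon.  The result is not an exotic aromatic forest,
   so CEM does not account for it: if a is the indicator of the forest made of
   two black vertices linked by a stolon, and b0 is 1 on the black vertex and on
   the tree representing grad div f (a numbered root, and a black vertex with a
   loop that is the successor of the other leaf of the liana) and 0 elsewhere,
   then S_{S_f(b0)}(a)[phi] = 1/2 |f + grad div f|^2 phi, but
   S_f(star b0 a)[phi] = 1/2 |f|^2 phi. *)

Definition has_stolon (t : EAF) := stolons (rep (tagged t)) != set0.

Definition numbered_root (t : EAT) :=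
  [exists v, is_root (rep (tagged (val t))) v && ~~ black (rep (tagged (val t))) v].

(* Main.v *)
Require Import Defs.
From HB Require Import structures.
From mathcomp Require Import all_boot all_order all_algebra all_fingroup.
From mathcomp Require Import generic_quotient zify.
From mathcomp Require Import monalg.
From mathcomp Require Import boolp reals topology normedtype derive.

Set Implicit Arguments.
Unset Strict Implicit.
Unset Printing Implicit Defensive.

Import Defs.
Import Order.TTheory GRing.Theory Num.Theory numFieldNormedType.Exports.
Local Open Scope quotient_scope.
Local Open Scope ring_scope.

(** Both sides are compared as sums over labeled graphs. By orbit counting, a
sum over the forests with [n] vertices weighted by [1 / sigma] is [1 / n!] times
a sum over the graphs on [n] labeled vertices ([sum_EAF_labeled]).

In the star product, a subforest of a labeled graph [G] with [k] blocks becomes,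
once the blocks are ordered, a map [c] from the vertices of [G] to [k] points
together with the subgraph [D] formed by its trees: [D] is an exotic aromatic
tree on each fiber of [c], a single vertex on the fibers outside the subforest.
The contraction is the image [quot c G D] under [c] of the part of [G] that is
not in [D]. Dividing by the [k!] orderings expresses the star product as a sum
over such pairs [(c, D)] ([star_on_sum]).

In the substituted series, a forest [H] with [k] vertices contributes in degree
[n] through the choices of degrees [m v] with sum [n] for the components of the
vector field put at its vertices. The factorials in the S-series of [f] turn
these choices into maps [c] from [n] points to the vertices of [H] with fibers of
sizes [m v] ([sum_multinomial]), and the trees of the component of degree [m v]
into trees on the fiber over [v]. Such a family of trees is again a graph [D],
called a clumping ([prod_sum_glue], [degree_sumE]).

What remains is an identity for fixed [c], [H] and [D] ([sum_substitution]). An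
edge from [u] to [v] in [H] differentiates the elementary differential of the tree
over [v], in the direction of the index of the root of the tree over [u]. By the
Leibniz rule ([partial_prod]) the derivative falls on one of the black vertices
of that tree. Choosing such a vertex for every edge of [H] amounts to choosing a
graph [G] that contains [D] and satisfies [quot c G D = H], and the resulting
product is the term of the elementary differential of [G]. The symmetry of second
derivatives ([schwarz]) makes the order of the differentiations immaterial. The
graph [G] can fail to be a forest only if a numbered root of a tree lies in a
stolon, and then the hypothesis makes the coefficient vanish
([stolon_weight0]). *)

(** * Partial derivatives of smooth functions *)

Section Schwarz.
Variables (R : realType) (V : normedModType R).
Implicit Types (F : V -> R) (x u v : V).

Lemma is_derive_line F x v (t : R) : derivable F (x + t *: v) v ->
  is_derive t 1 (fun s : R => F (x + s *: v)) ('D_v F (x + t *: v)).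
Proof.
have E : (fun h : R => h^-1 *: (((fun s : R => F (x + s *: v)) \o shift t) (h *: 1)
      - F (x + t *: v))) =
    (fun h : R => h^-1 *: ((F \o shift (x + t *: v)) (h *: v) - F (x + t *: v))).
  apply/funext => h /=; congr (_ *: (F _ - _)).
  by rewrite [h%:A]mulr1 scalerDl addrCA.
by move=> dF; split; rewrite /derivable /derive E.
Qed.

Lemma MVT_line F x v (h : R) : 0 < h -> (forall y, derivable F y v) ->
  exists2 t, 0 < t < h & F (x + h *: v) - F x = 'D_v F (x + t *: v) * h.
Proof.
move=> h0 dF.
have [||t] := @MVT R (fun s => F (x + s *: v)) (fun s => 'D_v F (x + s *: v)) 0 h h0.
- by move=> t _; apply: is_derive_line.
- apply: derivable_within_continuous => t _.
  by have [] := is_derive_line (dF (x + t *: v)).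
by rewrite in_itv /= scale0r addr0 subr0 => ? ?; exists t.
Qed.

(** Two applications of the mean value theorem: along [u] to the increment of
[F] in the direction [v], then along [v] to ['D_u F]. *)
Lemma second_difference F x u v (h : R) : 0 < h ->
    (forall y, derivable F y u) -> (forall y, derivable ('D_u F) y v) ->
  exists2 st : R * R, (0 < st.1 < h) && (0 < st.2 < h) &
    F (x + h *: v + h *: u) - F (x + h *: u) - (F (x + h *: v) - F x) =
    'D_v ('D_u F) (x + st.1 *: u + st.2 *: v) * h * h.
Proof.
move=> h0 dF dF2; pose G y := F (y + h *: v) - F y.
have shiftE y : (fun k : R => k^-1 *: (((fun z => F (z + h *: v)) \o shift y) (k *: u)
      - F (y + h *: v))) =
    (fun k : R => k^-1 *: ((F \o shift (y + h *: v)) (k *: u) - F (y + h *: v))).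
  by apply/funext => k /=; rewrite addrA.
have dG y : is_derive y u G ('D_u F (y + h *: v) - 'D_u F y).
  have d1 : is_derive y u (fun z => F (z + h *: v)) ('D_u F (y + h *: v)).
    by split; rewrite /derivable /derive shiftE //; exact: dF.
  have d2 : is_derive y u F ('D_u F y) by apply: derivableP.
  exact: (is_deriveB d1 d2).
have dG1 y : derivable G y u by have [] := dG y.
have [s sh sE] := MVT_line x h0 dG1.
have [t th tE] := MVT_line (x + s *: u) h0 dF2.
exists (s, t); first by rewrite /= sh th.
rewrite -tE -[(_ - _) * h](_ : 'D_u G (x + s *: u) * h = _); last first.
  by have [_ ->] := dG (x + s *: u).
rewrite -sE /G [x + h *: u + _]addrAC //.
Qed.

(** The second difference of [F] on a small square does not change when the two
directions are exchanged. It is a value of either mixed derivative near [x], and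
both are continuous. *)
Lemma schwarz F x u v :
    (forall y, derivable F y u) -> (forall y, derivable F y v) ->
    (forall y, derivable ('D_u F) y v) -> (forall y, derivable ('D_v F) y u) ->
    continuous ('D_v ('D_u F)) -> continuous ('D_u ('D_v F)) ->
  'D_v ('D_u F) x = 'D_u ('D_v F) x.
Proof.
move=> Fu Fv Fuv Fvu c1 c2; apply/eqP; rewrite -subr_eq0 -normr_eq0.
apply/negPn/negP => ne0.
set A := 'D_v ('D_u F) x in ne0 *; set B := 'D_u ('D_v F) x in ne0 *.
(* Each mixed derivative stays within half of the gap near [x]. *)
have e0 : 0 < `|A - B| / 2 by rewrite divr_gt0 // lt_def ne0 normr_ge0.
have /cvgrPdist_lt/(_ _ e0)/nbhs_ballP[r1 /= r10 b1] := c1 x.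
have /cvgrPdist_lt/(_ _ e0)/nbhs_ballP[r2 /= r20 b2] := c2 x.
have {}b1 y : `|x - y| < r1 -> `|A - 'D_v ('D_u F) y| < `|A - B| / 2.
  by move=> xy; apply: b1; rewrite -ball_normE.
have {}b2 y : `|x - y| < r2 -> `|B - 'D_u ('D_v F) y| < `|A - B| / 2.
  by move=> xy; apply: b2; rewrite -ball_normE.
pose r := Num.min r1 r2; have r0 : 0 < r by rewrite lt_min r10 r20.
(* The size of the square is [r / N], which keeps it in the ball of radius [r]. *)
pose N := `|u| + `|v| + 1.
have N0 : 0 < N by rewrite ltr_wpDl // addr_ge0.
pose h := r / N; have h0 : 0 < h by rewrite divr_gt0.
have small s t (a b : V) : `|a| + `|b| + 1 = N -> 0 < s < h -> 0 < t < h ->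
    `|x - (x + s *: a + t *: b)| < r.
  move=> abN /andP[s0 sh] /andP[t0 th].
  rewrite -addrA opprD addNKr normrN.
  apply: le_lt_trans (ler_normD _ _) _; rewrite !normrZ !gtr0_norm //.
  apply: (@le_lt_trans _ _ (h * `|a| + h * `|b|)).
    by apply: lerD; apply: ler_wpM2r => //; apply: ltW.
  rewrite -mulrDr -[ltRHS](@divfK _ N) ?gt_eqF // -/h ltr_pM2l //.
  by rewrite -abN ltrDl.
have [[s t] /= /andP[sh th] E1] := second_difference x h0 Fu Fuv.
have [[t' s'] /= /andP[th' sh'] E2] := second_difference x h0 Fv Fvu.
have := small s t u v erefl sh th; rewrite lt_min => /andP[/b1 /= l1 _].
have vuN : `|v| + `|u| + 1 = N by rewrite /N (addrC `|u|).
have := small t' s' v u vuN th' sh'; rewrite lt_min => /andP[_ /b2 /= l2].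
have E : 'D_v ('D_u F) (x + s *: u + t *: v) = 'D_u ('D_v F) (x + t' *: v + s' *: u).
  have hne : h != 0 by rewrite gt_eqF.
  apply: (mulIf hne); apply: (mulIf hne).
  have swap (a b c e : R) : a - b - (c - e) = a - c - (b - e).
    by rewrite !opprB !addrA addrAC [in RHS]addrAC; congr (_ + _); rewrite addrAC.
  by apply: etrans (esym E1) (etrans _ E2); rewrite swap (addrAC x (h *: v)).
rewrite -E in l2.
have := ltrD l1 l2; rewrite -splitr [X in _ + X]distrC => /(le_lt_trans (ler_normD _ _)).
by rewrite addrA subrK ltxx.
Qed.
End Schwarz.

Section Smooth.
Import classical_sets.
Variables (R : realType) (d : nat).
Implicit Types (g h : 'rV[R]_d -> R) (s : seq 'I_d).

Definition deriv1 (i : 'I_d) g := fun x => derive g x (delta_mx 0 i).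

(** Smoothness quantifies over all lists of indices at once. This recursive
form, one derivative at a time, is the one that passes to products: the
derivative of a product is a sum of products of one class less. *)
Fixpoint diffclass n g : Prop := continuous g /\
  if n is m.+1 then
    forall i, (forall x, derivable g x (delta_mx 0 i)) /\ diffclass m (deriv1 i g)
  else True.

Lemma partial_cat s1 s2 g : partial (s1 ++ s2) g = partial s1 (partial s2 g).
Proof. exact: foldr_cat. Qed.

Lemma smooth_partial s g : smooth g -> smooth (partial s g).
Proof. by move=> gs t; rewrite -partial_cat; apply: gs. Qed.

Lemma smooth_diffclass g : smooth g <-> forall n, diffclass n g.
Proof.
split=> [gs n|].
  elim: n g gs => [|n IHn] g gs /=; first by split => //; case: (gs [::]).
  split=> [|i]; first by case: (gs [::]).
  split; first by case: (gs [::]).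
  by apply: IHn; apply: (@smooth_partial [:: i]).
move=> gC s; elim/last_ind: s g gC => [|s i IHs] g gC.
  by have [? gD] := gC 1%N; split=> // i; case: (gD i).
rewrite -cats1 partial_cat; apply: IHs => n.
by case: (gC n.+1) => _ /(_ i)[].
Qed.

Lemma deriv1D i g h : (forall x, derivable g x (delta_mx 0 i)) ->
  (forall x, derivable h x (delta_mx 0 i)) ->
  deriv1 i (fun x => g x + h x) = fun x => deriv1 i g x + deriv1 i h x.
Proof. by move=> dg dh; apply/funext => x; exact: (deriveD (dg x) (dh x)). Qed.

Lemma deriv1M i g h : (forall x, derivable g x (delta_mx 0 i)) ->
  (forall x, derivable h x (delta_mx 0 i)) ->
  deriv1 i (fun x => g x * h x) = fun x => g x * deriv1 i h x + deriv1 i g x * h x.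
Proof.
move=> dg dh; apply/funext => x; rewrite [deriv1 i g x * _]mulrC.
exact: (deriveM (dg x) (dh x)).
Qed.

Lemma diffclassW n g : diffclass n.+1 g -> diffclass n g.
Proof.
elim: n g => [|n IHn] g [gc gD] //; split=> // i.
by have [? ?] := gD i; split=> //; apply: IHn.
Qed.

Lemma diffclassD n g h :
  diffclass n g -> diffclass n h -> diffclass n (fun x => g x + h x).
Proof.
elim: n g h => [|n IHn] g h [gc gD] [hc hD]; (split; first by move=> x; exact: (continuousD (gc x) (hc x))) => //.
move=> i; have [dg Cg] := gD i; have [dh Ch] := hD i.
split; first by move=> x; exact: (derivableD (dg x) (dh x)).
by rewrite deriv1D //; apply: IHn.
Qed.

Lemma diffclassM n g h :
  diffclass n g -> diffclass n h -> diffclass n (fun x => g x * h x).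
Proof.
elim: n g h => [|n IHn] g h Cg Ch; have [gc gD] := Cg; have [hc hD] := Ch;
  (split; first by move=> x; exact: (continuousM (gc x) (hc x))) => //.
move=> i; have [dg Cg1] := gD i; have [dh Ch1] := hD i.
split; first by move=> x; exact: (derivableM (dg x) (dh x)).
rewrite deriv1M //; apply: diffclassD; apply: IHn => //.
  exact: diffclassW.
exact: diffclassW.
Qed.

Lemma deriv1_cst i (c : R) : deriv1 i (fun _ => c) = fun=> 0.
Proof. by apply/funext => x; exact: derive_cst. Qed.

Lemma smoothD g h : smooth g -> smooth h -> smooth (fun x => g x + h x).
Proof. by rewrite !smooth_diffclass => gC hC n; apply: diffclassD. Qed.

Lemma smoothM g h : smooth g -> smooth h -> smooth (fun x => g x * h x).
Proof. by rewrite !smooth_diffclass => gC hC n; apply: diffclassM. Qed.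

Lemma smooth_cst (c : R) : smooth (fun _ : 'rV[R]_d => c).
Proof.
apply/smooth_diffclass => n; elim: n c => [|n IHn] c.
  by split=> // x; exact: cst_continuous.
split=> [x|i]; first exact: cst_continuous.
by split=> [x|]; [exact: derivable_cst | rewrite deriv1_cst].
Qed.

Lemma smooth_sum (T : Type) (r : seq T) (P : pred T) (F : T -> 'rV[R]_d -> R) :
  (forall t, P t -> smooth (F t)) -> smooth (fun x => \sum_(t <- r | P t) F t x).
Proof.
move=> sF; elim: r => [|t r IHr].
  by rewrite [X in smooth X](_ : _ = fun=> 0); [exact: smooth_cst | apply/funext => x; rewrite big_nil].
rewrite [X in smooth X](_ : _ = fun x => (if P t then F t x else 0) + \sum_(t <- r | P t) F t x).
  by apply: smoothD => //; case: (P t) (sF t) => [/(_ isT)//|_]; exact: smooth_cst.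
by apply/funext => x; rewrite big_cons; case: ifP; rewrite ?add0r.
Qed.

Lemma smooth_prod (T : Type) (r : seq T) (P : pred T) (F : T -> 'rV[R]_d -> R) :
  (forall t, P t -> smooth (F t)) -> smooth (fun x => \prod_(t <- r | P t) F t x).
Proof.
move=> sF; elim: r => [|t r IHr].
  by rewrite [X in smooth X](_ : _ = fun=> 1); [exact: smooth_cst | apply/funext => x; rewrite big_nil].
rewrite [X in smooth X](_ : _ = fun x => (if P t then F t x else 1) * \prod_(t <- r | P t) F t x).
  by apply: smoothM => //; case: (P t) (sF t) => [/(_ isT)//|_]; exact: smooth_cst.
by apply/funext => x; rewrite big_cons; case: ifP; rewrite ?mul1r.
Qed.

Lemma smooth_derivable g i x : smooth g -> derivable g x (delta_mx 0 i).
Proof. by move=> gs; case: (gs [::]). Qed.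

Lemma partial_cst s (c : R) : partial s (fun _ : 'rV[R]_d => c) = fun=> if s is [::] then c else 0.
Proof.
by elim: s => [|i s IHs] //=; rewrite IHs; apply/funext => x; case: s {IHs} => [|? ?]; exact: derive_cst.
Qed.

Lemma partialD s g h : smooth g -> smooth h ->
  partial s (fun x => g x + h x) = fun x => partial s g x + partial s h x.
Proof.
move=> gs hs; elim: s => [|i s IHs] //=; rewrite IHs.
by apply: deriv1D => x; apply: smooth_derivable; apply: smooth_partial.
Qed.

Lemma partial_sum s (T : Type) (r : seq T) (P : pred T) (F : T -> 'rV[R]_d -> R) :
  (forall t, P t -> smooth (F t)) ->
  partial s (fun x => \sum_(t <- r | P t) F t x) =
  fun x => \sum_(t <- r | P t) partial s (F t) x.
Proof.
move=> sF; elim: r => [|t r IHr].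
  rewrite [X in partial s X](_ : _ = fun=> 0); last by apply/funext => x; rewrite big_nil.
  by rewrite partial_cst; apply/funext => x; rewrite big_nil; case: s.
rewrite [X in partial s X](_ : _ = fun x => (if P t then F t x else 0) + \sum_(t <- r | P t) F t x).
  rewrite partialD; [|by case: (P t) (sF t) => [/(_ isT)//|_]; exact: smooth_cst|exact: smooth_sum].
  apply/funext => x; rewrite big_cons IHr; case: (P t) => //.
  by rewrite partial_cst /=; case: s {IHr} => [|? ?] /=; rewrite add0r.
by apply/funext => x; rewrite big_cons; case: ifP; rewrite ?add0r.
Qed.

Lemma partialZ s (c : R) g : smooth g ->
  partial s (fun x => c * g x) = fun x => c * partial s g x.
Proof.
move=> gs; elim: s => [|i s IHs] //=; rewrite IHs.
have gd x : derivable (partial s g) x (delta_mx 0 i).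
  by apply: smooth_derivable; apply: smooth_partial.
rewrite -[LHS]/(deriv1 i (fun x => (fun=> c) x * _ x)) deriv1M //.
by apply/funext => x; rewrite deriv1_cst mul0r addr0.
Qed.

(** Iterated derivatives are indexed by lists, obtained by enumerating sets of
vertices; by symmetry of the second derivatives, only the multiset of indices
matters, and relabeling the vertices does not change the derivative. *)
Lemma partial_perm s1 s2 g : smooth g -> perm_eq s1 s2 -> partial s1 g = partial s2 g.
Proof.
move=> gs; elim: s1 s2 => [|i s1 IHs] s2; first by rewrite perm_sym => /perm_nilP ->.
move=> p; have ip : i \in s2 by rewrite -(perm_mem p) mem_head.
case/path.splitPr: ip p => a b p.
have {}p : perm_eq s1 (a ++ b).
  by rewrite -(perm_cons i) (perm_trans p) // perm_catC /= perm_cons perm_catC.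
rewrite partial_cat /= (IHs _ p) partial_cat; have := smooth_partial b gs.
move: (partial b g) => {IHs gs p} {}g gs.
elim: a => [|j a IHa] //=; rewrite -IHa.
have as_ := smooth_partial a gs; apply/funext => x.
have D k1 y : derivable (partial a g) y (delta_mx 0 k1) by apply: smooth_derivable.
have D2 k1 k2 y : derivable ('D_(delta_mx 0 k1) (partial a g)) y (delta_mx 0 k2).
  by apply: smooth_derivable; exact: (@smooth_partial [:: k1]).
apply: schwarz => // y.
  by case: (as_ [:: i; j]) => + _; apply.
by case: (as_ [:: j; i]) => + _; apply.
Qed.

Lemma is_derive_coord (i j : 'I_d) (y : 'rV[R]_d) :
  is_derive y (delta_mx 0 j) (fun x : 'rV[R]_d => x 0 i) (i == j)%:R.
Proof.
have lim_ : ((fun h : R => h^-1 *: (((fun x : 'rV[R]_d => x 0 i) \o shift y)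
    (h *: delta_mx 0 j) - y 0 i)) @ (0 : R)^' --> ((i == j)%:R : R))%classic.
  apply: (@cvg_trans _ ((fun=> (i == j)%:R : R) @ (0 : R)^')%classic); last exact: cvg_cst.
  apply: near_eq_cvg; near=> h => /=.
  rewrite !mxE /= addrK [_ *: _]mulrA mulVf ?mul1r //.
  by near: h; exact: nbhs_dnbhs_neq.
split; first by apply/cvg_ex; exists (i == j)%:R.
exact: cvg_lim lim_.
Unshelve. all: by end_near.
Qed.

Lemma partial_coord s (i : 'I_d) :
  partial s (fun x : 'rV[R]_d => x 0 i) =
  fun x => match s with [::] => x 0 i | [:: j] => (i == j)%:R | _ => 0 end.
Proof.
elim/last_ind: s => [|s j _] //.
rewrite -cats1 partial_cat /= [X in partial s X](_ : _ = fun=> (i == j)%:R).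
  by rewrite partial_cst; case: s => [|k [|? ?]].
by apply/funext => y; have [_ ->] := is_derive_coord i j y.
Qed.

Lemma smooth_coord (i : 'I_d) : smooth (fun x : 'rV[R]_d => x 0 i).
Proof.
move=> s; rewrite partial_coord; case: s => [|j [|k s]]; split.
- exact: coord_continuous.
- by move=> j x; have [] := is_derive_coord i j x.
- by move=> x; exact: cst_continuous.
- by move=> k x; exact: derivable_cst.
- by move=> x; exact: cst_continuous.
- by move=> l x; exact: derivable_cst.
Qed.
End Smooth.

(** * The Leibniz rule for iterated derivatives *)

Section Leibniz.
Variables (R : realType) (d : nat).

Lemma deriv1_prod i (W : eqType) (r : seq W) (A : pred W) (F : W -> 'rV[R]_d -> R) :
  uniq r -> (forall w, A w -> smooth (F w)) ->
  deriv1 i (fun x => \prod_(w <- r | A w) F w x) =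
  fun x => \sum_(v <- r | A v) \prod_(w <- r | A w)
    (if w == v then deriv1 i (F w) x else F w x).
Proof.
move=> + sF; elim: r => [_|w r IHr /= /andP[wr ur]].
  rewrite [X in deriv1 i X](_ : _ = fun=> 1); last by apply/funext => x; rewrite big_nil.
  by rewrite deriv1_cst; apply/funext => x; rewrite big_nil.
have [Aw|nAw] := boolP (A w); last first.
  rewrite [X in deriv1 i X](_ : _ = fun x => \prod_(w <- r | A w) F w x); last first.
    by apply/funext => x; rewrite big_cons (negPf nAw).
  rewrite IHr //; apply/funext => x; rewrite big_cons (negPf nAw).
  by apply: eq_bigr => v _; rewrite big_cons (negPf nAw).
rewrite [X in deriv1 i X](_ : _ = fun x => F w x * \prod_(w <- r | A w) F w x); last first.
  by apply/funext => x; rewrite big_cons Aw.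
rewrite deriv1M; last first.
- by move=> x; apply: smooth_derivable; apply: smooth_prod.
- by move=> x; apply: smooth_derivable; apply: sF.
rewrite IHr //; apply/funext => x; rewrite big_cons Aw addrC big_cons Aw eqxx.
congr (_ * _ + _).
  rewrite big_seq_cond [RHS]big_seq_cond; apply: eq_bigr => z /andP[zr _].
  by case: eqP => // zw; rewrite -zw zr in wr.
rewrite big_distrr /= big_seq_cond [RHS]big_seq_cond; apply: eq_bigr => v /andP[vr _].
by rewrite big_cons Aw; case: eqP => // wv; rewrite wv vr in wr.
Qed.

(** Each derivative has to fall on one of the factors; a map [g] records on
which one. The reference map [g0] fixes [g] outside [s], so that maps chosen for
disjoint lists [s] can be merged into a single map. *)
Lemma partial_prod (U W : finType) (A : pred W) (F : W -> 'rV[R]_d -> R)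
    (i : U -> 'I_d) (g0 : U -> W) (s : seq U) :
  uniq s -> (forall w, A w -> smooth (F w)) ->
  partial [seq i u | u <- s] (fun x => \prod_(w | A w) F w x) =
  fun x => \sum_(g : {ffun U -> W} |
              [forall u, if u \in s then A (g u) else g u == g0 u])
    \prod_(w | A w) partial [seq i u | u <- s & g u == w] (F w) x.
Proof.
move=> + sF; elim: s => [_|u s IHs /= /andP[us ss]].
  apply/funext => x /=; rewrite (big_pred1 [ffun u => g0 u]) //= => g.
  apply/forallP/eqP => [h|->] => [|u]; last by rewrite ffunE eqxx.
  by apply/ffunP => u; rewrite ffunE; apply/eqP; have := h u.
rewrite -[LHS]/(deriv1 (i u) (partial _ _)) IHs //.
pose upd (g : {ffun U -> W}) w := [ffun v => if v == u then w else g v].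
have us' v : v \in s -> (v == u) = false by apply: contraTF => /eqP->.
have sH g w : A w -> smooth (partial [seq i u | u <- s & g u == w] (F w)).
  by move=> Aw; apply: smooth_partial; apply: sF.
have -> : deriv1 (i u) = partial [:: i u] by [].
rewrite partial_sum; last by move=> g _; apply: smooth_prod => w; apply: sH.
apply/funext => x.
rewrite [RHS](reindex_onto (fun p : {ffun U -> W} * W => upd p.1 p.2)
  (fun g => (upd g (g0 u), g u))) /=; last first.
  move=> g _; apply/ffunP => v; rewrite !ffunE /=.
  by case: eqP => [->|].
transitivity (\sum_(g : {ffun U -> W} |
              [forall u, if u \in s then A (g u) else g u == g0 u])
    \sum_(v | A v) \prod_(w | A w)
      (if w == v then deriv1 (i u) (partial [seq i u | u <- s & g u == w] (F w)) x
       else partial [seq i u | u <- s & g u == w] (F w) x)).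
  apply: eq_bigr => g _.
  exact: (congr1 (@^~ x) (deriv1_prod (i u) (index_enum_uniq W) (sH g))).
rewrite pair_big_dep /=; apply: eq_big => [[g w]|[g w] /andP[_ Aw]] /=.
  apply/andP/andP => -[].
    move=> /forallP h Aw; split.
      apply/forallP => v; rewrite in_cons ffunE.
      by have := h v; case: (v =P u) => [_ _|_] //=.
    apply/eqP; congr (_, _); last by rewrite ffunE eqxx.
    apply/ffunP => v; rewrite !ffunE; have := h v.
    by have [->|//] := eqVneq v u; rewrite (negPf us) => /eqP ->.
  move=> /forallP h /eqP[gE wE]; split; last first.
    by have := h u; rewrite in_cons eqxx ffunE eqxx.
  apply/forallP => v; have := h v; rewrite in_cons ffunE.
  have [->|//] := eqVneq v u; rewrite (negPf us) => _.
  by rewrite -gE !ffunE eqxx.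
apply: eq_bigr => v Av; rewrite ffunE eqxx eq_sym.
have E : [seq u0 <- s | upd g w u0 == v] = [seq u0 <- s | g u0 == v].
  by apply: eq_in_filter => z zs; rewrite ffunE us'.
by rewrite E; case: ifP.
Qed.
End Leibniz.

(** * Products of sums over independent choices *)

(** Distributivity for sums over index types that depend on the factor, when a
family of admissible indices is the same thing as a single object [t], with
[glue] assembling the object and [res] restricting it. *)
Lemma prod_sum_glue (R : comNzRingType) (K T : finType) (S : K -> finType)
    (Q : forall v, pred (S v)) (P : pred T) (res : forall v, T -> S v)
    (glue : (forall v, S v) -> T) (Z : forall v, S v -> R) :
    (forall s, (forall v, Q v (s v)) -> P (glue s)) ->
    (forall s v, (forall v, Q v (s v)) -> res v (glue s) = s v) ->
    (forall t, P t -> (forall v, Q v (res v t))) ->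
    (forall t s, P t -> (forall v, s v = res v t) -> glue s = t) ->
  \prod_v \sum_(s : S v | Q v s) Z v s = \sum_(t | P t) \prod_v Z v (res v t).
Proof.
move=> Pglue resK Qres glueK.
(* Inadmissible indices get the value 0, so that the sums run over whole types. *)
pose Z' v := [ffun s => if Q v s then Z v s else 0].
transitivity (\sum_(t : fprod S) \prod_v Z' v (t v)).
  have := @big_fprod_dep R 0 1 *%R +%R K S Z' predT.
  rewrite big_mkcondr /= => ->.
  rewrite -(bigA_distr_big_dep (fun v => tagged_with S v) (fun v s => untag 0 (Z' v) s)).
  apply: eq_bigr => v _; rewrite big_mkcond -(big_tag Z').
  by apply: eq_bigr => s _; rewrite ffunE.
rewrite (bigID (fun t : fprod S => [forall v, Q v (t v)])) /= [X in _ + X]big1 ?addr0.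
  rewrite [RHS](reindex_onto (fun s : fprod S => glue s)
     (fun t => [fprod v => res v t])) /=; last first.
    by move=> t Pt; apply: glueK => // v; rewrite fprodE.
  apply: eq_big => [t|t /forallP Qt].
    apply/forallP/andP => [Qt|[Pt /eqP <-] v]; last first.
      by rewrite fprodE; apply: Qres.
    split; first exact: Pglue.
    by apply/eqP/fprodP => v; rewrite fprodE resK.
  by apply: eq_bigr => v _; rewrite ffunE Qt resK.
move=> t; rewrite negb_forall => /existsP[v nQ].
by rewrite (bigD1 v) //= ffunE (negPf nQ) mul0r.
Qed.

Lemma big_sig (R : Type) (idx : R) (op : Monoid.com_law idx) (T : finType) (P : pred T)
    (F : T -> R) :
  \big[op/idx]_(x | P x) F x = \big[op/idx]_(x : {x | P x}) F (val x).
Proof.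
rewrite (reindex_omap (val : {x | P x} -> T) insub); last by move=> i Pi; rewrite insubT.
by apply: eq_bigl => x; rewrite (valP x) valK eqxx.
Qed.

Section Multinomial.
Variable R : numFieldType.

(** The maps from [n] points whose fibers have the sizes [m v] are counted by a
multinomial coefficient. The induction removes a point: it lies in some fiber
[v], which shifts [h v] by one, and on the other side this is the identity
[n + 1 = \sum_v m v]. *)
Lemma sum_multinomial (K : finType) N n (h : K -> nat -> R) : (n <= N)%N ->
  \sum_(m : {ffun K -> 'I_N.+1} | (\sum_v m v == n)%N)
     \prod_v (h v (m v) / (m v)`!%:R) =
  (n`!%:R)^-1 * \sum_(c : {ffun 'I_n -> K}) \prod_v h v #|[set w | c w == v]|.
Proof.
elim: n h => [|n IHn] h nN.
  rewrite fact0 invr1 mul1r.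
  rewrite (big_pred1 [ffun=> ord0]) => [|m]; last first.
    rewrite sum_nat_eq0; apply/forallP/eqP => [m0|-> v]; last by rewrite ffunE.
    by apply/ffunP => v; apply/val_inj; rewrite ffunE /=; apply/eqP/(implyP (m0 v)).
  rewrite (big_pred1 [ffun i : 'I_0 => match (notF (valP i)) with end]); last first.
    by move=> c; apply/esym/eqP/ffunP => -[].
  apply: eq_bigr => v _; rewrite ffunE fact0 divr1; congr (h v _).
  by apply/esym/eqP; rewrite cards_eq0; apply/eqP/setP => -[].
(* The weights after a point has been removed from the fiber of [v]. *)
pose sh v (w : K) j := h w (j + (w == v))%N.
have n0 : (n.+1%:R : R) != 0 by rewrite pnatr_eq0.
transitivity ((n.+1%:R)^-1 * \sum_v ((n`!%:R)^-1 *
    \sum_(c : {ffun 'I_n -> K}) \prod_w sh v w #|[set i | c i == w]|)); last first.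
  rewrite -big_distrr /= mulrA -invfM -natrM factS mulnC; congr (_ * _).
  rewrite pair_big /=.
  rewrite [RHS](reindex_onto
    (fun p : K * {ffun 'I_n -> K} => [ffun i => oapp p.2 p.1 (unlift ord0 i)])
    (fun c => (c ord0, [ffun i => c (lift ord0 i)]))) /=; last first.
    by move=> c _; apply/ffunP => i; rewrite ffunE; case: unliftP => [j|] -> /=; rewrite ?ffunE.
  apply: eq_big => [[v c] /=|[v c] _].
    apply/esym/eqP; rewrite ffunE unlift_none /=; congr (_, _).
    by apply/ffunP => i; rewrite !ffunE liftK.
  apply: eq_bigr => w _; rewrite /sh; congr (h w _).
  rewrite (cardsD1 ord0) inE ffunE unlift_none /= addnC eq_sym; congr (_ + _)%N.
  rewrite -(card_imset _ (@lift_inj _ ord0)); apply: eq_card => i.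
  rewrite !inE; apply/imsetP/andP => [[j]|[i0]].
    by rewrite inE => cj ->; rewrite ffunE liftK eq_sym neq_lift.
  rewrite ffunE; case: unliftP i0 => [j ->|->]; rewrite ?eqxx //= => _ cj.
  by exists j; rewrite // inE.
have {}IHn v := IHn (sh v) (ltnW nN).
under [in RHS]eq_bigr => v _ do rewrite -IHn.
apply: (canRL (mulKf n0)).
transitivity (\sum_v \sum_(m : {ffun K -> 'I_N.+1} | (\sum_v m v == n.+1)%N)
   (m v)%:R * \prod_w (h w (m w) / (m w)`!%:R)).
  rewrite exchange_big big_distrr /=; apply: eq_bigr => m /eqP <-.
  by rewrite natr_sum big_distrl.
apply: eq_bigr => v _.
rewrite (bigID (fun m : {ffun K -> 'I_N.+1} => (0 < m v)%N)) /= [X in _ + X]big1 ?addr0; last first.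
  by move=> m /andP[_]; rewrite lt0n negbK => /eqP ->; rewrite mul0r.
pose inc (m : {ffun K -> 'I_N.+1}) : {ffun K -> 'I_N.+1} :=
  [ffun w => inord (m w + (w == v))%N].
pose dec (m : {ffun K -> 'I_N.+1}) : {ffun K -> 'I_N.+1} :=
  [ffun w => inord (m w - (w == v))%N].
have incE (m : {ffun K -> 'I_N.+1}) w : (\sum_v m v == n)%N -> inc m w = (m w + (w == v))%N :> nat.
  move=> /eqP mn; rewrite ffunE inordK // ltnS.
  have : (m w <= n)%N by rewrite -mn (bigD1 w) //= leq_addr.
  by case: (w == v); lia.
have decE (m : {ffun K -> 'I_N.+1}) w : dec m w = (m w - (w == v))%N :> nat.
  by rewrite ffunE inordK // ltnS; have := ltn_ord (m w); lia.
rewrite [LHS](reindex_onto inc dec) /=; last first.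
  move=> m /andP[_ mv]; apply/ffunP => w; apply/val_inj; rewrite ffunE /= decE.
  rewrite inordK; last by have := ltn_ord (m w); case: eqP; [move=> ->|]; lia.
  by case: eqP => [->|] /=; lia.
have sum1 : (\sum_w (w == v) = 1)%N.
  by rewrite (bigD1 v) //= eqxx big1 // => w /negPf ->.
apply: eq_big => [m|m].
  apply/andP/idP => [[/andP[/eqP s v0] /eqP mE]|mn].
    have E w : m w = (inc m w - (w == v))%N :> nat by rewrite -[in LHS]mE decE.
    have E2 w : inc m w = (m w + (w == v))%N :> nat.
      by rewrite E subnK //; case: eqP => // ->.
    move: s; under eq_bigr => w _ do rewrite E2.
    by rewrite big_split /= sum1 addn1 => -[->].
  split; last by apply/eqP/ffunP => w; apply/val_inj; rewrite /= decE incE // addnK.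
  rewrite incE // eqxx addn1 andbT; apply/eqP.
  by under eq_bigr => w _ do rewrite incE //; rewrite big_split /= sum1 (eqP mn) addn1.
move=> /andP[/andP[/eqP s v0] /eqP mE].
have E w : m w = (inc m w - (w == v))%N :> nat by rewrite -[in LHS]mE decE.
have E2 w : inc m w = (m w + (w == v))%N :> nat.
  by rewrite E subnK //; case: eqP => // ->.
rewrite (bigD1 v) //= [RHS](bigD1 v) //= mulrA; congr (_ * _); last first.
  by apply: eq_bigr => w wv; rewrite /sh E2 (negPf wv) addn0.
by rewrite /sh E2 eqxx addn1 factS natrM invfM mulrCA mulVKf // pnatr_eq0.
Qed.
End Multinomial.

(** * Isomorphism of exotic aromatic forests and labeled sums *)

Lemma graphP (V : finType) (G H : graph V) :
  edges G = edges H -> stolons G = stolons H -> lianas G = lianas H -> G = H.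
Proof. by case: G H => [? ? ?] [? ? ?] /= -> -> ->. Qed.

Lemma edges_pull (U V : finType) (f : U -> V) G u v :
  ((u, v) \in edges (pull f G)) = ((f u, f v) \in edges G).
Proof. by rewrite inE. Qed.

Lemma mem_preds (V : finType) (G : graph V) u v : (u \in preds G v) = ((u, v) \in edges G).
Proof. exact: in_set. Qed.

Lemma pull_pull (U V W : finType) (f : U -> V) (g : V -> W) (G : graph W) :
  pull f (pull g G) = pull (g \o f) G.
Proof. by apply: graphP; apply/setP => x; rewrite !inE //= -imset_comp. Qed.

Lemma pull_ext (U V : finType) (f g : U -> V) (G : graph V) :
  f =1 g -> pull f G = pull g G.
Proof. by move=> fg; apply: graphP; apply/setP => x; rewrite !inE ?fg // (eq_imset _ fg). Qed.

Lemma pull_idfun (V : finType) (G : graph V) : pull id G = G.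
Proof. by apply: graphP; apply/setP => x; rewrite !inE ?imset_id //; case: x. Qed.

Lemma pull_can (U V : finType) (f : U -> V) (g : V -> U) (G : graph V) :
  cancel g f -> pull g (pull f G) = G.
Proof. by move=> gK; rewrite pull_pull (@pull_ext _ _ _ id) ?pull_idfun. Qed.

Section Spec.
Variables (V : finType) (G : graph V).

(** The axioms of exotic aromatic forests in terms of elements. They are all
universally quantified, so they pass to subgraphs and to induced graphs. *)
Record eaf_spec : Prop := EafSpec {
  eaf_succ : forall v w w', (v, w) \in edges G -> (v, w') \in edges G -> w = w';
  eaf_stolon2 : forall s, s \in stolons G -> #|s| = 2%N;
  eaf_stolonI : forall s t v,
    s \in stolons G -> t \in stolons G -> v \in s -> v \in t -> s = t;
  eaf_stolon_succ : forall s v w, s \in stolons G -> v \in s -> (v, w) \in edges G -> False;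
  eaf_liana2 : forall s, s \in lianas G -> #|s| = 2%N;
  eaf_lianaI : forall s t v,
    s \in lianas G -> t \in lianas G -> v \in s -> v \in t -> s = t;
  eaf_liana_pred : forall l u v, l \in lianas G -> v \in l -> (u, v) \in edges G -> False;
  eaf_liana_stolon : forall l s v,
    l \in lianas G -> v \in l -> s \in stolons G -> v \in s -> False }.

Lemma pairingP (P : {set {set V}}) :
  reflect ((forall s, s \in P -> #|s| = 2%N) /\
           (forall s t v, s \in P -> t \in P -> v \in s -> v \in t -> s = t))
          (pairing P).
Proof.
apply: (iffP andP) => [[/trivIsetP dP /forall_inP P2]|[P2 PI]]; split.
- by move=> s /P2/eqP.
- move=> s t v sP tP vs vt; apply/eqP/negPn/negP => st.
  by have /pred0P/(_ v) := dP _ _ sP tP st; rewrite /= vs vt.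
- apply/trivIsetP => s t sP tP; apply: contraNT => /pred0Pn[v /= /andP[vs vt]].
  by apply/eqP/(PI s t v).
- by apply/forall_inP => s /P2 ->.
Qed.

Lemma has_succP v : reflect (exists w, (v, w) \in edges G) (has_succ G v).
Proof. exact: existsP. Qed.

Lemma in_stolonP v : reflect (exists2 s, s \in stolons G & v \in s) (in_stolon G v).
Proof. exact: bigcupP. Qed.

Lemma nblackP v : reflect (exists2 s, s \in lianas G & v \in s) (~~ black G v).
Proof. by rewrite /black negbK; exact: bigcupP. Qed.

Lemma is_eafP : reflect eaf_spec (is_eaf G).
Proof.
apply: (iffP idP) => [/and3P[/and3P[/forallP E /pairingP[S2 SI] /forallP N]]|].
  move=> /pairingP[L2 LI] /forallP L.
  have stS s v : s \in stolons G -> v \in s -> in_stolon G v.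
    by move=> sS vs; apply/in_stolonP; exists s.
  have liN l v : l \in lianas G -> v \in l -> leaf G v.
    by move=> lL vl; apply: (implyP (L v)); apply/nblackP; exists l.
  split=> //.
  - move=> v w w' vw vw'; have /forallP/(_ w)/forallP/(_ w') := E v.
    by rewrite vw vw' => /eqP.
  - move=> s v w sS vs vw; have /implyP/(_ (stS _ _ sS vs))/has_succP[] := N v.
    by exists w.
  - move=> l u v lL vl uv; have /andP[/eqP p _] := liN _ _ lL vl.
    by have := in_set0 u; rewrite -p inE uv.
  - move=> l s v lL vl sS vs; have /andP[_ /negP[]] := liN _ _ lL vl.
    exact: stS vs.
case=> E S2 SI N L2 LI LP LS; apply/and3P; split; last first.
- apply/forallP => v; apply/implyP => /nblackP[l lL vl]; apply/andP; split.
    by apply/eqP/setP => u; rewrite !inE; apply/negP => uv; exact: (LP l u v).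
  by apply/in_stolonP => -[s sS vs]; exact: (LS l s v).
- exact/pairingP.
apply/and3P; split; last first.
- apply/forallP => v; apply/implyP => /in_stolonP[s sS vs].
  by apply/has_succP => -[w vw]; exact: (N s v w).
- exact/pairingP.
apply/forallP => v; apply/forallP => w; apply/forallP => w'.
by apply/implyP => /andP[vw vw']; apply/eqP; apply: (E v).
Qed.
End Spec.

Lemma eaf_spec_pull (U V : finType) (f : U -> V) (G : graph V) :
  injective f -> eaf_spec G -> eaf_spec (pull f G).
Proof.
move=> fI [E S2 SI N L2 LI LP LS].
have fm v (s : {set U}) : v \in s -> f v \in f @: s by apply: imset_f.
split.
- by move=> v w w'; rewrite !edges_pull => vw vw'; apply: fI; apply: (E (f v)).
- by move=> s; rewrite inE => /S2; rewrite card_imset.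
- move=> s t v; rewrite !inE => sS tS /fm vs /fm vt.
  by apply: (imset_inj fI); apply: SI vs vt.
- by move=> s v w; rewrite edges_pull inE => sS /fm vs; apply: N vs.
- by move=> s; rewrite inE => /L2; rewrite card_imset.
- move=> s t v; rewrite !inE => sS tS /fm vs /fm vt.
  by apply: (imset_inj fI); apply: LI vs vt.
- by move=> s u v; rewrite edges_pull inE => sS /fm vs; apply: LP vs.
- by move=> l s v; rewrite !inE => lL /fm vl sS /fm; apply: (LS (f @: l)).
Qed.

Section PullBij.
Variables (U V : finType) (f : U -> V) (g : V -> U).
Hypotheses (fK : cancel f g) (gK : cancel g f).
Variable G : graph V.

Lemma is_eaf_pull : is_eaf (pull f G) = is_eaf G.
Proof.
apply/is_eafP/is_eafP => h; last by apply: eaf_spec_pull h; exact: can_inj fK.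
by rewrite -(pull_can G gK); apply: eaf_spec_pull h; exact: can_inj gK.
Qed.

Lemma cover_pull (P : {set {set V}}) v :
  (v \in cover [set s : {set U} | f @: s \in P]) = (f v \in cover P).
Proof.
apply/bigcupP/bigcupP => -[s].
  by rewrite inE => sP vs; exists (f @: s) => //; exact: imset_f.
move=> sP vs; exists (g @: s); last by rewrite -[v]fK imset_f.
by rewrite inE -imset_comp (eq_imset (g := id)) ?imset_id.
Qed.

Lemma black_pull v : black (pull f G) v = black G (f v).
Proof. by rewrite /black cover_pull. Qed.

Lemma is_root_pull v : is_root (pull f G) v = is_root G (f v).
Proof.
rewrite /is_root /in_stolon cover_pull; congr (~~ _ && _).
apply/has_succP/has_succP => -[w]; first by rewrite edges_pull; exists (f w).
by exists (g w); rewrite edges_pull gK.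
Qed.

Lemma preds_pull v : f @: preds (pull f G) v = preds G (f v).
Proof.
apply/setP => w; rewrite inE; apply/imsetP/idP => [[u]|wv].
  by rewrite inE edges_pull => + ->.
by exists (g w); rewrite ?inE /= ?gK.
Qed.

Lemma roots_pull_bij : f @: roots (pull f G) = roots G.
Proof.
apply/setP => w; rewrite inE; apply/imsetP/idP => [[u]|wv].
  by rewrite inE is_root_pull => + ->.
by exists (g w); rewrite ?inE ?is_root_pull gK.
Qed.

Lemma is_eat_pull : is_eat (pull f G) = is_eat G.
Proof. by rewrite /is_eat is_eaf_pull -roots_pull_bij card_imset //; exact: can_inj fK. Qed.
End PullBij.

(** The number of vertices is part of the type of a forest, so the equality
[n = m] has to be eliminated before a bijection becomes a permutation. *)
Lemma eaf_class_pull n m (f : 'I_n -> 'I_m) (g : 'I_m -> 'I_n) (G : graph 'I_m)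
    (hf : is_eaf (pull f G)) (hG : is_eaf G) :
  cancel f g -> cancel g f -> eaf_class hf = eaf_class hG.
Proof.
move=> fK gK; have E : n = m.
  by rewrite -(card_ord n) -(card_ord m); apply: bij_eq_card; exists g; eassumption.
case: m / E f g G hf hG fK gK => f g G hf hG fK gK.
apply/eqP; rewrite eq_Tagged; apply/eqP/eqquotP; rewrite /= iso_sym.
apply/existsP; exists (perm (can_inj fK)); apply/eqP => /=.
by apply: eq_pull => i; rewrite permE.
Qed.

(** The sums below run over graphs on fibers and on quotients, so functionals on
isomorphism classes are transported to graphs on any finite type; they are
extended by [0] to graphs that are not exotic aromatic forests. *)
Definition on_graph (R : realType) (a : EAF -> R) (V : finType) (G : graph V) : R :=
  if insub (induced G [set: V]) is Some t then a (Tagged EAF_ (\pi_(EAF_ _) t)) else 0.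

Section OnGraph.
Variables (R : realType) (a : EAF -> R).

Lemma enum_val_setT_can (V : finType) :
  {g : V -> 'I_#|[set: V]| | cancel (@enum_val V (mem [set: V])) g & cancel g enum_val}.
Proof.
exists (fun v => enum_rank_in (in_setT v) v) => v; last by rewrite enum_rankK_in.
by rewrite enum_valK_in.
Qed.

Lemma on_graph_class (V : finType) (G : graph V) n (f : 'I_n -> V)
    (h : is_eaf (pull f G)) : bijective f -> on_graph a G = a (eaf_class h).
Proof.
case=> g fK gK; have [r eK rK] := enum_val_setT_can V.
rewrite /on_graph; case: insubP => [t ht tE|]; last first.
  by rewrite (is_eaf_pull eK rK) -(is_eaf_pull fK gK) h.
congr a; case: t tE ht => t ht /= tE ht'; subst t.
have E : pull f G = pull (r \o f) (induced G [set: V]).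
  by rewrite /induced pull_pull; apply: pull_ext => i /=; rewrite rK.
move: h; rewrite E => h.
symmetry; apply: (@eaf_class_pull _ _ (r \o f) (g \o enum_val)) => i /=.
  by rewrite rK fK.
by rewrite gK eK.
Qed.

Lemma on_graph_not_eaf (V : finType) (G : graph V) : ~~ is_eaf G -> on_graph a G = 0.
Proof.
move=> nG; rewrite /on_graph; have [r eK rK] := enum_val_setT_can V.
by rewrite insubF //; rewrite (is_eaf_pull eK rK) (negPf nG).
Qed.

Lemma on_graph_pull (U V : finType) (f : U -> V) (G : graph V) :
  bijective f -> on_graph a (pull f G) = on_graph a G.
Proof.
case=> g fK gK; have [hG|nG] := boolP (is_eaf G); last first.
  by rewrite !on_graph_not_eaf // (is_eaf_pull fK gK).
have [r eK rK] := enum_val_setT_can U.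
have h1 : is_eaf (pull (@enum_val U (mem [set: U])) (pull f G)).
  by rewrite (is_eaf_pull eK rK) (is_eaf_pull fK gK).
rewrite (on_graph_class h1) //; last by exists r.
move: h1; rewrite pull_pull => h1; rewrite (on_graph_class h1) //.
by exists (r \o g) => i /=; rewrite ?fK ?eK // rK gK.
Qed.

Lemma on_graph_ord n (G : graph 'I_n) (h : is_eaf G) : on_graph a G = a (eaf_class h).
Proof.
have h1 : is_eaf (pull id G) by rewrite pull_idfun.
rewrite (on_graph_class h1) //; last by exists id.
by congr a; apply: (@eaf_class_pull _ _ id id).
Qed.

Lemma on_graph_rep (t : EAF) : on_graph a (rep (tagged t)) = a t.
Proof.
case: t => n t /=; have h : is_eaf (rep t) := valP (repr t).
rewrite (on_graph_ord h); congr a; apply/eqP; rewrite eq_Tagged /=.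
apply/eqP; rewrite -[RHS]reprK; congr (\pi_(EAF_ n) _); exact: val_inj.
Qed.
End OnGraph.

(** The permutations act on the labelings of a forest, with [sigma] as the order
of the stabilizer, so a forest has [n! / sigma] labelings. *)
Lemma sum_EAF_labeled (R : realType) n (F : graph 'I_n -> R) :
    (forall (s : {perm 'I_n}) G, F (pull s G) = F G) ->
  \sum_(t : EAF_ n) F (rep t) / (sigma (rep t))%:R =
  (n`!%:R)^-1 * \sum_(G : graph 'I_n | is_eaf G) F G.
Proof.
move=> Fpull; have n0 : (n`!%:R : R) != 0 by rewrite pnatr_eq0 -lt0n fact_gt0.
pose cl (G : graph 'I_n) : option (EAF_ n) :=
  omap (fun g : eaf_graph n => \pi_(EAF_ n) g) (insub G).
have clP (t : EAF_ n) G : (is_eaf G && (cl G == Some t)) = [exists s : {perm 'I_n}, pull s (rep t) == G].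
  apply/andP/existsP => [[hG]|[s /eqP <-]].
    rewrite /cl insubT /= => /eqP[] ht.
    have /eqquotP/existsP[s /= sE] := etrans (reprK t) (esym ht).
    by exists s.
  have ht : is_eaf (rep t) := valP (repr t).
  have h : is_eaf (pull s (rep t)) by rewrite (is_eaf_pull (permK s) (permKV s)).
  split=> //; rewrite /cl insubT /=; apply/eqP; congr Some.
  apply: etrans (reprK t); apply/esym/eqquotP.
  by apply/existsP; exists s => /=.
have cardS (t : EAF_ n) G : [exists s : {perm 'I_n}, pull s (rep t) == G] ->
    #|[set s : {perm 'I_n} | pull s (rep t) == G]| = sigma (rep t).
  case/existsP => s0 /eqP <-.
  rewrite -[RHS](card_imset _ (@mulgI _ s0)); apply: eq_card => s.
  rewrite inE; apply/eqP/imsetP => [sE|[s1]].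
    exists (s0^-1 * s)%g; rewrite ?mulKVg // inE; apply/eqP.
    rewrite (@pull_ext _ _ _ (s \o s0^-1%g)) => [|i]; last by rewrite permM.
    by rewrite -pull_pull sE; apply: pull_can; exact: permKV.
  rewrite inE => /eqP sE ->.
  rewrite (@pull_ext _ _ _ (s1 \o s0)) => [|i]; last by rewrite permM.
  by rewrite -pull_pull sE.
apply: (canRL (mulKf n0)); rewrite big_distrr /=.
rewrite (eq_bigr (fun t : EAF_ n => \sum_(G | is_eaf G && (cl G == Some t)) F G)).
  rewrite (exchange_big_dep (@is_eaf 'I_n)) /=; last by move=> t G _ /andP[].
  apply: eq_bigr => G hG.
  rewrite (big_pred1 (\pi_(EAF_ n) (exist _ G hG))) // => t.
  by rewrite hG /cl insubT /= eq_sym.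
move=> t _; rewrite (eq_bigl _ _ (clP t)).
rewrite (eq_bigr (fun=> F (rep t))) => [|G /existsP[s /eqP <-]]; last exact: Fpull.
have sg0 : ((sigma (rep t))%:R : R) != 0.
  rewrite pnatr_eq0 -lt0n card_gt0; apply/set0Pn; exists 1%g; rewrite inE.
  by rewrite (@pull_ext _ _ _ id) ?pull_idfun // => i; rewrite perm1.
rewrite sumr_const -[RHS]mulr_natr mulrCA; congr (_ * _).
apply: (canLR (mulfK sg0)); rewrite -natrM; congr _%:R.
rewrite -card_Sn -[LHS]sum1_card [LHS](partition_big (fun s : {perm 'I_n} => pull s (rep t))
  (fun G => [exists s : {perm 'I_n}, pull s (rep t) == G])) /=; last first.
  by move=> s _; apply/existsP; exists s.
rewrite -sum_nat_const; apply: eq_bigr => G hG.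
by rewrite -(cardS _ _ hG) -sum1_card; apply: eq_bigl => s; rewrite inE.
Qed.

(** * Clumpings: graphs split along the fibers of a map *)

Notation fiber c v := {w | c w == v}.

Section Clumping.
Variables (V K : finType) (c : V -> K).

Definition restr (v : K) (D : graph V) : graph (fiber c v) := pull val D.

(** A clumping is a disjoint union of exotic aromatic trees, one on each fiber of
[c]; the aromas of a fiber belong to its tree. *)
Definition clumping (D : graph V) :=
  [&& is_eaf D, [forall e in edges D, c e.1 == c e.2],
      [forall s in stolons D :|: lianas D, forall u in s, forall w in s, c u == c w] &
      [forall v, #|[set w | (c w == v) && is_root D w]| == 1%N]].

Record clumping_spec (D : graph V) : Prop := ClumpingSpec {
  clumping_eaf : eaf_spec D;
  clumping_edge : forall u w, (u, w) \in edges D -> c u = c w;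
  clumping_stolon : forall s u w, s \in stolons D -> u \in s -> w \in s -> c u = c w;
  clumping_liana : forall s u w, s \in lianas D -> u \in s -> w \in s -> c u = c w;
  clumping_root : forall v, exists w, [/\ c w = v, is_root D w &
                    forall w', c w' = v -> is_root D w' -> w' = w] }.

Lemma clumpingP D : reflect (clumping_spec D) (clumping D).
Proof.
apply: (iffP and4P) => [[/is_eafP h1 /forall_inP h2 /forall_inP h3 /forallP h4]|].
  split=> //.
  - by move=> u w /h2/eqP.
  - move=> s u w sS us ws; have sS' : s \in stolons D :|: lianas D by rewrite inE sS.
    by have /forall_inP/(_ u us)/forall_inP/(_ w ws)/eqP := h3 s sS'.
  - move=> s u w sS us ws; have sS' : s \in stolons D :|: lianas D by rewrite inE sS orbT.
    by have /forall_inP/(_ u us)/forall_inP/(_ w ws)/eqP := h3 s sS'.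
  move=> v; have /cards1P[w wE] := h4 v; exists w.
  have : w \in [set w | (c w == v) && is_root D w] by rewrite wE set11.
  rewrite inE => /andP[/eqP cw rw]; split=> // w' cw' rw'.
  by apply/set1P; rewrite -wE inE cw' eqxx.
case=> h1 h2 h3 h3' h4; split; first exact/is_eafP.
- by apply/forall_inP => -[u w] /h2 /= ->.
- apply/forall_inP => s; rewrite inE => /orP[] sS;
    apply/forall_inP => u us; apply/forall_inP => w ws; apply/eqP.
    exact: h3 ws.
  exact: h3' ws.
apply/forallP => v; have [w [cw rw uw]] := h4 v; apply/cards1P; exists w.
apply/setP => w'; rewrite !inE; apply/andP/eqP => [[/eqP cw' rw']|->]; first exact: uw.
by rewrite cw rw.
Qed.

Lemma clumping_root_fun D : clumping D -> exists rt : {ffun K -> V},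
  forall v, [/\ c (rt v) = v, is_root D (rt v) &
             forall w, c w = v -> is_root D w -> w = rt v].
Proof.
case/clumpingP => _ _ _ _ /fin_all_exists[rt rtP].
by exists [ffun v => rt v] => v; rewrite ffunE.
Qed.

Definition restr_sets v (P : {set {set V}}) : {set {set fiber c v}} := [set s : {set fiber c v} | val @: s \in P].

Definition glue_sets (P : forall v, {set {set fiber c v}}) : {set {set V}} :=
  \bigcup_v [set val @: (s : {set fiber c v}) | s in P v].

Definition glue (T : forall v, graph (fiber c v)) : graph V :=
  Graph (\bigcup_v [set (val e.1, val e.2) | e in edges (T v)])
        (glue_sets (fun v => stolons (T v))) (glue_sets (fun v => lianas (T v))).

Lemma glue_edgesP (T : forall v, graph (fiber c v)) x y :
  reflect (exists v (x' y' : fiber c v), [/\ (x', y') \in edges (T v), val x' = x & val y' = y])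
          ((x, y) \in edges (glue T)).
Proof.
apply: (iffP bigcupP) => [[v _ /imsetP[[x' y'] e [-> ->]]]|[v [x' [y' [e <- <-]]]]].
  by exists v, x', y'.
by exists v => //; apply/imsetP; exists (x', y').
Qed.

Lemma glue_setsP (P : forall v, {set {set fiber c v}}) (s : {set V}) :
  reflect (exists v (s' : {set fiber c v}), s' \in P v /\ s = val @: s') (s \in glue_sets P).
Proof.
apply: (iffP bigcupP) => [[v _ /imsetP[s' sP ->]]|[v [s' [sP ->]]]].
  by exists v, s'.
by exists v => //; apply/imsetP; exists s'.
Qed.

Lemma fiber_val v (x : fiber c v) : c (val x) = v.
Proof. exact/eqP/(valP x). Qed.

(** The empty set would lie in the restriction to every fiber. *)
Lemma restr_glue_sets (P : forall v, {set {set fiber c v}}) v : (forall v, set0 \notin P v) -> restr_sets v (glue_sets P) = P v.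
Proof.
move=> P0; apply/setP => s; rewrite inE; apply/glue_setsP/idP => [|sP]; last by exists v, s.
case=> v' [s' [sP ss']]; have [s0|[x xs]] := set_0Vmem s'.
  by have := P0 v'; rewrite -s0 sP.
have : val x \in val @: s by rewrite ss' imset_f.
case/imsetP => y _ xy; have E : v = v' by rewrite -(fiber_val x) xy fiber_val.
by case: v' / E s' sP ss' x xs xy => s' sP /(imset_inj val_inj) ->.
Qed.

Lemma mem_cover_restr v (P : {set {set V}}) (w : fiber c v) :
    (forall s u w, s \in P -> u \in s -> w \in s -> c u = c w) ->
  (w \in cover (restr_sets v P)) = (val w \in cover P).
Proof.
move=> mono; apply/bigcupP/bigcupP => -[s].
  by rewrite inE => sP ws; exists (val @: s) => //; exact: imset_f.
move=> sP ws; exists (val @^-1: s); last by rewrite inE.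
rewrite inE (_ : val @: _ = s) //; apply/setP => u; apply/imsetP/idP => [[u'] + ->|us].
  by rewrite inE.
have cu : c u == v by rewrite (mono s u (val w)) // fiber_val.
by exists (Sub u cu); rewrite ?inE /= ?SubK.
Qed.

(** The part of the conditions on a clumping under which restriction to a fiber
preserves predecessors, colors and roots. *)
Record mono_spec (D : graph V) : Prop := MonoSpec {
  mono_edge : forall u w, (u, w) \in edges D -> c u = c w;
  mono_stolon : forall s u w, s \in stolons D -> u \in s -> w \in s -> c u = c w;
  mono_liana : forall s u w, s \in lianas D -> u \in s -> w \in s -> c u = c w }.

Lemma clumping_mono D : clumping_spec D -> mono_spec D.
Proof. by case. Qed.

Section Restr.
Variables (D : graph V) (mD : mono_spec D) (v : K).

Lemma black_restr (w : fiber c v) : black (restr v D) w = black D (val w).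
Proof. by rewrite /black mem_cover_restr //; exact: mono_liana. Qed.

Lemma is_root_restr (w : fiber c v) : is_root (restr v D) w = is_root D (val w).
Proof.
rewrite /is_root /in_stolon mem_cover_restr; last exact: mono_stolon.
congr (~~ _ && _); apply/has_succP/has_succP => -[u]; first by rewrite edges_pull; exists (val u).
move=> wu; have cu : c u == v by rewrite -(mono_edge mD wu) fiber_val.
by exists (Sub u cu); rewrite edges_pull.
Qed.

Lemma preds_restr (w : fiber c v) : val @: preds (restr v D) w = preds D (val w).
Proof.
apply/setP => u; rewrite inE; apply/imsetP/idP => [[u'] + ->|uw].
  by rewrite inE edges_pull.
have cu : c u == v by rewrite (mono_edge mD uw) fiber_val.
by exists (Sub u cu); rewrite ?inE /= ?SubK.
Qed.

End Restr.

Lemma is_eat_restr D v : clumping_spec D -> is_eat (restr v D).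
Proof.
move=> clD; have mD := clumping_mono clD.
apply/andP; split.
  by apply/is_eafP; apply: eaf_spec_pull; [exact: val_inj | exact: clumping_eaf].
have [w [cw rw uw]] := clumping_root clD v.
have cw' : c w == v by apply/eqP.
apply/cards1P; exists (Sub w cw'); apply/setP => u; rewrite !inE.
rewrite is_root_restr //; apply/idP/eqP => [ru|->]; last exact: rw.
by apply/val_inj/uw; rewrite ?fiber_val.
Qed.

Lemma set0_notin_eaf (W : finType) (G : graph W) : is_eaf G ->
  set0 \notin stolons G /\ set0 \notin lianas G.
Proof.
case/is_eafP => _ S2 _ _ L2 _ _ _.
by split; apply/negP; [move/S2 | move/L2]; rewrite cards0.
Qed.

Section Glue.
Variable T : forall v, graph (fiber c v).
Hypothesis T_eat : forall v, is_eat (T v).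

Lemma restr_glue v : restr v (glue T) = T v.
Proof.
have T0 w : set0 \notin stolons (T w) /\ set0 \notin lianas (T w).
  by apply: set0_notin_eaf; case/andP: (T_eat w).
apply: graphP; last 2 first.
- by apply: restr_glue_sets => w; case: (T0 w).
- by apply: (@restr_glue_sets (fun v => lianas (T v))) => w; case: (T0 w).
apply/setP => -[x y]; rewrite edges_pull; apply/glue_edgesP/idP => [|xy]; last first.
  by exists v, x, y.
case=> v' [x' [y' [e ex ey]]]; have E : v = v' by rewrite -(fiber_val x) -ex fiber_val.
case: v' / E x' y' e ex ey => x' y' e /val_inj <- /val_inj <- //.
Qed.

Lemma glue_monoS (P : forall v, {set {set fiber c v}}) (s : {set V}) u w : s \in glue_sets P -> u \in s -> w \in s -> c u = c w.
Proof. by case/glue_setsP => v [s' [_ ->]] /imsetP[u' _ ->] /imsetP[w' _ ->]; rewrite !fiber_val. Qed.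

Lemma glue_monoE u w : (u, w) \in edges (glue T) -> c u = c w.
Proof. by case/glue_edgesP => v [x [y [_ <- <-]]]; rewrite !fiber_val. Qed.

Lemma glue_sets_disj (P : forall v, {set {set fiber c v}}) (s t : {set V}) u :
    (forall v s t u, s \in P v -> t \in P v -> u \in s -> u \in t -> s = t) ->
  s \in glue_sets P -> t \in glue_sets P -> u \in s -> u \in t -> s = t.
Proof.
move=> PI /glue_setsP[v [s' [s'P ->]]] /glue_setsP[v' [t' [t'P ->]]].
case/imsetP => x xs ->; case/imsetP => y yt xy.
have E : v = v' by rewrite -(fiber_val x) xy fiber_val.
case: v' / E t' t'P y yt xy => t' t'P y yt /val_inj xy.
suff -> : s' = t' by [].
by apply: (PI v s' t' x) => //; rewrite xy.
Qed.

Lemma glue_clumping : clumping (glue T).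
Proof.
have spec v : eaf_spec (T v) by apply/is_eafP; case/andP: (T_eat v).
have mono_St s u w : s \in stolons (glue T) -> u \in s -> w \in s -> c u = c w by exact: glue_monoS.
have mono_L s u w : s \in lianas (glue T) -> u \in s -> w \in s -> c u = c w by exact: glue_monoS.
have inf (w : V) : exists x : fiber c (c w), val x = w by exists (Sub w (eqxx (c w))).
have inE_ v (x y : fiber c v) : (val x, val y) \in edges (glue T) -> (x, y) \in edges (T v).
  by rewrite -edges_pull -/(restr v _) restr_glue.
have up v (x : fiber c v) w : (val x, w) \in edges (glue T) -> exists2 y, w = val y & (x, y) \in edges (T v).
  move=> xw; have cw : c w == v by rewrite -(glue_monoE xw) fiber_val.
  by exists (Sub w cw); rewrite ?SubK //; apply: inE_; rewrite SubK.
have down v (y : fiber c v) w : (w, val y) \in edges (glue T) -> exists2 x, w = val x & (x, y) \in edges (T v).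
  move=> wy; have cw : c w == v by rewrite (glue_monoE wy) fiber_val.
  by exists (Sub w cw); rewrite ?SubK //; apply: inE_; rewrite SubK.
have same v v' (x : fiber c v) (s' : {set fiber c v'}) : val x \in val @: s' -> v = v'.
  by case/imsetP => y _ xy; rewrite -(fiber_val x) xy fiber_val.
apply/clumpingP; split=> //; last 2 first.
- exact: glue_monoE.
- move=> v; have /andP[_ /cards1P[w wE]] := T_eat v.
  have rE (x : fiber c v) : is_root (T v) x = is_root (glue T) (val x).
    rewrite -{1}(restr_glue v) /is_root /in_stolon mem_cover_restr //.
    congr (~~ _ && _); apply/has_succP/has_succP => -[u].
      by rewrite edges_pull; exists (val u).
    by case/up => y _; rewrite -{1}(restr_glue v); exists y.
  have wr : w \in roots (T v) by rewrite wE set11.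
  exists (val w); split; [exact: fiber_val|by rewrite -rE; rewrite inE in wr|].
  move=> w' cw'; have [x <-] := inf w'; move: x; rewrite cw' => x.
  by rewrite -rE => xr; congr val; apply/set1P; rewrite -wE inE.
split.
- move=> u w w'; have [x <-] := inf u; case/up=> y -> e /up[y' -> e'].
  by congr val; apply: (eaf_succ (spec _)) e e'.
- by move=> s /glue_setsP[v [s' [/(eaf_stolon2 (spec v)) s2 ->]]]; rewrite card_imset //; exact: val_inj.
- by move=> s t u; apply: glue_sets_disj => v; exact: (eaf_stolonI (spec v)).
- move=> s u w /glue_setsP[v [s' [s'S ->]]] /imsetP[x xs ->] /up[y _].
  exact: (eaf_stolon_succ (spec v)) s'S xs.
- by move=> s /glue_setsP[v [s' [/(eaf_liana2 (spec v)) s2 ->]]]; rewrite card_imset //; exact: val_inj.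
- by move=> s t u; apply: glue_sets_disj => v; exact: (eaf_lianaI (spec v)).
- move=> s u w /glue_setsP[v [s' [s'S ->]]] /imsetP[x xs ->] /down[y _].
  exact: (eaf_liana_pred (spec v)) s'S xs.
- move=> l s w /glue_setsP[v [l' [l'L ->]]] /imsetP[x xl ->] /glue_setsP[v' [s' [s'S ->]]] xs.
  have E := same _ _ _ _ xs; case: v' / E s' s'S xs => s' s'S; rewrite mem_imset; last exact: val_inj.
  exact: (eaf_liana_stolon (spec v)) l'L xl s'S.
Qed.
End Glue.

Lemma glue_restr D (T : forall v, graph (fiber c v)) :
  clumping D -> (forall v, T v = restr v D) -> glue T = D.
Proof.
case/clumpingP => eafD mE mS mL _ TE.
have lift w : exists x : fiber c (c w), val x = w by exists (Sub w (eqxx (c w))).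
have lifts (P : {set {set V}}) s : (forall s u w, s \in P -> u \in s -> w \in s -> c u = c w) ->
    (forall s, s \in P -> #|s| = 2%N) -> s \in P ->
    exists v (s' : {set fiber c v}), s' \in restr_sets v P /\ s = val @: s'.
  move=> mono P2 sP; have : s != set0 by rewrite -card_gt0 P2.
  case/set0Pn => w ws; exists (c w), (val @^-1: s).
  have E : s = val @: ((val : fiber c (c w) -> V) @^-1: s).
    apply/setP => u; apply/idP/imsetP => [us|[x + ->]]; last by rewrite inE.
    have cu : c u == c w by rewrite (mono s u w).
    by exists (Sub u cu); rewrite ?inE SubK.
  by split=> //; rewrite inE -E.
apply: graphP.
- apply/setP => -[x y]; apply/glue_edgesP/idP => [[v [x' [y' [+ <- <-]]]]|xy].
    by rewrite TE edges_pull.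
  have [x' xE] := lift x; have [y' yE] := lift y; move: y' yE; rewrite -(mE _ _ xy) => y' yE.
  by exists (c x), x', y'; rewrite TE edges_pull xE yE.
- apply/setP => s; apply/glue_setsP/idP => [[v [s' [+ ->]]]|sS].
    by rewrite TE inE.
  have [v [s' [s'S sE]]] := lifts _ _ mS (eaf_stolon2 eafD) sS.
  by exists v, s'; rewrite TE.
apply/setP => s; apply/glue_setsP/idP => [[v [s' [+ ->]]]|sS].
  by rewrite TE inE.
have [v [s' [s'S sE]]] := lifts _ _ mL (eaf_liana2 eafD) sS.
by exists v, s'; rewrite TE.
Qed.
End Clumping.

(** * Subforests as clumpings with a quotient *)

(** Two enumerations of the same set induce isomorphic graphs; this compares the
graphs induced on ordinals with those induced on fibers. *)
Lemma same_image (U1 U2 X : finType) (f1 : U1 -> X) (f2 : U2 -> X) :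
    injective f1 -> injective f2 -> (forall x, (x \in codom f1) = (x \in codom f2)) ->
  exists2 h : U1 -> U2, bijective h & forall u, f2 (h u) = f1 u.
Proof.
move=> I1 I2 E.
have m1 u : f1 u \in codom f2 by rewrite -E codom_f.
have m2 u : f2 u \in codom f1 by rewrite E codom_f.
exists (fun u => iinv (m1 u)) => [|u]; last by rewrite f_iinv.
exists (fun u => iinv (m2 u)) => u; [apply: I1|apply: I2]; by rewrite !f_iinv.
Qed.

Lemma bij_can (U V : finType) (h : U -> V) : bijective h ->
  exists2 g, cancel h g & cancel g h.
Proof. by case=> g; exists g. Qed.

Lemma eaf_spec_sub (V : finType) (D G : graph V) : edges D \subset edges G ->
  stolons D \subset stolons G -> lianas D \subset lianas G -> eaf_spec G -> eaf_spec D.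
Proof.
move=> /subsetP sE /subsetP sS /subsetP sL [E S2 SI N L2 LI LP LS].
split; first by move=> v w w' /sE vw /sE; exact: E vw.
- by move=> s /sS; exact: S2.
- by move=> s t v /sS ? /sS; exact: SI.
- by move=> s v w /sS ? ? /sE; exact: (N s).
- by move=> s /sL; exact: L2.
- by move=> s t v /sL ? /sL; exact: LI.
- by move=> s u v /sL ? ? /sE; exact: (LP s).
- by move=> l s v /sL ? ? /sS; exact: (LS l).
Qed.

Definition graph0 (V : finType) : graph V := Graph set0 set0 set0.

Section Quotient.
Variables (V K : finType) (c : V -> K).

(** When [D] is a clumping inside [G], this is the contraction of the trees of
[D] in [G]: these trees live on the fibers of [c], and the blocks of the
contraction are named by the values of [c]. *)
Definition quot (G D : graph V) : graph K :=
  Graph [set (c e.1, c e.2) | e in edges G :\: edges D]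
        [set c @: s | s : {set V} in stolons G :\: stolons D]
        [set c @: l | l : {set V} in lianas G :\: lianas D].

(** The subforests of [G] whose blocks are the fibers of [c]. The single vertices
outside a subforest also form fibers; there [D] has to be empty, and they are
the numbered vertices of the quotient. *)
Definition admissible (G D : graph V) :=
  [&& clumping c D,
      [&& edges D \subset edges G, stolons D \subset stolons G & lianas D \subset lianas G],
      is_eaf (quot G D) &
      [forall v, ~~ black (quot G D) v ==> (restr c v D == graph0 _)]].

(** All vertices are roots in the empty graph, and a clumping has a single root
in each fiber. *)
Lemma graph0_fiber D v w : clumping_spec c D -> restr c v D = graph0 _ -> c w = v ->
  [/\ forall w', c w' = v -> w' = w, black D w, is_root D w & preds D w = set0].
Proof.
move=> clD D0 cw; have mD := clumping_mono clD.
(* Roots are read off the restriction, in which nothing has a successor. *)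
have all_root w' : c w' = v -> is_root D w'.
  move/eqP => cw'; rewrite -[w']/(val (Sub w' cw' : fiber c v)) -(is_root_restr mD) D0.
  rewrite /is_root /has_succ /in_stolon /cover big_set0 inE andbT.
  by apply/existsP => -[u]; rewrite inE.
have [r [cr rr ur]] := clumping_root clD v.
have cw' : c w == v by apply/eqP.
split; last 1 first.
- rewrite -[w]/(val (Sub w cw' : fiber c v)) -preds_restr // D0.
  by apply/eqP; rewrite imset_eq0; apply/eqP/setP => u; rewrite !inE.
- move=> w' cw1.
  exact: etrans (ur w' cw1 (all_root _ cw1)) (esym (ur w cw (all_root _ cw))).
- rewrite -[w]/(val (Sub w cw' : fiber c v)) -black_restr // D0.
  by rewrite /black /cover big_set0 inE.
- exact: all_root.
Qed.

Lemma quot_nblackP G D v : reflect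
  (exists l w, [/\ l \in lianas G, l \notin lianas D, w \in l & c w = v])
  (~~ black (quot G D) v).
Proof.
apply: (iffP (nblackP _ _)) => [[_ /imsetP[l + ->] /imsetP[w wl ->]]|].
  by rewrite inE => /andP[? ?]; exists l, w.
move=> [l [w [lG lD wl <-]]]; exists (c @: l); last exact: imset_f.
by apply: imset_f; rewrite inE lD.
Qed.
End Quotient.

Section Subforest.
Variables (V K : finType) (c : V -> K) (G : graph V).
Hypothesis eafG : eaf_spec G.

Definition fiber_set (v : K) : {set V} := [set w | c w == v].

Definition fiber_sets : {set {set V}} := [set fiber_set v | v : K].

(** A liana of [G] is contained in a clump or disjoint from all of them; the
former are the lianas of the trees of the subforest. *)
Definition subgraph_of (p : presubforest V) : graph V :=
  Graph (sub_edges p) (sub_stolons p) [set l in lianas G | ~~ [disjoint l & covered p]].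

(** The clumps are the fibers which become black in the quotient, as a vertex
outside the subforest keeps its number. *)
Definition presubforest_of_graph (D : graph V) : presubforest V :=
  PreSubforest [set fiber_set v | v in [pred v | black (quot c G D) v]] (edges D) (stolons D).

Hypothesis c_surj : forall v, exists w, c w = v.

Lemma fiber_set_inj : injective fiber_set.
Proof.
move=> v v' E; have [w cw] := c_surj v.
have : w \in fiber_set v' by rewrite -E inE cw.
by rewrite inE cw => /eqP.
Qed.

Lemma fiber_sets_triv : trivIset fiber_sets.
Proof.
apply/trivIsetP => _ _ /imsetP[v _ ->] /imsetP[v' _ ->] ne.
apply/pred0P => w /=; rewrite !inE; apply/negP => /andP[/eqP cv /eqP cv'].
by rewrite -cv -cv' eqxx in ne.
Qed.

Lemma mem_covered (p : presubforest V) (w : V) : reflect (exists2 B, B \in clumps p & w \in B) (w \in covered p).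
Proof. exact: bigcupP. Qed.

Section Blocks.
Variable p : presubforest V.
Hypothesis blocksE : blocks p = fiber_sets.

Lemma block_fiber w : block p w = fiber_set (c w).
Proof.
rewrite /block blocksE; apply: def_pblock; first exact: fiber_sets_triv.
  by apply: imset_f.
by rewrite inE.
Qed.

Lemma block_imset (s : {set V}) : block p @: s = fiber_set @: (c @: s).
Proof. by rewrite -imset_comp; apply: eq_imset => w; exact: block_fiber. Qed.

(** The blocks are the fibers and fibers are distinguished by the values of [c],
so that the block of a vertex [w] can be read as [c w]. *)
Lemma pull_contraction :
  pull fiber_set
    (Graph [set (block p e.1, block p e.2) | e in edges G :\: sub_edges p]
           [set block p @: s | s : {set V} in stolons G :\: sub_stolons p]
           [set block p @: l | l : {set V} in lianas G & [disjoint l & covered p]]) =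
  quot c G (subgraph_of p).
Proof.
apply: graphP; apply/setP => s; rewrite inE.
- apply/imsetP/imsetP => -[e eG eE]; exists e => //.
    case: s eE => v w /= []; rewrite !block_fiber.
    by move=> /fiber_set_inj -> /fiber_set_inj ->.
  by rewrite eE /= !block_fiber.
- apply/imsetP/imsetP => -[t tG tE]; exists t => //.
    by apply: (imset_inj fiber_set_inj); rewrite tE block_imset.
  by rewrite tE block_imset.
- apply/imsetP/imsetP => -[t tG tE]; exists t.
  + by move: tG; rewrite !inE => /andP[-> ->].
  + by apply: (imset_inj fiber_set_inj); rewrite tE block_imset.
  + by move: tG; rewrite !inE => /andP[+ tG]; rewrite tG /= negbK.
  + by rewrite tE block_imset.
Qed.

Lemma contraction_bij : exists2 h : 'I_#|blocks p| -> K, bijective h &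
  contraction G p = pull h (quot c G (subgraph_of p)).
Proof.
have [|||h hb hE] := @same_image _ _ _ (@enum_val _ (mem (blocks p))) fiber_set.
- exact: enum_val_inj.
- exact: fiber_set_inj.
- move=> B; apply/codomP/codomP => -[i ->].
    have : enum_val i \in fiber_sets by rewrite -blocksE; exact: enum_valP.
    by case/imsetP => v _ vE; exists v.
  have iB : fiber_set i \in blocks p by rewrite blocksE imset_f.
  by exists (enum_rank_in iB (fiber_set i)); rewrite enum_rankK_in.
exists h => //; rewrite -pull_contraction pull_pull /contraction /induced.
by apply: pull_ext => i /=; rewrite hE.
Qed.
End Blocks.

Lemma clump_bij p v : fiber_set v \in clumps p -> exists2 h : 'I_#|fiber_set v| -> fiber c v,
  bijective h & clump_graph G p (fiber_set v) = pull h (restr c v (subgraph_of p)).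
Proof.
move=> vp.
have [|||h hb hE] := @same_image _ _ _ (@enum_val _ (mem (fiber_set v))) (val : fiber c v -> V).
- exact: enum_val_inj.
- exact: val_inj.
- move=> w; apply/codomP/codomP => -[i ->].
    by have := enum_valP i; rewrite inE => iv; exists (Sub (enum_val i) iv).
  have iB : val i \in fiber_set v by rewrite inE (valP i).
  by exists (enum_rank_in iB (val i)); rewrite enum_rankK_in.
exists h => //; rewrite /clump_graph /induced pull_pull (pull_ext _ (hE : val \o h =1 _)).
apply: graphP => //; apply/setP => s; rewrite !inE; apply: esym.
case sG: (_ \in lianas G) => //=; apply/negP => dis.
have : s != set0 by rewrite -card_gt0 -(card_imset _ enum_val_inj) (eaf_liana2 eafG sG).
case/set0Pn => x xs; have := disjointFr dis (imset_f _ xs).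
case/negP; apply/mem_covered; exists (fiber_set v) => //; exact: enum_valP.
Qed.
End Subforest.

Section Correspondence.
Variables (V K : finType) (c : V -> K) (G : graph V).
Hypothesis eafG : eaf_spec G.
Hypothesis c_surj : forall v, exists w, c w = v.

Record subforest_spec (p : presubforest V) : Prop := SubforestSpec {
  subforest_triv : trivIset (clumps p);
  subforest_black : forall v, black G v -> v \in covered p;
  subforest_edgeS : sub_edges p \subset edges G;
  subforest_edge : forall u w, (u, w) \in sub_edges p ->
    exists2 B, B \in clumps p & (u \in B) && (w \in B);
  subforest_stolonS : sub_stolons p \subset stolons G;
  subforest_stolon : forall s, s \in sub_stolons p -> exists2 B, B \in clumps p & s \subset B;
  subforest_liana : forall l, l \in lianas G -> ~~ [disjoint l & covered p] ->
    exists2 B, B \in clumps p & l \subset B;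
  subforest_eat : forall B, B \in clumps p -> is_eat (clump_graph G p B);
  subforest_quot : is_eaf (contraction G p) }.

Lemma subforestP p : reflect (subforest_spec p) (is_subforest G p).
Proof.
apply: (iffP idP) => [/and5P[h1 /forallP h2 h3 /forall_inP h4 /and5P[h5 /forall_inP h6 /forall_inP h7 /forall_inP h8 h9]]|].
  split=> //.
  - by move=> v; apply/implyP.
  - by move=> u w /h4/exists_inP.
  - by move=> s /h6/exists_inP.
  - by move=> l /h7/orP[->|/exists_inP].
case=> h1 h2 h3 h4 h5 h6 h7 h8 h9; apply/and5P; split=> //.
- by apply/forallP => v; apply/implyP/h2.
- by apply/forall_inP => -[u w] /h4/exists_inP.
apply/and5P; split=> //; apply/forall_inP => //.
- by move=> s /h6/exists_inP.
- move=> l /h7 h; case: (boolP [disjoint l & covered p]) => //= /h ?.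
  exact/exists_inP.
Qed.

Section ToGraph.
Variable p : presubforest V.
Hypothesis pG : subforest_spec p.
Hypothesis blocksE : blocks p = fiber_sets c.
Let D := subgraph_of G p.

Lemma clump_fiber B : B \in clumps p -> exists v, B = fiber_set c v.
Proof.
move=> Bp; have : B \in fiber_sets c by rewrite -blocksE inE Bp.
by case/imsetP => v _ ->; exists v.
Qed.

Lemma clump_same B u w : B \in clumps p -> u \in B -> w \in B -> c u = c w.
Proof. by move=> /clump_fiber[v ->]; rewrite !inE => /eqP -> /eqP ->. Qed.

Lemma fiber_cases v : fiber_set c v \in clumps p \/
  exists w, [/\ w \notin covered p, c w = v & forall w', c w' = v -> w' = w].
Proof.
have : fiber_set c v \in blocks p by rewrite blocksE imset_f.
rewrite inE => /orP[|/imsetP[w wp vE]]; [by left|right; exists w].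
have mw w' : (c w' == v) = (w' == w) by have /setP/(_ w') := vE; rewrite !inE.
split; first by rewrite inE in wp.
- by apply/eqP; rewrite mw.
- by move=> w' /eqP; rewrite mw => /eqP.
Qed.

Lemma clump_covered v w : fiber_set c v \in clumps p -> c w = v -> w \in covered p.
Proof. by move=> vp cw; apply/mem_covered; exists (fiber_set c v); rewrite // inE cw. Qed.

Lemma sub_liana l : l \in lianas D -> exists2 B, B \in clumps p & l \subset B.
Proof. by rewrite inE => /andP[lG nl]; exact: (subforest_liana pG). Qed.

Lemma sub_touch_covered : [/\ forall u w, (u, w) \in edges D -> (u \in covered p) /\ (w \in covered p),
  forall s w, s \in stolons D -> w \in s -> w \in covered p &
  forall l w, l \in lianas D -> w \in l -> w \in covered p].
Proof.
split.
- move=> u w /(subforest_edge pG)[B Bp /andP[uB wB]].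
  by split; apply/mem_covered; exists B.
- move=> s w /(subforest_stolon pG)[B Bp /subsetP sB] /sB wB.
  by apply/mem_covered; exists B.
- move=> l w /sub_liana[B Bp /subsetP lB] /lB wB.
  by apply/mem_covered; exists B.
Qed.

Lemma lianas_sub : lianas D \subset lianas G.
Proof. by apply/subsetP => l; rewrite inE => /andP[]. Qed.

Lemma subgraph_eaf : eaf_spec D.
Proof.
apply: eaf_spec_sub eafG; [exact: (subforest_edgeS pG)|exact: (subforest_stolonS pG)|].
exact: lianas_sub.
Qed.

Lemma subgraph_mono : mono_spec c D.
Proof.
split.
- by move=> u w /(subforest_edge pG)[B Bp /andP[]]; exact: clump_same.
- by move=> s u w /(subforest_stolon pG)[B Bp /subsetP sB] /sB us /sB; exact: (clump_same Bp us).
- by move=> s u w /sub_liana[B Bp /subsetP sB] /sB us /sB; exact: (clump_same Bp us).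
Qed.

Lemma uncovered_root w : w \notin covered p -> is_root D w.
Proof.
have [cE cS _] := sub_touch_covered.
move=> nw; apply/andP; split.
  by apply/negP => /has_succP[u /cE[wc _]]; rewrite wc in nw.
by apply/negP => /in_stolonP[s sD /(cS _ _ sD) wc]; rewrite wc in nw.
Qed.

Lemma subgraph_clumping : clumping_spec c D.
Proof.
have [mE mS mL] := subgraph_mono; split=> //; first exact: subgraph_eaf.
move=> v; have [vp|[w [nw cw uw]]] := fiber_cases v; last first.
  by exists w; split=> //; [exact: uncovered_root|move=> w' /uw].
have [h /bij_can[g hK gK] hE] := clump_bij eafG vp.
have := subforest_eat pG vp; rewrite hE (is_eat_pull hK gK) => /andP[_ /cards1P[r rE]].
have := set11 r; rewrite -rE inE is_root_restr; last exact: subgraph_mono.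
move=> rr; exists (val r); split=> //; first exact: fiber_val.
move=> w /eqP cw rw; rewrite -[w]/(val (Sub w cw : fiber c v)); congr val.
by apply/set1P; rewrite -rE inE is_root_restr //; exact: subgraph_mono.
Qed.

Lemma nblack_uncovered w : ~~ black (quot c G D) (c w) -> w \notin covered p.
Proof.
case/quot_nblackP => l [u [lG lD ul cu]].
have nu : u \notin covered p.
  by apply: contraNN lD => uc; rewrite inE lG; apply/pred0Pn; exists u; rewrite /= ul.
have [vp|[w' [nw' _ uw]]] := fiber_cases (c w).
  by rewrite (clump_covered vp) in nu.
by rewrite (uw w).
Qed.

Lemma black_covered w : black (quot c G D) (c w) -> w \in covered p.
Proof.
apply: contraTT => nw; have /nblackP[l lG wl] : ~~ black G w.
  by apply: contraNN nw; exact: (subforest_black pG).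
apply/quot_nblackP; exists l, w; split=> //.
have [_ _ cL] := sub_touch_covered.
by apply: contraNN nw => lD; exact: (cL l).
Qed.

Lemma subgraph_admissible : admissible c G D.
Proof.
have [cE cS cL] := sub_touch_covered.
apply/and4P; split.
- exact/clumpingP/subgraph_clumping.
- apply/and3P; split; [exact: (subforest_edgeS pG)|exact: (subforest_stolonS pG)|].
  exact: lianas_sub.
- have [h /bij_can[g hK gK] hE] := contraction_bij G c_surj blocksE.
  by have := subforest_quot pG; rewrite hE (is_eaf_pull hK gK).
apply/forallP => v; apply/implyP => nv.
have nc (x : fiber c v) : val x \notin covered p.
  by apply: nblack_uncovered; rewrite fiber_val.
have sne (P : {set {set V}}) : P \subset stolons G :|: lianas G ->
    (forall s w, s \in P -> w \in s -> w \in covered p) -> restr_sets c v P = set0.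
  move=> /subsetP sP cP; apply/setP => s; rewrite !inE; apply/negP => sP'.
  have : val @: s != set0 :> {set V}.
    have := sP _ sP'; rewrite -card_gt0 inE => /orP[/(eaf_stolon2 eafG)|/(eaf_liana2 eafG)] -> //.
  case/set0Pn => w ws; have wc := cP _ _ sP' ws.
  by case/imsetP: ws => x _ wx; rewrite wx (negPf (nc x)) in wc.
apply/eqP/graphP.
- apply/setP => -[x y]; rewrite edges_pull inE; apply/negP => /cE[xc _].
  by rewrite (negPf (nc x)) in xc.
- by apply: sne cS; apply: subset_trans (subforest_stolonS pG) (subsetUl _ _).
- by apply: sne cL; apply: subset_trans lianas_sub (subsetUr _ _).
Qed.

Lemma subgraph_of_clumps : [set fiber_set c v | v in [pred v | black (quot c G D) v]] = clumps p.
Proof.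
apply/setP => B; apply/imsetP/idP => [[v bv ->]|Bp].
  have [//|[w [nw cw _]]] := fiber_cases v.
  by case/negP: nw; apply: black_covered; rewrite cw.
have [v vE] := clump_fiber Bp; exists v => //.
suff bv : black (quot c G D) v by [].
have [w cw] := c_surj v; rewrite -cw; apply: contraT => nv.
by have /negP[] := nblack_uncovered nv; apply: (@clump_covered v); rewrite -?vE.
Qed.

Lemma subgraph_ofK : presubforest_of_graph c G D = p.
Proof. by rewrite /presubforest_of_graph subgraph_of_clumps /=; case: p. Qed.
End ToGraph.

Section FromGraph.
Variable D : graph V.
Hypothesis adm : admissible c G D.
Let p := presubforest_of_graph c G D.

Lemma admissible_clumping : clumping_spec c D.
Proof. by case/and4P: adm => /clumpingP. Qed.

Lemma admissible_sub : [/\ edges D \subset edges G, stolons D \subset stolons G & lianas D \subset lianas G].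
Proof. by case/and4P: adm => _ /and3P. Qed.

Lemma admissible_nblack v w : ~~ black (quot c G D) v -> c w = v ->
  [/\ forall w', c w' = v -> w' = w, black D w, is_root D w & preds D w = set0].
Proof.
move=> nv cw; case/and4P: adm => _ _ _ /forallP/(_ v)/implyP/(_ nv)/eqP D0.
exact: graph0_fiber admissible_clumping D0 cw.
Qed.

Lemma covered_black w : (w \in covered p) = black (quot c G D) (c w).
Proof.
apply/mem_covered/idP => [[_ /imsetP[v bv ->]]|bw]; first by rewrite inE => /eqP ->.
by exists (fiber_set c (c w)); [apply/imset_f|rewrite inE].
Qed.

Lemma admissible_liana_nblack l w : l \in lianas G -> l \notin lianas D -> w \in l ->
  ~~ black (quot c G D) (c w).
Proof. by move=> lG lD wl; apply/quot_nblackP; exists l, w. Qed.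

Lemma admissible_nblack_nblack w : ~~ black (quot c G D) (c w) -> ~~ black G w.
Proof.
move=> nv; case/quot_nblackP: (nv) => l [u [lG lD ul cu]].
have [uniq_w _ _ _] := admissible_nblack nv erefl.
by apply/nblackP; exists l => //; rewrite -(uniq_w u cu).
Qed.

Lemma graph_edge_black u w : (u, w) \in edges D -> black (quot c G D) (c u).
Proof.
move=> uw; apply: contraT => /admissible_nblack/(_ erefl)[_ _ /andP[/has_succP[]]].
by exists w.
Qed.

Lemma graph_stolon_black s w : s \in stolons D -> w \in s -> black (quot c G D) (c w).
Proof.
move=> sD ws; apply: contraT => /admissible_nblack/(_ erefl)[_ _ /andP[_ /in_stolonP[]]].
by exists s.
Qed.

Lemma graph_liana_black s w : s \in lianas D -> w \in s -> black (quot c G D) (c w).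
Proof.
move=> sD ws; apply: contraT => /admissible_nblack/(_ erefl)[_ bw _ _].
by have : ~~ black D w; [apply/nblackP; exists s | rewrite bw].
Qed.

Lemma presubforest_ofK : subgraph_of G p = D.
Proof.
have [_ _ /subsetP sL] := admissible_sub.
apply: graphP => //; apply/setP => l; rewrite inE; apply/andP/idP => [[lG]|lD].
  case/pred0Pn => w /= /andP[wl]; rewrite covered_black.
  by apply: contraTT => lD; exact: admissible_liana_nblack lD wl.
have lG := sL _ lD; split=> //; have : l != set0 by rewrite -card_gt0 (eaf_liana2 eafG lG).
case/set0Pn => w wl; apply/pred0Pn; exists w; rewrite /= wl covered_black.
exact: graph_liana_black lD wl.
Qed.

Lemma blocks_presubforest : blocks p = fiber_sets c.
Proof.
apply/setP => B; rewrite inE; apply/orP/imsetP => [[/imsetP[v _ ->]|/imsetP[w + ->]]|[v _ ->]].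
- by exists v.
- rewrite inE covered_black => /admissible_nblack/(_ erefl)[uw _ _ _]; exists (c w) => //.
  by apply/setP => u; rewrite !inE; apply/eqP/eqP => [->|/uw].
have [bv|nv] := boolP (black (quot c G D) v); [left|right]; first exact: imset_f.
have [w cw] := c_surj v; have [uw _ _ _] := admissible_nblack nv cw.
apply/imsetP; exists w; first by rewrite inE covered_black cw.
by apply/setP => u; rewrite !inE; apply/eqP/eqP => [/uw|->].
Qed.

Lemma mem_clumps v : (fiber_set c v \in clumps p) = black (quot c G D) v.
Proof.
apply/imsetP/idP => [[v' bv' /(fiber_set_inj c_surj) ->] //|bv].
by exists v.
Qed.

Lemma subset_fiber (s : {set V}) w : w \in s -> (forall u w, u \in s -> w \in s -> c u = c w) ->
  s \subset fiber_set c (c w).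
Proof. by move=> ws mono; apply/subsetP => u us; rewrite inE; apply/eqP/mono. Qed.

Lemma presubforest_spec : is_subforest G p.
Proof.
have clD := admissible_clumping; have [mE mS mL] := clumping_mono clD.
have [sE sS sL] := admissible_sub.
apply/subforestP; split=> //.
- apply: trivIsetS (fiber_sets_triv c); apply/subsetP => _ /imsetP[v _ ->]; exact: imset_f.
- by move=> w; rewrite covered_black; apply: contraTT; exact: admissible_nblack_nblack.
- move=> u w uw; exists (fiber_set c (c u)); last by rewrite !inE (mE _ _ uw) eqxx.
  by rewrite mem_clumps; exact: graph_edge_black uw.
- move=> s sD; have : s != set0.
    by rewrite -card_gt0 (eaf_stolon2 (clumping_eaf clD) sD).
  case/set0Pn => w ws; exists (fiber_set c (c w)).
    by rewrite mem_clumps; exact: graph_stolon_black sD ws.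
  by apply: subset_fiber => // u u' us; apply: mS us.
- move=> l lG /pred0Pn[w /= /andP[wl]]; rewrite covered_black => bw.
  exists (fiber_set c (c w)); first by rewrite mem_clumps.
  apply: subset_fiber => // u u' us; apply: mL us.
  by apply: contraTT bw => lD; exact: admissible_liana_nblack lD wl.
- move=> _ /imsetP[v bv ->]; have vp : fiber_set c v \in clumps p by rewrite mem_clumps.
  have [h /bij_can[g hK gK] ->] := clump_bij eafG vp.
  by rewrite presubforest_ofK (is_eat_pull hK gK); exact: is_eat_restr.
have [h /bij_can[g hK gK] ->] := contraction_bij G c_surj blocks_presubforest.
by rewrite presubforest_ofK (is_eaf_pull hK gK); case/and4P: adm.
Qed.
End FromGraph.

Section Weights.
Variables (R : realType) (a b : EAF -> R).

(** The value of [b] on the clumps times the value of [a] on the contraction, that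
is the contribution of [p] to the convolution of [b] and [a]. *)
Definition subforest_weight (p : presubforest V) : R :=
  (\prod_(B in clumps p) on_graph b (clump_graph G p B)) * on_graph a (contraction G p).

Definition admissible_weight (D : graph V) : R :=
  (\prod_(v | black (quot c G D) v) on_graph b (restr c v D)) * on_graph a (quot c G D).

(** Forgetting the partition and keeping the edges, stolons and lianas of the
trees is a bijection, because [c] already gives the partition. *)
Lemma sum_subforest_fixed_blocks :
  \sum_(p : presubforest V | is_subforest G p && (blocks p == fiber_sets c)) subforest_weight p =
  \sum_(D : graph V | admissible c G D) admissible_weight D.
Proof.
rewrite (reindex_onto (presubforest_of_graph c G) (subgraph_of G)) /=; last first.
  by move=> p /andP[/subforestP pG /eqP blocksE]; exact: subgraph_ofK.
apply: eq_big => [D|D].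
  apply/andP/idP => [[/andP[/subforestP pG /eqP blocksE] /eqP DE]|adm].
    by rewrite -DE; exact: subgraph_admissible.
  by rewrite presubforest_spec // blocks_presubforest // presubforest_ofK // !eqxx.
move=> /andP[/andP[/subforestP pG /eqP blocksE] /eqP DE].
have adm : admissible c G D by rewrite -DE; exact: subgraph_admissible.
rewrite /subforest_weight /admissible_weight; congr (_ * _); last first.
  have [h hb ->] := contraction_bij G c_surj blocksE.
  by rewrite on_graph_pull // presubforest_ofK.
rewrite big_imset /=; last by move=> v v' _ _ /(fiber_set_inj c_surj).
apply: eq_bigr => v bv.
have vp : fiber_set c v \in clumps (presubforest_of_graph c G D) by rewrite mem_clumps.
have [h hb ->] := clump_bij eafG vp.
by rewrite on_graph_pull // presubforest_ofK.
Qed.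
End Weights.
End Correspondence.

(** * The coaction as a sum over clumpings *)

Section Count.
Variables (V : finType) (P : {set {set V}}).
Hypothesis partP : partition P [set: V].

Definition has_blocks k (c : {ffun V -> 'I_k}) :=
  [forall v, exists w, c w == v] && (fiber_sets c == P).

Lemma has_blocks_surj k (c : {ffun V -> 'I_k}) : has_blocks c -> forall v, exists w, c w = v.
Proof. by case/andP => /forallP h _ v; have /existsP[w /eqP] := h v; exists w. Qed.

(** Such a map [c] is an ordering of the blocks of the partition. *)
Lemma card_has_blocks k :
  #|[set c : {ffun V -> 'I_k} | has_blocks c]| = if k == #|P| then k`! else 0%N.
Proof.
case: eqP => [kP|kP]; last first.
  apply/eqP; rewrite cards_eq0; apply/eqP/setP => c; rewrite !inE.
  apply/negP => hc; case: kP; have /andP[_ /eqP <-] := hc.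
  rewrite card_imset ?card_ord //; exact: fiber_set_inj (has_blocks_surj hc).
pose fs (c : {ffun V -> 'I_k}) := [ffun v => fiber_set c v].
have fsI : injective fs.
  move=> c c' /ffunP E; apply/ffunP => w; have := E (c w); rewrite !ffunE => /setP/(_ w).
  by rewrite !inE eqxx => /esym/eqP.
rewrite -(card_imset _ fsI) -[in RHS](ffactnn k) [X in (X ^_ _)%N]kP -[X in (_ ^_ X)%N](card_ord k).
rewrite -card_inj_ffuns_on; apply: eq_card => s.
case/and3P: partP => /eqP covP trivP P0.
rewrite !inE; apply/imsetP/andP => [[c + ->]|[sP /injectiveP sI]].
  rewrite inE => hc; have /andP[_ /eqP cP] := hc; split.
    by apply/ffun_onP => v; rewrite ffunE -cP; apply: imset_f.
  by apply/injectiveP => v v'; rewrite !ffunE; exact: fiber_set_inj (has_blocks_surj hc) _ _.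
have sPv v : s v \in P by move/ffun_onP: sP; apply.
have sE : s @: setT = P.
  apply/eqP; rewrite eqEcard (card_imset _ sI) cardsT card_ord -kP leqnn andbT.
  by apply/subsetP => _ /imsetP[v _ ->].
have ex w : exists v, w \in s v.
  have : w \in cover P by rewrite covP.
  by case/bigcupP => B; rewrite -sE => /imsetP[v _ ->]; exists v.
have [c cP] := fin_all_exists ex.
have cE v : fiber_set (finfun c) v = s v.
  apply/setP => w; rewrite inE ffunE; apply/eqP/idP => [<-//|wv].
  by apply: sI; rewrite -(def_pblock trivP _ (cP w)) // -(def_pblock trivP _ wv).
exists (finfun c); last by apply/ffunP => v; rewrite ffunE cE.
rewrite inE; apply/andP; split; last first.
  apply/eqP; rewrite -sE /fiber_sets -(eq_imset _ cE); apply/setP => B.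
  by apply/imsetP/imsetP => -[v _ ->]; exists v.
apply/forallP => v; apply/existsP; have : s v != set0.
  by apply: contraNneq P0 => <-.
by case/set0Pn => w; rewrite -cE inE => ?; exists w.
Qed.

Lemma card_blocks_le : (#|P| <= #|V|)%N.
Proof.
rewrite -[#|V|]cardsT (card_partition partP) -sum1_card; apply: leq_sum => B BP.
rewrite card_gt0; case/and3P: partP => _ _; apply: contraNneq => <- //.
Qed.

Lemma sum_has_blocks (R : realType) :
  \sum_(k < #|V|.+1) ((k`!)%:R : R)^-1 * (#|[set c : {ffun V -> 'I_k} | has_blocks c]|)%:R = 1.
Proof.
have lt : (#|P| < #|V|.+1)%N by rewrite ltnS card_blocks_le.
rewrite (bigD1 (Ordinal lt)) //= card_has_blocks eqxx mulVf ?pnatr_eq0 -?lt0n ?fact_gt0 //.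
rewrite big1 ?addr0 // => k; rewrite -val_eqE /= => /negPf nk.
by rewrite card_has_blocks nk mulr0.
Qed.
End Count.

Section Star.
Import finmap.
Variables (R : realType) (a : EAF -> R) (b0 : EAT -> R).
Let b := extend0 b0.

Lemma characterM m1 m2 : character b0 (mmul m1 m2) = character b0 m1 * character b0 m2.
Proof.
have wide (m : {cmonom EAT}) (X : {fset EAT}) : (finsupp m `<=` X)%fset ->
    character b0 m = \prod_(t <- X) b0 t ^+ m t.
  move=> mX; rewrite /character (big_fset_incl _ mX) // => t _.
  by rewrite -cmE_neq0 negbK => /eqP ->.
rewrite {1}/character mdomD (wide _ _ (fsubsetUl (finsupp m1) (finsupp m2)))
  (wide _ _ (fsubsetUr (finsupp m1) (finsupp m2))) -big_split /=.
by apply: eq_bigr => t _; rewrite cmM exprD.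
Qed.

Lemma character1 : character b0 mone = 1.
Proof. by rewrite /character mdom1 big_seq_fset0. Qed.

Lemma characterU t : character b0 (ucm t) = b0 t.
Proof. by rewrite /character mdomU big_seq_fset1 cmUU expr1. Qed.

Lemma extend0_eat (t : EAT) : b (val t) = b0 t.
Proof. by rewrite /b /extend0 valK. Qed.

(** The sum defining [star], taken over a labeled graph in place of the
representative of a class. *)
Definition star_on (V : finType) (G : graph V) : R :=
  \sum_(p : presubforest V | is_subforest G p) subforest_weight G a b p.

Lemma star_rep (t : EAF) : star b0 a t = star_on (rep (tagged t)).
Proof.
rewrite /star /CEM raddf_sum /star_on; set G := rep (tagged t).
rewrite [RHS]big_sig /=; apply: eq_bigr => p _.
rewrite mmapU /= mul1r /tensor /subforest_weight /=; congr (_ * _); last first.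
  by rewrite (on_graph_ord a (subforest_contraction p)).
rewrite /clump_monomial (big_morph _ characterM character1).
rewrite [RHS]big_sig; apply: eq_bigr => B _.
rewrite characterU -extend0_eat /= (on_graph_ord b (is_eat_eaf (subforest_clump (valP B)))).
by [].
Qed.
End Star.

Lemma blocks_partition (V : finType) (G : graph V) (p : presubforest V) :
  is_subforest G p -> partition (blocks p) [set: V].
Proof.
move=> /subforestP pG; have cov w : w \in cover (blocks p).
  have [/mem_covered[B Bp wB]|nw] := boolP (w \in covered p).
    by apply/bigcupP; exists B; rewrite // inE Bp.
  apply/bigcupP; exists [set w]; last exact: set11.
  by rewrite inE; apply/orP; right; apply: imset_f; rewrite inE.
apply/and3P; split.
- by apply/eqP/setP => w; rewrite cov inE.
- have disj B w : B \in clumps p -> w \notin covered p -> w \notin B.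
    by move=> Bp; apply: contraNN => wB; apply/mem_covered; exists B.
  apply/trivIsetP => A B; rewrite !inE => /orP[Ap|/imsetP[x + ->]] /orP[Bp|/imsetP[y + ->]].
  + by move/trivIsetP: (subforest_triv pG); apply.
  + by rewrite inE => ny _; rewrite disjoint_sym disjoints1 disj.
  + by rewrite inE => nx _; rewrite disjoints1 disj.
  + by move=> _ _ xy; rewrite disjoints1 inE; apply: contraNneq xy => ->.
rewrite inE negb_or; apply/andP; split.
  apply/negP => /(subforest_eat pG)/andP[_ /cards1P[r _]].
  by case: r => r; rewrite cards0.
by apply/negP => /imsetP[w _ /setP/(_ w)]; rewrite !inE eqxx.
Qed.

Section StarSum.
Variables (R : realType) (a : EAF -> R) (b0 : EAT -> R).
Let b := extend0 b0.

(** Summing over the orderings of the blocks counts every subforest [k!] times,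
with [k] the number of its blocks. *)
Lemma star_on_sum (V : finType) (G : graph V) : is_eaf G ->
  star_on a b0 G = \sum_(k < #|V|.+1) ((k`!)%:R)^-1 *
    \sum_(c : {ffun V -> 'I_k}) \sum_(D : graph V | admissible c G D)
      admissible_weight c G a b D.
Proof.
move=> /is_eafP eafG; rewrite /star_on.
transitivity (\sum_(p | is_subforest G p) \sum_(k < #|V|.+1) ((k`!)%:R : R)^-1 *
    \sum_(c : {ffun V -> 'I_k} | has_blocks (blocks p) c) subforest_weight G a b p).
  apply: eq_bigr => p /blocks_partition part.
  rewrite -[LHS]mul1r -[X in X * _ = _](sum_has_blocks part R) big_distrl /=.
  apply: eq_bigr => k _; rewrite sumr_const -mulrA; congr (_ * _).
  rewrite -[RHS]mulr_natl; congr (_%:R * _).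
  by apply: eq_card => c; rewrite inE.
rewrite exchange_big /=; apply: eq_bigr => k _; rewrite -big_distrr /=; congr (_ * _).
rewrite (exchange_big_dep predT) //=; apply: eq_bigr => c _.
have [/forallP c_surj|nsurj] := boolP [forall v, exists w, c w == v]; last first.
  rewrite big_pred0 => [|p]; last by rewrite /has_blocks (negPf nsurj) andbF.
  rewrite big_pred0 // => D; apply/negP => /and4P[/clumping_root_fun[r rP] _ _ _].
  case/negP: nsurj; apply/forallP => v; apply/existsP; exists (r v).
  by case: (rP v) => -> _ _.
rewrite -(sum_subforest_fixed_blocks eafG) => [|v]; last first.
  by have /existsP[w /eqP] := c_surj v; exists w.
have surj : [forall v, exists w, c w == v] by apply/forallP.
by apply: eq_bigl => p; rewrite /has_blocks surj [fiber_sets c == _]eq_sym.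
Qed.

Section Relabel.
Variables (V K : finType) (s : {perm V}) (c c' : V -> K).
Hypothesis c'E : c' =1 c \o s.

Lemma quot_relabel G D : quot c' (pull s G) (pull s D) = quot c G D.
Proof.
have cs (t : {set V}) : c' @: t = c @: (s @: t).
  by rewrite -imset_comp; apply: eq_imset.
have sK (t : {set V}) : s @: (s^-1%g @: t) = t.
  by rewrite -imset_comp (eq_imset (g := id)) ?imset_id // => x /=; rewrite permKV.
apply: graphP; apply/setP => t.
- apply/imsetP/imsetP => -[e eG ->].
    exists (s e.1, s e.2); last by rewrite /= !c'E.
    by move: eG; rewrite !inE.
  exists (s^-1 e.1, s^-1 e.2)%g; last by rewrite /= !c'E /= !permKV.
  by move: eG; rewrite !inE /= !permKV; case: e.
- apply/imsetP/imsetP => -[t' tG ->].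
    exists (s @: t'); last exact: cs.
    by move: tG; rewrite !inE.
  exists (s^-1%g @: t'); last by rewrite cs sK.
  by move: tG; rewrite !inE sK.
- apply/imsetP/imsetP => -[t' tG ->].
    exists (s @: t'); last exact: cs.
    by move: tG; rewrite !inE.
  exists (s^-1%g @: t'); last by rewrite cs sK.
  by move: tG; rewrite !inE sK.
Qed.

Lemma restr_relabel D v : exists2 h : fiber c' v -> fiber c v, bijective h &
  restr c' v (pull s D) = pull h (restr c v D).
Proof.
have [|||h hb hE] := @same_image _ _ _ (s \o (val : fiber c' v -> V)) (val : fiber c v -> V).
- exact: inj_comp (@perm_inj _ s) val_inj.
- exact: val_inj.
- move=> w; apply/codomP/codomP => -[x ->].
    have cx : c (s (val x)) == v by have := valP x; rewrite c'E.
    by exists (Sub (s (val x)) cx).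
  have cx : c' (s^-1%g (val x)) == v by rewrite c'E /= permKV (valP x).
  by exists (Sub (s^-1%g (val x)) cx); rewrite /= permKV.
by exists h => //; rewrite /restr !pull_pull; apply: pull_ext => x; rewrite /= hE.
Qed.

Lemma clumping_relabel D : clumping c D -> clumping c' (pull s D).
Proof.
case/clumpingP => eafD mE mS mL rD; apply/clumpingP; split.
- exact: eaf_spec_pull (@perm_inj _ s) eafD.
- by move=> u w; rewrite edges_pull !c'E; exact: mE.
- move=> t u w; rewrite inE !c'E => tD ut wt.
  by apply: mS tD _ _; exact: imset_f.
- move=> t u w; rewrite inE !c'E => tD ut wt.
  by apply: mL tD _ _; exact: imset_f.
move=> v; have [w [cw rw uw]] := rD v; exists (s^-1%g w).
rewrite c'E (is_root_pull (permK s) (permKV s)) /= permKV; split=> // w'.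
rewrite c'E (is_root_pull (permK s) (permKV s)) => cw' rw'.
by rewrite -(uw (s w')) ?permK.
Qed.

Lemma subset_relabel (G D : graph V) : [&& edges D \subset edges G,
    stolons D \subset stolons G & lianas D \subset lianas G] ->
  [&& edges (pull s D) \subset edges (pull s G),
    stolons (pull s D) \subset stolons (pull s G) & lianas (pull s D) \subset lianas (pull s G)].
Proof.
case/and3P => /subsetP sE /subsetP sS /subsetP sL.
by apply/and3P; split; apply/subsetP => x; rewrite !inE; [exact: sE|exact: sS|exact: sL].
Qed.

Lemma admissible_relabel G D : admissible c G D -> admissible c' (pull s G) (pull s D).
Proof.
case/and4P => clD sD qD /forallP nD; apply/and4P; split.
- exact: clumping_relabel.
- exact: subset_relabel.
- by rewrite quot_relabel.
apply/forallP => v; rewrite quot_relabel; apply/implyP => /(implyP (nD v))/eqP D0.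
have [h _ ->] := restr_relabel D v; rewrite D0.
by apply/eqP/graphP; apply/setP => x; rewrite !inE.
Qed.

Lemma admissible_weight_relabel G D :
  admissible_weight c' (pull s G) a b (pull s D) = admissible_weight c G a b D.
Proof.
rewrite /admissible_weight quot_relabel; congr (_ * _); apply: eq_bigr => v _.
by have [h hb ->] := restr_relabel D v; rewrite on_graph_pull.
Qed.
End Relabel.

(** The right-hand side of [star_on_sum] involves only maps and graphs on the
vertices, which can be relabeled by [s] simultaneously. *)
Lemma star_on_pull (V : finType) (s : {perm V}) (G : graph V) : is_eaf G ->
  star_on a b0 (pull s G) = star_on a b0 G.
Proof.
move=> eafG; rewrite !star_on_sum ?(is_eaf_pull (permK s) (permKV s)) //.
apply: eq_bigr => k _; congr (_ * _).
pose comp (t : {perm V}) (c : {ffun V -> 'I_k}) : {ffun V -> 'I_k} := [ffun w => c (t w)].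
have compK t : cancel (comp t) (comp (t^-1)%g).
  by move=> c; apply/ffunP => w; rewrite !ffunE permKV.
have compKV t : cancel (comp (t^-1)%g) (comp t).
  by move=> c; apply/ffunP => w; rewrite !ffunE permK.
rewrite (reindex (comp s)); last by exists (comp (s^-1)%g) => c _; [exact: compK|exact: compKV].
apply: eq_bigr => c _; have cE : comp s c =1 c \o s by move=> w; rewrite ffunE.
have pK (t : {perm V}) : cancel (@pull V V t) (pull t^-1%g).
  by move=> D; apply: pull_can; exact: permKV.
rewrite (reindex (pull s)); last first.
  by exists (pull s^-1%g) => D _; [exact: pK|apply: pull_can; exact: permK].
apply: eq_big => D; last by move=> _; exact: admissible_weight_relabel.
apply/idP/idP => [|h]; last exact: admissible_relabel h.
rewrite -{2}(pK s G) -{2}(pK s D); apply: admissible_relabel => w.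
by rewrite /= ffunE permKV.
Qed.
End StarSum.

(** * Elementary differentials on finite types *)

Lemma perm_enum_imset (U V : finType) (h : U -> V) (A : {set U}) (B : {set V}) :
  injective h -> h @: A = B -> perm_eq [seq h u | u <- enum A] (enum B).
Proof.
move=> hI AB; apply: uniq_perm; rewrite ?map_inj_uniq ?enum_uniq // => v.
rewrite mem_enum -AB; apply/mapP/imsetP => -[u uA ->]; exists u => //.
  by rewrite mem_enum in uA.
by rewrite mem_enum.
Qed.

Section ElementaryDifferential.
Variables (R : realType) (d : nat).
Local Notation E := 'rV[R]_d.

Definition index_compat (V : finType) (G : graph V) (i : V -> 'I_d) : bool :=
  [forall s in stolons G :|: lianas G, forall u in s, forall v in s, i u == i v].

Lemma index_compatP (V : finType) (G : graph V) (i : V -> 'I_d) : reflect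
  ((forall s u v, s \in stolons G -> u \in s -> v \in s -> i u = i v) /\
   (forall s u v, s \in lianas G -> u \in s -> v \in s -> i u = i v)) (index_compat G i).
Proof.
apply: (iffP forall_inP) => [h|[hS hL] s].
  split=> s u v sG us vs.
    have sG' : s \in stolons G :|: lianas G by rewrite inE sG.
    by have /forall_inP/(_ _ us)/forall_inP/(_ _ vs)/eqP := h s sG'.
  have sG' : s \in stolons G :|: lianas G by rewrite inE sG orbT.
  by have /forall_inP/(_ _ us)/forall_inP/(_ _ vs)/eqP := h s sG'.
rewrite inE => /orP[] sG; apply/forall_inP => u us; apply/forall_inP => v vs; apply/eqP.
  exact: hS vs.
exact: hL vs.
Qed.

Definition elem_diff_on (V : finType) (G : graph V) (f : V -> E -> E) (phi : E -> R)
    (x : E) : R :=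
  \sum_(i : {ffun V -> 'I_d}) (index_compat G i)%:R *
    (\prod_(v | black G v)
       partial [seq i u | u <- enum (preds G v)] (fun y => f v y 0 (i v)) x) *
    partial [seq i r | r <- enum (roots G)] phi x.

Lemma elem_diff_onE n (G : graph 'I_n) f phi x :
  elem_diff G f phi x = elem_diff_on G f phi x.
Proof. by []. Qed.

Lemma index_compat_pull (U V : finType) (h : U -> V) (g : V -> U) (G : graph V)
    (i : V -> 'I_d) : cancel h g -> cancel g h ->
  index_compat (pull h G) (i \o h) = index_compat G i.
Proof.
move=> hK gK; have back (s : {set V}) : h @: (g @: s) = s.
  by rewrite -imset_comp (eq_imset (g := id)) ?imset_id.
apply/index_compatP/index_compatP => -[hS hL]; split=> s u v.
- by rewrite -[s]back -[u]gK -[v]gK !(mem_imset _ _ (can_inj hK)) => sG; apply: hS; rewrite inE.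
- by rewrite -[s]back -[u]gK -[v]gK !(mem_imset _ _ (can_inj hK)) => sG; apply: hL; rewrite inE.
- by rewrite inE => sG us vs; apply: hS sG _ _; apply: imset_f.
- by rewrite inE => sG us vs; apply: hL sG _ _; apply: imset_f.
Qed.

Lemma elem_diff_on_pull (U V : finType) (h : U -> V) (G : graph V) (f : V -> E -> E)
    (f' : U -> E -> E) (phi : E -> R) (x : E) :
    bijective h -> f' =1 f \o h ->
    (forall v, black G v -> smooth_field (f v)) -> smooth phi ->
  elem_diff_on (pull h G) f' phi x = elem_diff_on G f phi x.
Proof.
case=> g hK gK fE fs phis; rewrite /elem_diff_on.
rewrite (reindex (fun i : {ffun V -> 'I_d} => [ffun u => i (h u)])) /=; last first.
  by exists (fun i : {ffun U -> 'I_d} => [ffun v => i (g v)]) => i _;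
    apply/ffunP => v; rewrite !ffunE ?hK ?gK.
apply: eq_bigr => i _; congr (_ * _ * _).
- rewrite -(index_compat_pull _ _ hK gK) ; congr (nat_of_bool _)%:R.
  by apply/index_compatP/index_compatP => -[hS hL]; split=> s u v sG us vs;
    have := hS s u v; have := hL s u v; rewrite /= !ffunE; auto.
- rewrite [RHS](reindex h); last by exists g => v _; [exact: hK|exact: gK].
  apply: eq_big => [u|u]; first by rewrite (black_pull hK gK).
  rewrite (black_pull hK gK) => bu; rewrite fE /= ffunE.
  apply: (congr1 (@^~ x)); apply: partial_perm; first exact: fs.
  rewrite (eq_map (g := i \o h)) => [|w]; last by rewrite ffunE.
  rewrite map_comp; apply: perm_map; apply: perm_enum_imset; first exact: can_inj hK.
  exact: preds_pull gK _ _.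
apply: (congr1 (@^~ x)); apply: partial_perm => //.
rewrite (eq_map (g := i \o h)) => [|w]; last by rewrite ffunE.
rewrite map_comp; apply: perm_map; apply: perm_enum_imset; first exact: can_inj hK.
exact: roots_pull_bij hK gK G.
Qed.

Section Series.
Variables (f : E -> E) (fs : smooth_field f).

Lemma S_series_labeled (a : EAF -> R) n phi x : smooth phi ->
  S_series f a n phi x = (n`!%:R)^-1 *
    \sum_(G : graph 'I_n | is_eaf G) on_graph a G * elem_diff_on G (fun=> f) phi x.
Proof.
move=> phis; rewrite /S_series.
rewrite -(sum_EAF_labeled (F := fun G => on_graph a G * elem_diff_on G (fun=> f) phi x)).
  apply: eq_bigr => t _; rewrite elem_diff_onE mulrAC; congr (_ * _ / _).
  exact: esym (on_graph_rep a (Tagged EAF_ t)).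
move=> s G; have sb : bijective s by exists s^-1%g; [exact: permK|exact: permKV].
by rewrite on_graph_pull // (elem_diff_on_pull _ sb (f := fun=> f)).
Qed.

Lemma on_graph_extend0 (b0 : EAT -> R) (V : finType) (G : graph V) :
  ~~ is_eat G -> on_graph (extend0 b0) G = 0.
Proof.
move=> nG; have [eafG|neaf] := boolP (is_eaf G); last exact: on_graph_not_eaf.
have [r eK rK] := enum_val_setT_can V.
have h : is_eaf (pull (@enum_val V (mem [set: V])) G) by rewrite (is_eaf_pull eK rK).
rewrite (on_graph_class _ h); last by exists r.
rewrite /extend0 insubF //= is_eat_class (is_eat_pull eK rK).
exact: negPf.
Qed.

(** The factorial absorbs the [1 / n!] of the labeled sum, and a tree on ordinals
can be transported to any set [W] of the same size. *)
Lemma field_of_labeled (b0 : EAT -> R) (W : finType) (j : 'I_d) (y : E) :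
  (#|W|`!%:R) * field_of (S_series f (extend0 b0)) #|W| y 0 j =
  \sum_(T : graph W | is_eat T) on_graph (extend0 b0) T *
     elem_diff_on T (fun=> f) (fun z => z 0 j) y.
Proof.
have js := smooth_coord R j.
rewrite mxE S_series_labeled // mulrA mulfV ?mul1r ?pnatr_eq0 -?lt0n ?fact_gt0 //.
have hK := @enum_rankK W; have gK := @enum_valK W.
have pK (U V : finType) (h : U -> V) (g : V -> U) : cancel g h -> cancel (@pull U V h) (pull g).
  by move=> gK' D; apply: pull_can.
rewrite (reindex (pull (@enum_val W W))); last first.
  by exists (pull enum_rank) => D _; apply: pull_can.
have eb : bijective (@enum_val W W) by exists enum_rank.
rewrite [LHS]big_mkcond [RHS]big_mkcond; apply: eq_bigr => T _.
rewrite (is_eaf_pull gK hK) on_graph_pull // (elem_diff_on_pull _ eb (f := fun=> f)) //.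
case: ifP => [eafT|neaf]; last by rewrite /is_eat neaf.
by case: ifP => // /negbT ?; rewrite on_graph_extend0 // mul0r.
Qed.

(** A coordinate function has constant first derivatives: the root gets the index
[j], and only the factors of the vertices depend on the point. *)
Lemma elem_diff_on_coord (W : finType) (T : graph W) (r : W) (j : 'I_d) (y : E) :
    roots T = [set r] ->
  elem_diff_on T (fun=> f) (fun z => z 0 j) y =
  \sum_(i : {ffun W -> 'I_d}) ((index_compat T i)%:R * (j == i r)%:R) *
    \prod_(v | black T v)
       partial [seq i u | u <- enum (preds T v)] (fun y => f y 0 (i v)) y.
Proof.
by move=> rE; apply: eq_bigr => i _; rewrite rE enum_set1 partial_coord /= mulrAC.
Qed.
End Series.
End ElementaryDifferential.

(** * Substituting trees for vertices *)

Section Attach.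
Variables (V K : finType) (c : V -> K) (D : graph V) (H : graph K) (rt : K -> V).
Hypotheses (clD : clumping_spec c D) (eafH : eaf_spec H).
Hypothesis rtP : forall v, [/\ c (rt v) = v, is_root D (rt v) &
                              forall w, c w = v -> is_root D w -> w = rt v].
Hypothesis empty_nblack : forall v, ~~ black H v -> restr c v D = graph0 _.
Hypothesis stolon_root : forall s v, s \in stolons H -> v \in s -> black D (rt v).

(** [H] is lifted to the vertices of [D] through the root [rt v] of each tree. The
edges of [H] leave from the roots, and [att] chooses where they arrive. *)
Definition attach (att : K -> V) : graph V :=
  Graph (edges D :|: [set (rt u, att u) | u in [pred u | has_succ H u]])
        (stolons D :|: [set rt @: s | s : {set K} in stolons H])
        (lianas D :|: [set rt @: l | l : {set K} in lianas H]).

(** The successor [att u] is a black vertex of the tree that replaces the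
successor of [u] in [H]. The value at the vertices without successor is fixed to
the root, so that an attachment is determined by the graph it builds. *)
Definition attachment (att : K -> V) :=
  [forall u, if has_succ H u then black D (att u) && ((u, c (att u)) \in edges H)
             else att u == rt u].

Definition detach (G : graph V) : {ffun K -> V} :=
  [ffun u => if [pick w | (rt u, w) \in edges G :\: edges D] is Some w then w else rt u].

Lemma c_rt v : c (rt v) = v. Proof. by case: (rtP v). Qed.

Lemma rt_inj : injective rt. Proof. exact: can_inj c_rt. Qed.

Lemma imset_rt (s : {set K}) : c @: (rt @: s) = s.
Proof.
by rewrite -imset_comp (eq_imset (g := id)) ?imset_id // => v; exact: c_rt.
Qed.

Lemma rtE w : is_root D w -> rt (c w) = w.
Proof. by case: (rtP (c w)) => _ _ h rw; rewrite -(h w). Qed.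

Lemma rt_edge u w : (rt u, w) \in edges D -> False.
Proof. by case: (rtP u) => _ /andP[/has_succP h _] _ uw; apply: h; exists w. Qed.

Lemma rt_stolon u s : s \in stolons D -> rt u \in s -> False.
Proof. by case: (rtP u) => _ /andP[_ /in_stolonP h] _ sD us; apply: h; exists s. Qed.

Lemma nblack_fiber u : ~~ black H u -> [/\ forall w, c w = u -> w = rt u,
  black D (rt u), preds D (rt u) = set0 & forall w, c w = u -> is_root D w].
Proof.
move=> nu; have D0 := empty_nblack nu.
have [h b _ p] := graph0_fiber clD D0 (c_rt u); split=> // w cw.
by case: (graph0_fiber clD D0 cw).
Qed.

Lemma liana_black_rt l u : l \in lianas D -> rt u \in l -> ~~ black H u -> False.
Proof.
move=> lD ul /nblack_fiber[_ bu _ _]; have : ~~ black D (rt u) by apply/nblackP; exists l.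
by rewrite bu.
Qed.

Lemma liana_nblack l u : l \in lianas H -> u \in l -> ~~ black H u.
Proof. by move=> lH ul; apply/nblackP; exists l. Qed.

Lemma eaf_nonempty (W : finType) (X : graph W) s : eaf_spec X ->
  (s \in stolons X) || (s \in lianas X) -> exists v, v \in s.
Proof.
move=> eafX sX; suff /set0Pn : s != set0 by [].
by case/orP: sX => [/(eaf_stolon2 eafX)|/(eaf_liana2 eafX)] s2; rewrite -card_gt0 s2.
Qed.

Section Attached.
Variable att : K -> V.
Hypothesis attP : attachment att.
Let G := attach att.

Lemma attachmentE u : has_succ H u -> black D (att u) /\ (u, c (att u)) \in edges H.
Proof. by move=> hu; have := forallP attP u; rewrite hu => /andP[]. Qed.

Lemma attach_edgeP x y : reflect ((x, y) \in edges D \/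
  exists u, [/\ has_succ H u, x = rt u & y = att u]) ((x, y) \in edges G).
Proof.
rewrite inE; apply: (iffP orP) => -[xy|]; try by left.
  by case/imsetP => u hu [-> ->]; right; exists u.
by move=> [u [hu -> ->]]; right; apply: (imset_f (fun u => (rt u, att u))).
Qed.

Lemma attach_stolonP s : reflect (s \in stolons D \/
  exists2 t, t \in stolons H & s = rt @: t) (s \in stolons G).
Proof.
rewrite inE; apply: (iffP orP) => -[xy|]; try by left.
  by case/imsetP => u hu ->; right; exists u.
by move=> [u hu ->]; right; apply: imset_f.
Qed.

Lemma attach_lianaP s : reflect (s \in lianas D \/
  exists2 t, t \in lianas H & s = rt @: t) (s \in lianas G).
Proof.
rewrite inE; apply: (iffP orP) => -[xy|]; try by left.
  by case/imsetP => u hu ->; right; exists u.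
by move=> [u hu ->]; right; apply: imset_f.
Qed.

(** The only new constraint is on stolons: their ends are roots of trees of [D],
and [stolon_root] makes these black. The fibers over the numbered vertices of
[H] are single vertices without predecessors, so the lianas of [H] still join
leaves. *)
Lemma attach_eaf : eaf_spec G.
Proof.
have eafD := clumping_eaf clD; split.
- move=> v w w' /attach_edgeP[vw|[u [hu -> ->]]] /attach_edgeP[vw'|[u' [hu' vE ->]]].
  + exact: (eaf_succ eafD) vw vw'.
  + by rewrite vE in vw; case: (rt_edge vw).
  + by case: (rt_edge vw').
  + by rewrite (rt_inj vE).
- move=> s /attach_stolonP[/(eaf_stolon2 eafD) //|[t /(eaf_stolon2 eafH) t2 ->]].
  by rewrite card_imset //; exact: rt_inj.
- move=> s t v /attach_stolonP[sD|[s' sH ->]] /attach_stolonP[tD|[t' tH ->]].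
  + exact: (eaf_stolonI eafD).
  + by move=> vs /imsetP[u _ vE]; rewrite vE in vs; case: (rt_stolon sD vs).
  + by move=> /imsetP[u _ ->] us; case: (rt_stolon tD us).
  + move=> /imsetP[u us ->]; rewrite (mem_imset _ _ rt_inj) => ut.
    by rewrite (eaf_stolonI eafH sH tH us ut).
- move=> s v w /attach_stolonP[sD|[s' sH ->]].
    move=> vs /attach_edgeP[vw|[u [_ vE _]]]; first exact: (eaf_stolon_succ eafD) vs vw.
    by rewrite vE in vs; case: (rt_stolon sD vs).
  case/imsetP => z zs ->; case/attach_edgeP => [/rt_edge //|[u [/has_succP[u' uu'] /rt_inj zu _]]].
  by rewrite zu in zs; exact: (eaf_stolon_succ eafH) sH zs uu'.
- move=> s /attach_lianaP[/(eaf_liana2 eafD) //|[t /(eaf_liana2 eafH) t2 ->]].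
  by rewrite card_imset //; exact: rt_inj.
- move=> s t v /attach_lianaP[sD|[s' sH ->]] /attach_lianaP[tD|[t' tH ->]].
  + exact: (eaf_lianaI eafD).
  + move=> vs /imsetP[u ut vE]; rewrite vE in vs.
    by case: (liana_black_rt sD vs); exact: liana_nblack ut.
  + move=> /imsetP[u ut ->] us.
    by case: (liana_black_rt tD us); exact: liana_nblack ut.
  + move=> /imsetP[u us ->]; rewrite (mem_imset _ _ rt_inj) => ut.
    by rewrite (eaf_lianaI eafH sH tH us ut).
- move=> l x v /attach_lianaP[lD|[l' lH ->]].
    move=> vl /attach_edgeP[xv|[u [hu _ vE]]]; first exact: (eaf_liana_pred eafD) vl xv.
    have [+ _] := attachmentE hu; rewrite -vE => bv.
    by have : ~~ black D v; [apply/nblackP; exists l|rewrite bv].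
  case/imsetP => z zl ->; have nz := liana_nblack lH zl.
  have [_ _ pz _] := nblack_fiber nz.
  case/attach_edgeP => [xz|[u [hu _ zE]]].
    by have : x \in preds D (rt z); [rewrite inE|rewrite pz inE].
  have [_] := attachmentE hu; rewrite -zE c_rt; exact: (eaf_liana_pred eafH) lH zl.
- move=> l s v /attach_lianaP[lD|[l' lH ->]] vl /attach_stolonP[sD|[s' sH ->]].
  + exact: (eaf_liana_stolon eafD) lD vl sD.
  + move=> /imsetP[u us vE]; rewrite vE in vl; have := stolon_root sH us.
    by apply/negP/nblackP; exists l.
  + by case/imsetP: vl => u _ -> us; case: (rt_stolon sD us).
  + case/imsetP: vl => u ul ->; rewrite (mem_imset _ _ rt_inj).
    exact: (eaf_liana_stolon eafH) lH ul sH.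
Qed.

Lemma attach_newE x y : ((x, y) \in edges G :\: edges D) =
  has_succ H (c x) && (x == rt (c x)) && (y == att (c x)).
Proof.
rewrite in_setD; apply/andP/andP => [[nD /attach_edgeP[xy|[u [hu -> ->]]]]|].
- by rewrite xy in nD.
- by rewrite c_rt hu !eqxx.
move=> [/andP[hu /eqP xE] /eqP yE]; rewrite xE; split; first by apply/negP => /rt_edge.
by apply/attach_edgeP; right; exists (c x).
Qed.

Lemma attach_new_stolons : stolons G :\: stolons D = [set rt @: s | s : {set K} in stolons H].
Proof.
apply/setP => s; rewrite in_setD; apply/andP/idP => [[nD]|].
  by rewrite inE (negPf nD).
case/imsetP => t tH ->; split; last by apply/attach_stolonP; right; exists t.
have [u ut] : exists u, u \in t by apply: (eaf_nonempty eafH); rewrite tH.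
by apply/negP => tD; apply: (rt_stolon tD (imset_f rt ut)).
Qed.

Lemma attach_new_lianas : lianas G :\: lianas D = [set rt @: s | s : {set K} in lianas H].
Proof.
apply/setP => s; rewrite in_setD; apply/andP/idP => [[nD]|].
  by rewrite inE (negPf nD).
case/imsetP => t tH ->; split; last by apply/attach_lianaP; right; exists t.
have [u ut] : exists u, u \in t by apply: (eaf_nonempty eafH); rewrite tH orbT.
by apply/negP => tD; apply: (liana_black_rt tD (imset_f rt ut)); exact: liana_nblack ut.
Qed.

Lemma quot_attach : quot c G D = H.
Proof.
apply: graphP; rewrite /quot /=.
- apply/setP => -[u v]; apply/imsetP/idP => [[[x y] + [-> ->]]|uv].
    rewrite attach_newE => /andP[/andP[hu /eqP xE] /eqP ->] /=.
    by case: (attachmentE hu).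
  have hu : has_succ H u by apply/has_succP; exists v.
  exists (rt u, att u); first by rewrite attach_newE c_rt hu !eqxx.
  rewrite /= c_rt; congr (_, _); have [_] := attachmentE hu.
  exact: (eaf_succ eafH) uv.
- rewrite attach_new_stolons -imset_comp (eq_imset (g := id)) ?imset_id //.
  by move=> s; exact: imset_rt.
- rewrite attach_new_lianas -imset_comp (eq_imset (g := id)) ?imset_id //.
  by move=> s; exact: imset_rt.
Qed.

Lemma attach_admissible : admissible c G D.
Proof.
apply/and4P; split; first exact/clumpingP.
- by apply/and3P; split; exact: subsetUl.
- by rewrite quot_attach; exact/is_eafP.
by apply/forallP => v; rewrite quot_attach; apply/implyP => /empty_nblack ->.
Qed.

Lemma detach_attach : detach G =1 att.
Proof.
move=> u; rewrite ffunE; case: pickP => [w|none].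
  by rewrite attach_newE c_rt => /andP[_ /eqP].
have := forallP attP u; case: ifP => [hu _|_ /eqP //].
by have := none (att u); rewrite attach_newE c_rt hu !eqxx.
Qed.

Lemma black_attach w : black G w = black D w && black H (c w).
Proof.
apply: negb_inj; rewrite negb_and; apply/nblackP/orP => [[l /attach_lianaP[lD|[l' lH ->]]]|[]].
- by move=> wl; left; apply/nblackP; exists l.
- by case/imsetP => u ul ->; right; rewrite c_rt; exact: liana_nblack ul.
- by case/nblackP => l lD wl; exists l => //; apply/attach_lianaP; left.
move=> nw; have [rw _ _ _] := nblack_fiber nw; case/nblackP: nw => l lH wl.
exists (rt @: l); first by apply/attach_lianaP; right; exists l.
by rewrite (rw w erefl) imset_f.
Qed.

Lemma roots_attach : rt @: roots H = roots G.
Proof.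
apply/setP => w; rewrite inE; apply/imsetP/andP => [[u + ->]|[nE nS]].
  rewrite inE => /andP[nE nS]; split.
    apply/negP => /has_succP[w' /attach_edgeP[/rt_edge //|[u' [hu' /rt_inj uE _]]]].
    by rewrite uE hu' in nE.
  apply/negP => /in_stolonP[s /attach_stolonP[sD us|[t tH ->]]]; first exact: rt_stolon sD us.
  rewrite (mem_imset _ _ rt_inj) => ut; case/negP: nS; apply/in_stolonP.
  by exists t.
have rw : is_root D w.
  apply/andP; split.
    apply: contraNN nE => /has_succP[w' ww']; apply/has_succP; exists w'.
    by apply/attach_edgeP; left.
  apply: contraNN nS => /in_stolonP[s sD ws]; apply/in_stolonP; exists s => //.
  by apply/attach_stolonP; left.
exists (c w); last by rewrite rtE.
rewrite inE; apply/andP; split.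
  apply: contraNN nE => hu; apply/has_succP; exists (att (c w)).
  by apply/attach_edgeP; right; exists (c w); split=> //; rewrite rtE.
apply: contraNN nS => /in_stolonP[t tH wt]; apply/in_stolonP; exists (rt @: t).
  by apply/attach_stolonP; right; exists t.
by rewrite -(rtE rw) imset_f.
Qed.

Lemma preds_attach w : black G w -> perm_eq (enum (preds G w))
  ([seq rt u | u <- enum (preds H (c w)) & att u == w] ++ enum (preds D w)).
Proof.
rewrite black_attach => /andP[bD bH]; apply: uniq_perm; first exact: enum_uniq.
  rewrite cat_uniq enum_uniq (map_inj_uniq rt_inj) filter_uniq ?enum_uniq //= andbT.
  apply/hasPn => x; rewrite mem_enum inE => xw; apply/mapP => -[u _ xE].
  by rewrite xE in xw; case: (rt_edge xw).
move=> x; rewrite mem_cat !mem_enum !mem_preds; apply/idP/orP => [/attach_edgeP[xw|[u [hu -> ->]]]|[]].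
- by right.
- left; apply/mapP; exists u => //; rewrite mem_filter eqxx mem_enum mem_preds.
  by case: (attachmentE hu).
- case/mapP => u; rewrite mem_filter mem_enum mem_preds => /andP[/eqP aw uw] ->.
  apply/attach_edgeP; right; exists u; split=> //.
  by apply/has_succP; exists (c w).
- by move=> xw; apply/attach_edgeP; left.
Qed.
End Attached.

Section Detached.
Variable G : graph V.
Hypotheses (eafG : eaf_spec G) (adm : admissible c G D) (qH : quot c G D = H).

Let sub := admissible_sub adm.

(** A vertex that is not a root of [D] already has its successor, or its stolon,
in [D], and there is only one of them in [G]. *)
Lemma new_edge_root x y : (x, y) \in edges G :\: edges D -> x = rt (c x).
Proof.
case: sub => /subsetP sE /subsetP sS _; rewrite in_setD => /andP[nD xy].
rewrite rtE //; apply/andP; split.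
  apply/negP => /has_succP[z xz]; case/negP: nD.
  by rewrite -(eaf_succ eafG (sE _ xz) xy).
by apply/negP => /in_stolonP[s sD xs]; exact: (eaf_stolon_succ eafG) (sS _ sD) xs xy.
Qed.

Lemma new_edge_quot x y : (x, y) \in edges G :\: edges D -> (c x, c y) \in edges H.
Proof. by move=> xy; rewrite -qH; apply/imsetP; exists (x, y). Qed.

Lemma new_edge_black x y : (x, y) \in edges G :\: edges D -> black D y.
Proof.
case: sub => _ _ /subsetP sL; rewrite in_setD => /andP[_ xy].
apply: contraT => /nblackP[l lD yl]; case: (eaf_liana_pred eafG (sL _ lD) yl xy).
Qed.

Lemma new_stolon_root s : s \in stolons G :\: stolons D -> rt @: (c @: s) = s.
Proof.
case: sub => /subsetP sE /subsetP sS _; rewrite in_setD => /andP[nD sG].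
rewrite -imset_comp -[RHS]imset_id; apply: eq_in_imset => x xs /=.
rewrite rtE //; apply/andP; split.
  by apply/negP => /has_succP[y /sE]; exact: (eaf_stolon_succ eafG) sG xs.
apply/negP => /in_stolonP[t tD xt]; case/negP: nD.
by rewrite (eaf_stolonI eafG sG (sS _ tD) xs xt).
Qed.

(** A liana outside [D] makes its ends numbered in [H], where the fibers have a
single vertex. *)
Lemma new_liana_root l : l \in lianas G :\: lianas D -> rt @: (c @: l) = l.
Proof.
rewrite in_setD => /andP[nD lG].
rewrite -imset_comp -[RHS]imset_id; apply: eq_in_imset => x xl /=.
have nx : ~~ black H (c x) by rewrite -qH; apply/quot_nblackP; exists l, x.
by have [h _ _ _] := nblack_fiber nx; rewrite -(h x).
Qed.

Lemma detachP u : has_succ H u -> (rt u, detach G u) \in edges G :\: edges D.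
Proof.
case/has_succP => v; rewrite -[X in edges X]qH => /imsetP[[x y] xy [uE vE]].
rewrite ffunE; case: pickP => [w //|/(_ y)].
by rewrite uE /= -(new_edge_root xy) xy.
Qed.

Lemma detach_attachment : attachment (detach G).
Proof.
apply/forallP => u; case: ifP => hu.
  have e := detachP hu; rewrite (new_edge_black e) /=.
  by have := new_edge_quot e; rewrite c_rt.
rewrite ffunE; case: pickP => // w /new_edge_quot; rewrite c_rt => uw.
by have : has_succ H u; [apply/has_succP; exists (c w)|rewrite hu].
Qed.

Lemma attach_detach : attach (detach G) = G.
Proof.
case: sub => sE sS sL; apply: graphP; apply/setP => s.
- case: s => x y; apply/attach_edgeP/idP => [[xy|[u [hu -> ->]]]|xy].
  + exact: (subsetP sE).
  + by have := detachP hu; rewrite in_setD => /andP[].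
  have [xyD|nxy] := boolP ((x, y) \in edges D); [by left|right].
  have xy' : (x, y) \in edges G :\: edges D by rewrite in_setD nxy.
  have hu : has_succ H (c x) by apply/has_succP; exists (c y); exact: new_edge_quot.
  exists (c x); split=> //; first exact: new_edge_root xy'.
  have := detachP hu; rewrite -(new_edge_root xy') in_setD => /andP[_ xd].
  exact: (eaf_succ eafG) xy xd.
- apply/attach_stolonP/idP => [[sD|[t]]|sG]; first exact: (subsetP sS).
    rewrite -[X in stolons X]qH => /imsetP[s' s'G -> ->]; rewrite new_stolon_root //.
    by move: s'G; rewrite in_setD => /andP[].
  have [sD|nD] := boolP (s \in stolons D); [by left|right].
  have sG' : s \in stolons G :\: stolons D by rewrite in_setD nD.
  exists (c @: s); last by rewrite new_stolon_root.
  by rewrite -qH; apply/imsetP; exists s.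
- apply/attach_lianaP/idP => [[sD|[t]]|sG]; first exact: (subsetP sL).
    rewrite -[X in lianas X]qH => /imsetP[s' s'G -> ->]; rewrite new_liana_root //.
    by move: s'G; rewrite in_setD => /andP[].
  have [sD|nD] := boolP (s \in lianas D); [by left|right].
  have sG' : s \in lianas G :\: lianas D by rewrite in_setD nD.
  exists (c @: s); last by rewrite new_liana_root.
  by rewrite -qH; apply/imsetP; exists s.
Qed.
End Detached.
End Attach.

Lemma prod_natr_bool (R : comNzRingType) (K : finType) (P : pred K) :
  \prod_v ((P v)%:R : R) = [forall v, P v]%:R.
Proof.
case: (boolP [forall v, P v]) => [/forallP h|].
  by rewrite big1 // => v _; rewrite h.
by rewrite negb_forall => /existsP[v /negPf nv]; rewrite (bigD1 v) //= nv mul0r.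
Qed.

Section Expansion.
Variables (R : realType) (d : nat).
Local Notation E := 'rV[R]_d.
Variables (f : E -> E) (fs : smooth_field f) (phi : E -> R) (phis : smooth phi) (x : E).
Variables (V K : finType) (c : V -> K) (D : graph V) (H : graph K).
Hypotheses (clD : clumping c D) (eafH : is_eaf H).
Hypothesis empty_nblack : forall v, ~~ black H v -> restr c v D = graph0 _.
Hypothesis stolon_root : forall s v w,
  s \in stolons H -> v \in s -> c w = v -> is_root D w -> black D w.

Let clumpD : clumping_spec c D. Proof. exact/clumpingP. Qed.
Let eafSpecH : eaf_spec H. Proof. exact/is_eafP. Qed.
Let mD := clumping_mono clumpD.

Variable rt : {ffun K -> V}.
Hypothesis rtP : forall v, [/\ c (rt v) = v, is_root D (rt v) &
                              forall w, c w = v -> is_root D w -> w = rt v].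

Let crt v : c (rt v) = v. Proof. by case: (rtP v). Qed.

Definition fiber_root v : fiber c v := Sub (rt v) (introT eqP (crt v)).

Lemma roots_restr v : roots (restr c v D) = [set fiber_root v].
Proof.
apply/setP => w; rewrite !inE is_root_restr //; have [_ rr ur] := rtP v.
apply/idP/eqP => [rw|-> //]; apply/val_inj/ur; rewrite ?fiber_val //.
Qed.

(** The derivative of [f] that a vertex [w] of [D] contributes to the elementary
differential of [D], for a given choice [i] of indices. *)
Definition factor (i : V -> 'I_d) (w : V) : E -> R :=
  partial [seq i u | u <- enum (preds D w)] (fun y => f y 0 (i w)).

Lemma smooth_factor i w : smooth (factor i w).
Proof. by apply: smooth_partial; exact: fs. Qed.

Definition restr_fun v (i : {ffun V -> 'I_d}) : {ffun fiber c v -> 'I_d} :=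
  [ffun w => i (val w)].

(** The vertices of a clump that carry a factor of the elementary differential.
The vertex of a fiber which is numbered in [H] is black in [D], but not in the
substituted graph, whence the last condition. *)
Definition clump_active v (w : V) := [&& c w == v, black D w & black H v].

Definition clump_term (j : K -> 'I_d) v (i : {ffun fiber c v -> 'I_d}) : R :=
  (index_compat (restr c v D) i)%:R * (j v == i (fiber_root v))%:R *
  partial [seq j u | u <- enum (preds H v)]
    (fun y => \prod_(w : fiber c v | black (restr c v D) w && black H v)
       partial [seq i u | u <- enum (preds (restr c v D) w)] (fun z => f z 0 (i w)) y) x.

Definition clump_factor (j : K -> 'I_d) v : R :=
  if black H v then
    partial [seq j u | u <- enum (preds H v)]
      (elem_diff_on (restr c v D) (fun=> f) (fun z => z 0 (j v))) x
  else 1.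

(** At a numbered vertex of [H] the fiber is a single vertex, and the sum reduces
to the index [j v]; both kinds of vertices can then be treated alike. *)
Lemma clump_factorE j v : clump_factor j v = \sum_(i : {ffun fiber c v -> 'I_d}) clump_term j i.
Proof.
rewrite /clump_factor /clump_term; case: ifP => bv.

  have sF (i : {ffun fiber c v -> 'I_d}) : smooth (fun y =>
      \prod_(w : fiber c v | black (restr c v D) w)
       partial [seq i u | u <- enum (preds (restr c v D) w)] (fun z => f z 0 (i w)) y).
    by apply: smooth_prod => w _; apply: smooth_partial; exact: fs.
  rewrite (_ : elem_diff_on _ _ _ = fun y => \sum_(i : {ffun fiber c v -> 'I_d})
     ((index_compat (restr c v D) i)%:R * (j v == i (fiber_root v))%:R) *
      \prod_(w : fiber c v | black (restr c v D) w)
       partial [seq i u | u <- enum (preds (restr c v D) w)] (fun z => f z 0 (i w)) y).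
    rewrite partial_sum; last by move=> i _; apply: smoothM => //; exact: smooth_cst.
    apply: eq_bigr => i _; rewrite partialZ //; congr (_ * partial _ _ _).
    by apply/funext => y; apply: eq_bigl => w; rewrite andbT.
  by apply/funext => y; rewrite (elem_diff_on_coord _ _ _ (roots_restr v)).
have nv := negbT bv.
have [uw _ _ _] := nblack_fiber clumpD rtP empty_nblack nv.
have p0 : enum (preds H v) = [::].
  rewrite (_ : preds H v = set0) ?enum_set0 //; apply/setP => u; rewrite mem_preds inE.
  by apply/negP; case/nblackP: nv => l lH vl; exact: (eaf_liana_pred eafSpecH lH vl).
rewrite (bigD1 [ffun=> j v]) //= p0 /= big_pred0 => [|w]; last by rewrite andbF.
rewrite ffunE eqxx !mulr1 (_ : index_compat _ _); last first.
  rewrite empty_nblack //; apply/forall_inP => s; by rewrite !inE.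
rewrite big1 ?addr0 // => i ni; rewrite (_ : j v == _ = false) ?mulr0 ?mul0r //.
apply: contraNF ni => /eqP ji; apply/eqP/ffunP => w; rewrite ffunE ji; congr (i _).
by apply/val_inj; apply: uw; exact: fiber_val.
Qed.

Lemma index_compat_ext (W : finType) (X : graph W) (i i' : W -> 'I_d) : i =1 i' ->
  index_compat X i = index_compat X i'.
Proof.
by move=> ii'; apply: eq_forallb => s; congr (_ ==> _); apply: eq_forallb => u;
  congr (_ ==> _); apply: eq_forallb => v; rewrite !ii'.
Qed.

Lemma clump_term_restr j v (i : {ffun V -> 'I_d}) :
  clump_term j (restr_fun v i) =
  (index_compat (restr c v D) (fun w => i (val w)))%:R * (j v == i (rt v))%:R *
  partial [seq j u | u <- enum (preds H v)]
    (fun y => \prod_(w | clump_active v w) factor i w y) x.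
Proof.
rewrite /clump_term; congr (_ * _); first congr (_ * _).
- by congr (nat_of_bool _)%:R; apply: index_compat_ext => w; rewrite ffunE.
- by rewrite ffunE.
apply: (congr1 (fun g => partial [seq j u | u <- enum (preds H v)] g x)).
apply/funext => y; rewrite big_mkcondr [RHS]big_mkcondr /= [RHS]big_sig big_mkcond.
apply: eq_bigr => w _; rewrite black_restr //; case: (black D _) => //=.
case: ifP => // _; apply: (congr1 (@^~ y)); rewrite ffunE; apply: partial_perm; first exact: fs.
rewrite (eq_map (g := i \o val)) => [|u]; last by rewrite ffunE.
rewrite map_comp; apply: perm_map; apply: perm_enum_imset; first exact: val_inj.
exact: preds_restr.
Qed.

Lemma prod_clump_factor (j : K -> 'I_d) :
  \prod_v clump_factor j v = \sum_(i : {ffun V -> 'I_d}) \prod_v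
   ((index_compat (restr c v D) (fun w => i (val w)))%:R * (j v == i (rt v))%:R *
    partial [seq j u | u <- enum (preds H v)]
      (fun y => \prod_(w | clump_active v w) factor i w y) x).
Proof.
under eq_bigr => v _ do rewrite clump_factorE.
(* A vertex takes its index from the family member of its own fiber. *)
pose glue_fun (s : forall v, {ffun fiber c v -> 'I_d}) : {ffun V -> 'I_d} :=
  [ffun w => s (c w) (Sub w (eqxx (c w)))].
rewrite (prod_sum_glue (P := xpredT) (res := restr_fun) (glue := glue_fun)) //.
- by apply: eq_bigr => i _; apply: eq_bigr => v _; rewrite clump_term_restr.
- move=> s v _; apply/ffunP => w; rewrite !ffunE.
  case: w => w cw /=; move: (cw); rewrite -(eqP cw) => cw'.
  by congr (s _ _); apply: val_inj.
- move=> i s _ sE; apply/ffunP => w; rewrite ffunE sE ffunE //.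
Qed.

(** The Leibniz rule sends every derivative coming from a predecessor in [H] to
one of the active vertices of the clump. The choices made in the different
clumps concern different vertices of [H], as successors are unique, and they
form an attachment. *)
Lemma prod_attach (i : {ffun V -> 'I_d}) :
  \prod_v partial [seq i (rt u) | u <- enum (preds H v)]
      (fun y => \prod_(w | clump_active v w) factor i w y) x =
  \sum_(att : {ffun K -> V} | attachment c D H rt att)
    \prod_(w | black D w && black H (c w))
      partial ([seq i (rt u) | u <- enum (preds H (c w)) & att u == w] ++
               [seq i u | u <- enum (preds D w)]) (fun y => f y 0 (i w)) x.
Proof.
under eq_bigr => v _ do
  rewrite (partial_prod (fun u => i (rt u)) rt (enum_uniq _) (fun w _ => smooth_factor i w)).
pose res v (att : {ffun K -> V}) : {ffun K -> V} :=
  [ffun u => if (u, v) \in edges H then att u else rt u].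
pose glue_att (s : K -> {ffun K -> V}) : {ffun K -> V} :=
  [ffun u => if [pick v | (u, v) \in edges H] is Some v then s v u else rt u].
pose Q v (g : {ffun K -> V}) :=
  [forall u, if u \in enum (preds H v) then clump_active v (g u) else g u == rt u].
have Hblack u v : (u, v) \in edges H -> black H v.
  move=> uv; apply: contraT => /nblackP[l lH vl].
  by case: (eaf_liana_pred eafSpecH lH vl uv).
have pickE u v : (u, v) \in edges H -> [pick v | (u, v) \in edges H] = Some v.
  move=> uv; case: pickP => [v' uv'|/(_ v)]; last by rewrite uv.
  by rewrite (eaf_succ eafSpecH uv uv').
have pickN u : ~~ has_succ H u -> [pick v | (u, v) \in edges H] = None.
  by move=> nu; case: pickP => // v uv; case/has_succP: nu; exists v.
have Qin v g u : Q v g -> (u, v) \in edges H -> clump_active v (g u).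
  by move=> /forallP/(_ u); rewrite mem_enum mem_preds => + uv; rewrite uv.
have Qout v g u : Q v g -> (u, v) \notin edges H -> g u = rt u.
  by move=> /forallP/(_ u); rewrite mem_enum mem_preds => + /negPf nuv; rewrite nuv => /eqP.
rewrite (prod_sum_glue (S := fun=> {ffun K -> V}) (Q := Q) (T := {ffun K -> V})
  (P := fun att => attachment c D H rt att) (res := res)
  (glue := glue_att)).
- apply: eq_bigr => att attP; rewrite [RHS](partition_big c predT) //=.
  apply: eq_bigr => v _; apply: eq_big => [w|w].
    by rewrite /clump_active; case: eqP => [->|]; rewrite ?andbT ?andbF.
  case/and3P => /eqP cw bw bv; rewrite cw -partial_cat; congr (partial (map _ _ ++ _) _ _).
  apply: eq_in_filter => u; rewrite mem_enum mem_preds => uv.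
  by rewrite ffunE uv.
- move=> s Qs; apply/forallP => u; rewrite ffunE; case: ifP => [/has_succP[v uv]|/negbT nu].
    rewrite (pickE _ _ uv); have /and3P[/eqP cs bs _] := Qin _ _ _ (Qs v) uv.
    by rewrite bs cs.
  by rewrite pickN.
- move=> s v Qs; apply/ffunP => u; rewrite !ffunE; case: ifP => [uv|/negbT nuv].
    by rewrite (pickE _ _ uv).
  by rewrite (Qout _ _ _ (Qs v) nuv).
- move=> att /forallP attP v; apply/forallP => u; rewrite mem_enum mem_preds ffunE.
  case: (boolP ((u, v) \in edges H)) => [uv|_] /=; last by rewrite eqxx.
  have hu : has_succ H u by apply/has_succP; exists v.
  have := attP u; rewrite hu => /andP[bu uc].
  by rewrite /clump_active bu (Hblack _ _ uv) (eaf_succ eafSpecH uc uv) eqxx.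
move=> att s /forallP attP sE; apply/ffunP => u; rewrite ffunE.
case: pickP => [v uv|none]; first by rewrite sE ffunE uv.
have := attP u; case: ifP => [/has_succP[v uv]|_ /eqP //].
by have := none v; rewrite uv.
Qed.

Lemma index_compat_restr (i : V -> 'I_d) :
  [forall v, index_compat (restr c v D) (fun w => i (val w))] = index_compat D i.
Proof.
have lift (s : {set V}) u : u \in s -> (forall w, w \in s -> c w = c u) ->
    s = val @: ((val : fiber c (c u) -> V) @^-1: s).
  move=> us cs; apply/setP => w; apply/idP/imsetP => [ws|[y + ->]]; last by rewrite inE.
  have cw : c w == c u by rewrite cs.
  by exists (Sub w cw); rewrite ?inE SubK.
apply/forallP/index_compatP => [h|[hS hL] v].
  split=> s u w sD us ws.
  - have cs y : y \in s -> c y = c u by move=> ys; exact: (mono_stolon mD sD).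
    have /index_compatP[hS _] := h (c u).
    have cw : c w == c u by rewrite cs.
    apply: (hS (val @^-1: s) (Sub u (eqxx (c u))) (Sub w cw)); rewrite inE ?SubK //.
    by rewrite -lift.
  - have cs y : y \in s -> c y = c u by move=> ys; exact: (mono_liana mD sD).
    have /index_compatP[_ hL] := h (c u).
    have cw : c w == c u by rewrite cs.
    apply: (hL (val @^-1: s) (Sub u (eqxx (c u))) (Sub w cw)); rewrite inE ?SubK //.
    by rewrite -lift.
apply/index_compatP; split=> s u w; rewrite inE => sD us ws.
  by apply: hS sD _ _; apply: imset_f.
by apply: hL sD _ _; apply: imset_f.
Qed.

Lemma index_compat_attach att (i : V -> 'I_d) :
  index_compat (attach D H rt att) i = index_compat H (fun u => i (rt u)) && index_compat D i.
Proof.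
apply/index_compatP/andP => [[hS hL]|[/index_compatP[S1 L1] /index_compatP[S2 L2]]].
  split; apply/index_compatP; split=> s u v sD us vs.
  - by apply: (hS (rt @: s)); rewrite ?imset_f // inE imset_f ?orbT.
  - by apply: (hL (rt @: s)); rewrite ?imset_f // inE imset_f ?orbT.
  - by apply: (hS s); rewrite // inE sD.
  - by apply: (hL s); rewrite // inE sD.
split=> s u v; rewrite inE => /orP[sD|/imsetP[t tH ->]].
- exact: S2.
- by move=> /imsetP[u' u't ->] /imsetP[v' v't ->]; exact: (S1 t).
- exact: L2.
- by move=> /imsetP[u' u't ->] /imsetP[v' v't ->]; exact: (L1 t).
Qed.

Let stolon_rt s v : s \in stolons H -> v \in s -> black D (rt v).
Proof. by move=> sH vs; have [cr rr _] := rtP v; exact: (stolon_root sH vs cr rr). Qed.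

(** The indices [j] on [H] are those of the roots of [D], the product rule yields
a sum over attachments, and attachments correspond to the graphs [G] of which
[H] is the quotient by [D]. *)
Lemma sum_substitution :
  \sum_(j : {ffun K -> 'I_d}) (index_compat H j)%:R * (\prod_v clump_factor j v) *
     partial [seq j r | r <- enum (roots H)] phi x =
  \sum_(G : graph V | admissible c G D && (quot c G D == H) && is_eaf G)
     elem_diff_on G (fun=> f) phi x.
Proof.
transitivity (\sum_(i : {ffun V -> 'I_d}) (index_compat H (fun u => i (rt u)))%:R *
    (index_compat D i)%:R *
    (\prod_v partial [seq i (rt u) | u <- enum (preds H v)]
      (fun y => \prod_(w | clump_active v w) factor i w y) x) *
    partial [seq i (rt r) | r <- enum (roots H)] phi x).
  under eq_bigr => j _ do rewrite prod_clump_factor big_distrr big_distrl /=.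
  rewrite exchange_big /=; apply: eq_bigr => i _.
  rewrite (bigD1 [ffun v => i (rt v)]) //= [X in _ + X]big1 ?addr0 => [|j nj]; last first.
    have [v nv] : exists v, j v != i (rt v).
      apply/existsP; rewrite -negb_forall; apply: contraNN nj => /forallP h.
      by apply/eqP/ffunP => v; rewrite ffunE (eqP (h v)).
    by rewrite [X in _ * X * _](bigD1 v) //= (negPf nv) !(mulr0, mul0r).
  rewrite -index_compat_restr.
  rewrite -(prod_natr_bool R (fun v => index_compat (restr c v D) (fun w => i (val w)))).
  congr (_ * _); last first.
    by congr (partial _ _ _); apply: eq_map => r; rewrite ffunE.
  rewrite -mulrA. rewrite -big_split /=; congr (_%:R * _).
    by congr nat_of_bool; apply: index_compat_ext => v; rewrite ffunE.
  apply: eq_bigr => v _; rewrite ffunE eqxx mulr1; congr (_ * partial _ _ _).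
  by apply: eq_map => u; rewrite ffunE.
transitivity (\sum_(att : {ffun K -> V} | attachment c D H rt att)
    elem_diff_on (attach D H rt att) (fun=> f) phi x).
  under eq_bigr => i _ do rewrite prod_attach big_distrr big_distrl /=.
  rewrite exchange_big /=; apply: eq_bigr => att attP; apply: eq_bigr => i _.
  rewrite -natrM mulnb -(index_compat_attach att i); congr (_ * _ * _).
    apply: eq_big => w; first by rewrite (black_attach clumpD rtP).
    move=> bw; have bG : black (attach D H rt att) w by rewrite (black_attach clumpD rtP).
    apply: (congr1 (@^~ x)); apply: partial_perm; first exact: fs.
    rewrite perm_sym (perm_trans (perm_map i (preds_attach clumpD rtP empty_nblack attP bG))) //.
    by rewrite map_cat -map_comp.
  apply: (congr1 (@^~ x)); apply: partial_perm => //.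
  rewrite (map_comp i); apply: perm_map; apply: perm_enum_imset; first exact: rt_inj rtP.
  exact: (roots_attach H rtP att).
rewrite [RHS](reindex_onto (fun att : {ffun K -> V} => attach D H rt att)
   (fun G => detach D rt G)) /=; last first.
  move=> G /andP[/andP[adm /eqP qH] /is_eafP eafG].
  exact: (attach_detach clumpD rtP empty_nblack eafG adm qH).
apply: eq_bigl => att; apply/idP/andP => [attP|[/andP[/andP[adm /eqP qH] /is_eafP eafG] /eqP dE]].
  split; last by apply/eqP/ffunP; exact: (detach_attach rtP attP).
  rewrite (attach_admissible clumpD eafSpecH rtP empty_nblack attP).
  rewrite (quot_attach clumpD eafSpecH rtP empty_nblack attP) eqxx.
  by apply/is_eafP; exact: (attach_eaf clumpD eafSpecH rtP empty_nblack stolon_rt attP).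
by rewrite -dE; exact: (detach_attachment rtP eafG adm qH).
Qed.
End Expansion.

(** * Comparison of the two series *)

Lemma is_eat_graph0 (W : finType) : is_eat (graph0 W) = (#|W| == 1%N).
Proof.
have eaf0 : is_eaf (graph0 W).
  by apply/is_eafP; split=> [v w w'|s|s t v|s v w|s|s t v|l u v|l s v];
    rewrite /graph0 /= in_set0.
rewrite /is_eat eaf0 /=; congr (_ == _); apply: eq_card => w; rewrite !inE.
rewrite /is_root /in_stolon /cover big_set0 inE andbT.
by apply/existsP => -[u]; rewrite inE.
Qed.

Lemma rep_eaf_class n (G : graph 'I_n) (hG : is_eaf G) :
  exists s : {perm 'I_n}, rep (tagged (eaf_class hG)) = pull s G.
Proof.
have /eqquotP/existsP[s /eqP /= sE] := reprK (\pi_(EAF_ n)%qT (exist _ G hG)).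
exists (s^-1)%g; rewrite -[in RHS]sE; apply/esym/pull_can.
by move=> i /=; rewrite permKV.
Qed.

Section Assembly.
Variables (R : realType) (d : nat).
Local Notation E := 'rV[R]_d.
Variables (f : E -> E) (fs : smooth_field f).
Variables (a : EAF -> R) (b0 : EAT -> R).
Let b := extend0 b0.
Let g := field_of (S_series f b).

Lemma smooth_elem_diff_on (W : finType) (T : graph W) (h : W -> E -> E) (psi : E -> R) :
  (forall w, smooth_field (h w)) -> smooth psi -> smooth (elem_diff_on T h psi).
Proof.
move=> hs psis; apply: smooth_sum => i _; apply: smoothM; last exact: smooth_partial.
apply: smoothM; first exact: smooth_cst.
by apply: smooth_prod => w _; apply: smooth_partial; exact: hs.
Qed.

Lemma smooth_field_of m : smooth_field (g m).
Proof.
move=> i; rewrite [X in smooth X](_ : _ = fun y => (m`!%:R)^-1 *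
   \sum_(G : graph 'I_m | is_eaf G) on_graph b G * elem_diff_on G (fun=> f) (fun z => z 0 i) y).
  apply: smoothM; first exact: smooth_cst.
  apply: smooth_sum => G _; apply: smoothM; first exact: smooth_cst.
  by apply: smooth_elem_diff_on => //; exact: smooth_coord.
by apply/funext => y; rewrite mxE S_series_labeled //; exact: smooth_coord.
Qed.

(** A tree has a root, hence a vertex. *)
Lemma field_of0 y j : g 0%N y 0 j = 0.
Proof.
rewrite mxE S_series_labeled; [|exact: fs|exact: smooth_coord].
rewrite big1 ?mulr0 // => G _; rewrite on_graph_extend0 ?mul0r //.
by apply/negP => /andP[_ /cards1P[]] [].
Qed.

Section Fixed.
Variables (n : nat) (phi : E -> R) (phis : smooth phi) (x : E).

(** At a numbered vertex of [H] the empty graph on a fiber of size one plays the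
role of the tree, which encodes that this vertex has degree one. *)
Definition tree_term k (c : 'I_n -> 'I_k) (H : graph 'I_k) (j : 'I_k -> 'I_d) v
    (T : graph (fiber c v)) : R :=
  if black H v then
    on_graph b T * partial [seq j u | u <- enum (preds H v)]
      (elem_diff_on T (fun=> f) (fun z => z 0 (j v))) x
  else (T == graph0 _)%:R.

Definition degree_term k (H : graph 'I_k) (j : 'I_k -> 'I_d) v (m : nat) : R :=
  if black H v then partial [seq j u | u <- enum (preds H v)] (fun y => g m y 0 (j v)) x
  else (m == 1%N)%:R.

Lemma sum_tree_term k (c : {ffun 'I_n -> 'I_k}) H j v :
  #|[set w | c w == v]|`!%:R * degree_term H j v #|[set w | c w == v]| =
  \sum_(T : graph (fiber c v) | is_eat T) tree_term H j T.
Proof.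
have cE : #|[set w | c w == v]| = #|{: fiber c v}|.
  by rewrite card_sig; apply: eq_card => w; rewrite inE.
rewrite cE /degree_term /tree_term; case: (black H v); last first.
  rewrite [RHS]big_mkcond (bigD1 (graph0 _)) //= big1 ?addr0 => [|T nT]; last first.
    by rewrite (negPf nT); case: ifP.
  rewrite eqxx is_eat_graph0; case: eqP => [->|_]; last by rewrite mulr0.
  by rewrite mulr1.
have smT (T : graph (fiber c v)) :
    smooth (elem_diff_on T (fun=> f) (fun z => z 0 (j v))).
  by apply: smooth_elem_diff_on => //; exact: smooth_coord.
rewrite -[LHS]/((fun z => #|{: fiber c v}|`!%:R * partial _ _ z) x) -partialZ; last first.
  exact: smooth_field_of.
rewrite (_ : (fun y => _ * _) = fun y => \sum_(T : graph (fiber c v) | is_eat T)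
   on_graph b T * elem_diff_on T (fun=> f) (fun z => z 0 (j v)) y); last first.
  by apply/funext => y; rewrite field_of_labeled.
rewrite partial_sum => [|T _]; last by apply: smoothM => //; exact: smooth_cst.
by apply: eq_bigr => T _; rewrite partialZ.
Qed.

(** The contribution of [H] in degree [n] to the series along the formal vector
field [g]. *)
Definition degree_sum k (H : graph 'I_k) : R :=
  \sum_(m : {ffun 'I_k -> 'I_n.+1} |
             [&& [forall v, (0 < m v)%N],
                 [forall v, ~~ black H v ==> (m v == 1%N :> nat)] &
                 (\sum_v m v == n)%N])
      elem_diff_on H (fun v => g (m v)) phi x.

(** A choice of degrees [m] becomes the choice of a map [c] with fibers of sizes
[m v], on which the trees of the components [g (m v)] live. The constraints on
the degrees hold for every map with a nonzero contribution, because there is no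
tree of degree zero. *)
Lemma degree_sumE k (H : graph 'I_k) :
  degree_sum H = (n`!%:R)^-1 * \sum_(c : {ffun 'I_n -> 'I_k})
    \sum_(j : {ffun 'I_k -> 'I_d}) (index_compat H j)%:R *
      (\prod_v \sum_(T : graph (fiber c v) | is_eat T) tree_term H j T) *
      partial [seq j r | r <- enum (roots H)] phi x.
Proof.
rewrite /degree_sum exchange_big [X in _ = _ * X]exchange_big /= big_distrr /=.
apply: eq_bigr => j _; rewrite -!big_distrl -!big_distrr /= mulrA; congr (_ * _).
rewrite mulrCA; congr (_ * _).
under [in RHS]eq_bigr => c _ do under eq_bigr => v _ do rewrite -sum_tree_term.
rewrite -(sum_multinomial (fun v m => m`!%:R * degree_term H j v m) (leqnn n)).
have dK v m : m`!%:R * degree_term H j v m / m`!%:R = degree_term H j v m.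
  by rewrite mulrAC mulfV ?mul1r // pnatr_eq0 -lt0n fact_gt0.
under [in RHS]eq_bigr => m _ do under eq_bigr => v _ do rewrite dK.
rewrite [RHS](bigID (fun m : {ffun 'I_k -> 'I_n.+1} => [forall v, (0 < m v)%N] &&
   [forall v, ~~ black H v ==> (m v == 1%N :> nat)])) /= [X in _ + X]big1 ?addr0; last first.
  move=> m /andP[_]; rewrite negb_and !negb_forall => /orP[] /existsP[v].
    rewrite -eqn0Ngt => /eqP mv; rewrite (bigD1 v) //= /degree_term mv.
    case: ifP => _; last by rewrite mul0r.
    rewrite (_ : (fun y => _) = fun=> 0); last by apply/funext => y; rewrite field_of0.
    by rewrite partial_cst; case: (map _ _) => [|? ?]; rewrite mul0r.
  rewrite negb_imply => /andP[bv mv]; rewrite (bigD1 v) //= /degree_term (negPf bv).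
  by rewrite (negPf mv) mul0r.
apply: eq_big => m; first by rewrite [RHS]andbC andbA.
case/and3P => _ /forallP m1 _; rewrite [LHS]big_mkcond /=; apply: eq_bigr => v _.
rewrite /degree_term; case: ifP => // bv.
by have := m1 v; rewrite bv /= => ->.
Qed.

Lemma degree_sum_pull k (s : {perm 'I_k}) (H : graph 'I_k) :
  degree_sum (pull s H) = degree_sum H.
Proof.
have sb : bijective s by exists s^-1%g; [exact: permK|exact: permKV].
rewrite /degree_sum (reindex (fun m : {ffun 'I_k -> 'I_n.+1} => [ffun v => m (s v)])) /=; last first.
  exists (fun m : {ffun 'I_k -> 'I_n.+1} => [ffun v => m (s^-1%g v)]) => m _;
    by apply/ffunP => v; rewrite !ffunE ?permK ?permKV.
apply: eq_big => m.
  congr [&& _, _ & _].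
  - apply/forallP/forallP => h v; last by rewrite ffunE.
    by have := h (s^-1%g v); rewrite ffunE permKV.
  - apply/forallP/forallP => h v.
      by have := h (s^-1%g v); rewrite ffunE (black_pull (permK s) (permKV s)) permKV.
    by rewrite ffunE (black_pull (permK s) (permKV s)).
  rewrite [in RHS](reindex_inj (@perm_inj _ s)) /=; congr (_ == _).
  by apply: eq_bigr => v _; rewrite ffunE.
move=> _; apply: (elem_diff_on_pull _ sb) => // [v|v _]; first by rewrite /= ffunE.
exact: smooth_field_of.
Qed.

Lemma S_series_formal_labeled :
  S_series_formal g a n phi x = \sum_(k < n.+1) (k`!%:R)^-1 *
    \sum_(H : graph 'I_k | is_eaf H) on_graph a H * degree_sum H.
Proof.
apply: eq_bigr => k _.
rewrite -(sum_EAF_labeled (F := fun H => on_graph a H * degree_sum H)).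
  apply: eq_bigr => t _; rewrite mulrAC; congr (_ * _ / _).
  exact: esym (on_graph_rep a (Tagged EAF_ t)).
move=> s G; rewrite degree_sum_pull on_graph_pull //.
by exists s^-1%g; [exact: permK|exact: permKV].
Qed.

Hypothesis hab : forall (t : EAF) (u : EAT),
  has_stolon t -> numbered_root u -> a t = 0 \/ b0 u = 0.

(** This is where the hypothesis on [a] and [b0] enters: a tree with a numbered
root may not be substituted at the end of a stolon. *)
Lemma stolon_weight0 k (H : graph 'I_k) (W : finType) (T : graph W) w s :
    is_eaf H -> is_eat T -> s \in stolons H -> is_root T w -> ~~ black T w ->
  on_graph a H * on_graph b T = 0.
Proof.
move=> hH eT sH rw bw; have [eafT _] := andP eT.
have [r eK rK] := enum_val_setT_can W.
have h : is_eaf (pull (@enum_val W (mem [set: W])) T) by rewrite (is_eaf_pull eK rK).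
have he : is_eat (pull (@enum_val W (mem [set: W])) T) by rewrite (is_eat_pull eK rK).
rewrite (on_graph_ord a hH) (on_graph_class b h); last by exists r.
have hs : has_stolon (eaf_class hH).
  rewrite /has_stolon; have [p ->] := rep_eaf_class hH; apply/set0Pn.
  exists (p^-1%g @: s); rewrite inE -imset_comp (eq_imset (g := id)) ?imset_id //.
  by move=> i /=; rewrite permKV.
have bE : b (eaf_class h) = b0 (eat_class he).
  rewrite /b /extend0 insubT /=; first by rewrite is_eat_class.
  move=> hc; congr b0; apply: val_inj => /=; congr eaf_class; exact: bool_irrelevance.
have hr : numbered_root (eat_class he).
  rewrite /numbered_root /=; have [p ->] := rep_eaf_class (is_eat_eaf he).
  apply/existsP; exists (p^-1%g (r w)).
  rewrite (is_root_pull (permK p) (permKV p)) (black_pull (permK p) (permKV p)) permKV.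
  by rewrite (is_root_pull eK rK) (black_pull eK rK) rK rw bw.
by rewrite bE; case: (hab hs hr) => ->; rewrite ?mul0r ?mulr0.
Qed.

(** Both sides vanish if [D] is not empty on some numbered fiber of [H], or if the
product of the coefficients is zero. Otherwise no root of [D] at the end of a
stolon is numbered and the substitution formula applies. *)
Lemma clumping_contribution k (c : {ffun 'I_n -> 'I_k}) (H : graph 'I_k) (D : graph 'I_n) :
    is_eaf H -> clumping c D ->
  on_graph a H * (\sum_(j : {ffun 'I_k -> 'I_d}) (index_compat H j)%:R *
      (\prod_v tree_term H j (restr c v D)) *
      partial [seq j r | r <- enum (roots H)] phi x) =
  \sum_(G : graph 'I_n | admissible c G D && (quot c G D == H) && is_eaf G)
     admissible_weight c G a b D * elem_diff_on G (fun=> f) phi x.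
Proof.
move=> hH clD; have clumpD : clumping_spec c D by apply/clumpingP.
have [/existsP[v /andP[nv Dv]]|] := boolP [exists v, ~~ black H v && (restr c v D != graph0 _)].
  rewrite big1 ?mulr0 => [|j _]; last first.
    by rewrite (bigD1 v) //= /tree_term (negPf nv) (negPf Dv) !(mul0r, mulr0).
  rewrite big_pred0 // => G; apply/negP => /andP[/andP[adm /eqP qH] _].
  case/and4P: adm => _ _ _ /forallP/(_ v); rewrite qH nv /=.
  by rewrite (negPf Dv).
rewrite negb_exists => /forallP D0.
have empty_nblack v : ~~ black H v -> restr c v D = graph0 _.
  by move=> nv; have := D0 v; rewrite nv /= negbK => /eqP.
pose B := \prod_(v | black H v) on_graph b (restr c v D).
transitivity (on_graph a H * B * \sum_(j : {ffun 'I_k -> 'I_d}) (index_compat H j)%:R *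
      (\prod_v clump_factor f x c D H j v) *
      partial [seq j r | r <- enum (roots H)] phi x).
  rewrite -mulrA; congr (_ * _); rewrite big_distrr /=; apply: eq_bigr => j _.
  rewrite mulrA [B * _]mulrCA; congr (_ * _ * _).
  rewrite /B [X in X * _]big_mkcond -big_split /=; apply: eq_bigr => v _.
  rewrite /tree_term /clump_factor; case: ifP => bv //.
  by rewrite empty_nblack ?bv // eqxx mul1r.
(* The graph built by an attachment need not be a forest, unless the coefficient is nonzero. *)
have [B0|Bn0] := eqVneq (on_graph a H * B) 0.
  rewrite B0 mul0r big1 // => G /andP[/andP[_ /eqP qH] _].
  by rewrite /admissible_weight qH -/B [B * _]mulrC B0 mul0r.
have [rt rtP] := clumping_root_fun clD.
rewrite (sum_substitution fs phis x clD hH empty_nblack _ rtP).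
  rewrite big_distrr /=; apply: eq_bigr => G /andP[/andP[_ /eqP qH] _].
  by rewrite /admissible_weight qH -/B [B * _]mulrC.
move=> s v w sH vs cw rw; apply: contraNT Bn0 => nw.
have bv : black H v.
  have eafH : eaf_spec H by apply/is_eafP.
  by apply: contraT => /nblackP[l lH vl]; case: (eaf_liana_stolon eafH lH vl sH vs).
have mD := clumping_mono clumpD.
have cw' : c w == v by apply/eqP.
have := @stolon_weight0 _ H _ (restr c v D) (Sub w cw') s hH (is_eat_restr v clumpD) sH.
rewrite is_root_restr // black_restr // => /(_ rw nw) ab0.
by rewrite /B (bigD1 v) //= mulrA ab0 mul0r.
Qed.

Lemma S_series_formal_star :
  S_series_formal g a n phi x = S_series f (star b0 a) n phi x.
Proof.
rewrite S_series_formal_labeled.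
transitivity ((n`!%:R)^-1 * \sum_(G : graph 'I_n | is_eaf G)
    star_on a b0 G * elem_diff_on G (fun=> f) phi x); last first.
  (* The invariance under relabeling is only available on forests. *)
  pose F (G : graph 'I_n) := if is_eaf G then
    star_on a b0 G * elem_diff_on G (fun=> f) phi x else 0.
  have -> : \sum_(G : graph 'I_n | is_eaf G) star_on a b0 G *
      elem_diff_on G (fun=> f) phi x = \sum_(G : graph 'I_n | is_eaf G) F G.
    by apply: eq_bigr => G eafG; rewrite /F eafG.
  rewrite -sum_EAF_labeled => [|s G].
    apply: eq_bigr => t _; have h : is_eaf (rep t) := valP (repr t).
    by rewrite /F h mulrAC star_rep.
  rewrite /F (is_eaf_pull (permK s) (permKV s)); case: ifP => // eafG.
  have sb : bijective s by exists s^-1%g; [exact: permK|exact: permKV].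
  by rewrite star_on_pull // (elem_diff_on_pull _ sb (f := fun=> f)).
transitivity (\sum_(k < n.+1) (k`!%:R)^-1 * ((n`!%:R)^-1 * \sum_(c : {ffun 'I_n -> 'I_k})
   \sum_(G : graph 'I_n | is_eaf G) \sum_(D : graph 'I_n | admissible c G D)
     admissible_weight c G a b D * elem_diff_on G (fun=> f) phi x)).
  apply: eq_bigr => k _; congr (_ * _).
  under eq_bigr => H _ do rewrite degree_sumE mulrCA.
  rewrite -big_distrr /=; congr (_ * _).
  under eq_bigr => H _ do rewrite big_distrr /=.
  rewrite exchange_big /=; apply: eq_bigr => c _.
  transitivity (\sum_(H : graph 'I_k | is_eaf H) \sum_(D : graph 'I_n | clumping c D)
     \sum_(G : graph 'I_n | admissible c G D && (quot c G D == H) && is_eaf G)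
     admissible_weight c G a b D * elem_diff_on G (fun=> f) phi x).
    apply: eq_bigr => H hH.
    under [in RHS]eq_bigr => D clD do rewrite -clumping_contribution //.
    rewrite -big_distrr /=; congr (_ * _); rewrite [RHS]exchange_big /=.
    apply: eq_bigr => j _; rewrite -big_distrl -big_distrr /=; congr (_ * _ * _).
    apply: (prod_sum_glue (res := fun v D => restr c v D) (glue := @glue _ _ c)) => //.
    - by move=> T; exact: glue_clumping.
    - by move=> T v eT; exact: restr_glue.
    - by move=> D /clumpingP clD v; exact: is_eat_restr.
    - by move=> D T clD; exact: glue_restr.
  rewrite (exchange_big_dep (clumping c)) //=.
  rewrite [RHS](exchange_big_dep (clumping c)) /=; last by move=> G D _ /andP[].
  apply: eq_bigr => D clD; rewrite (exchange_big_dep (@is_eaf 'I_n)) /=; last first.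
    by move=> H G _ /andP[].
  rewrite [RHS]big_mkcondr /=; apply: eq_bigr => G hG.
  case: ifP => [adm|nadm]; last first.
    by rewrite big_pred0 // => H; rewrite andbF.
  rewrite (big_pred1 (quot c G D)) // => H; rewrite hG clD !andbT /=.
  by rewrite [RHS]eq_sym; case: eqP => [<-|]; rewrite ?andbF // andbT; case/and4P: adm.
transitivity ((n`!%:R)^-1 * \sum_(G : graph 'I_n | is_eaf G)
  \sum_(k < n.+1) (k`!%:R)^-1 * \sum_(c : {ffun 'I_n -> 'I_k})
    \sum_(D : graph 'I_n | admissible c G D)
     admissible_weight c G a b D * elem_diff_on G (fun=> f) phi x).
  rewrite [in RHS]exchange_big big_distrr /=; apply: eq_bigr => k _.
  rewrite mulrCA; congr (_ * _); rewrite -big_distrr /=; congr (_ * _).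
  by rewrite exchange_big.
congr (_ * _); apply: eq_bigr => G hG; rewrite star_on_sum // card_ord big_distrl /=.
apply: eq_bigr => k _; rewrite -mulrA; congr (_ * _); rewrite big_distrl /=.
by apply: eq_bigr => c _; rewrite big_distrl.
Qed.
End Fixed.
End Assembly.

Theorem theorem2p8 (R : realType) (d : nat)
    (f : 'rV[R]_d -> 'rV[R]_d) (hf : smooth_field f)
    (a : EAF -> R) (b0 : EAT -> R)
    (hab : forall (t : EAF) (u : EAT),
       has_stolon t -> numbered_root u -> a t = 0 \/ b0 u = 0)
    (n : nat) (phi : 'rV[R]_d -> R) (hphi : smooth phi) (x : 'rV[R]_d) :
  S_series_formal (field_of (S_series f (extend0 b0))) a n phi x =
  S_series f (star b0 a) n phi x.
Proof. exact: (S_series_formal_star hf n hphi x hab). Qed.
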